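(* For $(A,\lambda_A)$ in $\mathrm{C}_{\mathcal O}(c)$ there is a natural isomorphism of graded $\mathcal O$-algebras $$\bigwedge_{\mathcal O}\operatorname{Hom}_{\mathcal O}(\mathfrak p_A/\mathfrak p_A^2,\mathcal O)\;\cong\;\operatorname{Ext}^*_A(\mathcal O,\mathcal O)^{\mathrm{tf}}.$$
   Context: $\mathcal O$ is a discrete valuation ring. For an $\mathcal O$-module $U$, $U^{\mathrm{tf}}$ is the quotient of $U$ by its torsion submodule; for a graded module this is applied degreewise. $\mathrm{C}_{\mathcal O}(c)$ is the category of pairs $(A,\lambda_A)$ where $A$ is a complete noetherian local $\mathcal O$-algebra and $\lambda_A\colon A\to\mathcal O$ is a surjective map of $\mathcal O$-algebras such that, with $\mathfrak p_A:=\operatorname{Ker}\lambda_A$, the local ring $A_{\mathfrak p_A}$ is regular of Krull dimension $c$. $\mathcal O$ is an $A$-module via $\lambda_A$. Morphisms in the category are local $\mathcal O$-algebra maps compatible with the augmentations. $\operatorname{Ext}^*_A(\mathcal O,\mathcal O)$ is the Yoneda Ext-algebra (composition product), and its torsion-free quotient carries the induced algebra structure. The exterior algebra is graded with $\operatorname{Hom}_{\mathcal O}(\mathfrak p_A/\mathfrak p_A^2,\mathcal O)$ in degree one. In degree one the isomorphism is induced by the natural identification $\operatorname{Hom}_{\mathcal O}(\mathfrak p_A/\mathfrak p_A^2,\mathcal O)\cong\operatorname{Hom}_A(\mathfrak p_A,\mathcal O)\cong\operatorname{Ext}^1_A(\mathcal O,\mathcal O)$. *)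

(* Defs.v *)
From HB Require Import structures.
From mathcomp Require Import all_boot all_order all_algebra.
From mathcomp Require Import ring.
From mathcomp Require Import boolp classical_sets functions.

Set Implicit Arguments.
Unset Strict Implicit.
Unset Printing Implicit Defensive.

Import GRing.Theory.
Local Open Scope quotient_scope.
Local Open Scope ring_scope.

Record submod (R : pzRingType) (V : lmodType R) := Submod {
  submod_set :> V -> Prop;
  submod0 : submod_set 0;
  submodP : forall a u v,
    submod_set u -> submod_set v -> submod_set (a *: u + v) }.

Section Submodule.
Variables (R : pzRingType) (V : lmodType R) (S : submod V).

Definition in_submod : pred V := fun x => `[< S x >].

Lemma submodD u v : S u -> S v -> S (u + v).
Proof. by move=> Su Sv; rewrite -[u]scale1r; apply: submodP. Qed.

Lemma submodZ a u : S u -> S (a *: u).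
Proof. by move=> Su; rewrite -[_ *: _]addr0; apply: submodP => //; apply: submod0. Qed.

Lemma submodN u : S u -> S (- u).
Proof. by move=> Su; rewrite -scaleN1r; apply: submodZ. Qed.

Lemma in_submod_closed : subsemimod_closed in_submod.
Proof.
split; first split.
- exact/asboolP/submod0.
- by move=> u v /asboolP Su /asboolP Sv; apply/asboolP/submodD.
- by move=> a u /asboolP Su; apply/asboolP/submodZ.
Qed.

Definition submod_type := {x : V | in_submod x}.
HB.instance Definition _ := SubChoice.on submod_type.
HB.instance Definition _ :=
  GRing.SubChoice_isSubLmodule.Build R V in_submod submod_type in_submod_closed.

Definition to_submod (x : V) (Sx : S x) : submod_type :=
  exist _ x (introT (asboolP _) Sx).

Lemma submod_typeP (x : submod_type) : S (val x).
Proof. exact/asboolP/(valP x). Qed.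

Definition qmod_rel (x y : V) : bool := `[< S (x - y) >].

Lemma qmod_rel_equiv : equiv_class_of qmod_rel.
Proof.
split=> [x|x y|y x z].
- by apply/asboolP; rewrite subrr; apply: submod0.
- by apply/asboolP/asboolP => /submodN; rewrite opprB.
- move=> /asboolP Sxy /asboolP Syz; apply/asboolP.
  by rewrite -[x](subrK y) -addrA; apply: submodD.
Qed.

Canonical qmod_equiv := EquivRelPack qmod_rel_equiv.
Canonical qmod_enc := defaultEncModRel qmod_rel.

Definition qmod := {eq_quot qmod_rel}.
HB.instance Definition _ : EqQuotient V qmod_rel qmod := EqQuotient.on qmod.
HB.instance Definition _ := Choice.on qmod.

Definition qmod_pi (x : V) : qmod := \pi_qmod x.

Lemma qmod_eqP x y : qmod_pi x = qmod_pi y <-> S (x - y).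
Proof.
split=> [/eqP|Sxy]; first by rewrite piE => /asboolP.
by apply/eqP; rewrite piE; apply/asboolP.
Qed.

Lemma qmod_reprK (x : qmod) : qmod_pi (repr x) = x.
Proof. exact: reprK. Qed.

Lemma qmod_repr x : S (repr (qmod_pi x) - x).
Proof. by apply/qmod_eqP; rewrite qmod_reprK. Qed.

Definition qmod_zero := qmod_pi 0.
Definition qmod_add (x y : qmod) : qmod := qmod_pi (repr x + repr y).
Definition qmod_opp (x : qmod) : qmod := qmod_pi (- repr x).
Definition qmod_scale a (x : qmod) : qmod := qmod_pi (a *: repr x).

Lemma qmod_addE x y : qmod_add (qmod_pi x) (qmod_pi y) = qmod_pi (x + y).
Proof. by apply/qmod_eqP; rewrite opprD addrACA; apply: submodD; apply: qmod_repr. Qed.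

Lemma qmod_oppE x : qmod_opp (qmod_pi x) = qmod_pi (- x).
Proof. by apply/qmod_eqP; rewrite -opprD; apply/submodN/qmod_repr. Qed.

Lemma qmod_scaleE a x : qmod_scale a (qmod_pi x) = qmod_pi (a *: x).
Proof. by apply/qmod_eqP; rewrite -scalerBr; apply/submodZ/qmod_repr. Qed.

Let qmodW (Q : qmod -> Prop) : (forall x, Q (qmod_pi x)) -> forall x, Q x.
Proof. by move=> H x; rewrite -[x]qmod_reprK. Qed.

Let qmod_addA : associative qmod_add.
Proof.
by elim/qmodW=> x; elim/qmodW=> y; elim/qmodW=> z; rewrite !qmod_addE addrA.
Qed.
Let qmod_addC : commutative qmod_add.
Proof. by elim/qmodW=> x; elim/qmodW=> y; rewrite !qmod_addE addrC. Qed.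
Let qmod_add0 : left_id qmod_zero qmod_add.
Proof. by elim/qmodW=> x; rewrite qmod_addE add0r. Qed.
Let qmod_addN : left_inverse qmod_zero qmod_opp qmod_add.
Proof. by elim/qmodW=> x; rewrite qmod_oppE qmod_addE addNr. Qed.

HB.instance Definition _ :=
  GRing.isZmodule.Build qmod qmod_addA qmod_addC qmod_add0 qmod_addN.

Let qmod_scaleA a b x : qmod_scale a (qmod_scale b x) = qmod_scale (a * b) x.
Proof. by elim/qmodW: x => x; rewrite !qmod_scaleE scalerA. Qed.
Let qmod_scale1 : left_id 1 qmod_scale.
Proof. by elim/qmodW=> x; rewrite qmod_scaleE scale1r. Qed.
Let qmod_scaleDr : right_distributive qmod_scale +%R.
Proof.
move=> a; elim/qmodW=> x; elim/qmodW=> y.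
by rewrite [_ + _]qmod_addE !qmod_scaleE [RHS]qmod_addE scalerDr.
Qed.
Let qmod_scaleDl x : {morph qmod_scale^~ x : a b / a + b}.
Proof.
by elim/qmodW: x => x a b; rewrite !qmod_scaleE [RHS]qmod_addE scalerDl.
Qed.

HB.instance Definition _ := GRing.Zmodule_isLmodule.Build R qmod
  qmod_scaleA qmod_scale1 qmod_scaleDr qmod_scaleDl.

Lemma qmod_pi_linear : linear qmod_pi.
Proof. by move=> a x y; rewrite -qmod_addE -qmod_scaleE. Qed.
HB.instance Definition _ := GRing.isLinear.Build R V qmod _ qmod_pi qmod_pi_linear.

Lemma qmodP (Q : qmod -> Prop) : (forall x, Q (qmod_pi x)) -> forall x, Q x.
Proof. exact: qmodW. Qed.

End Submodule.

Section Dual.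
Variables (R : comNzRingType) (V : lmodType R).

Lemma dual_submod0 : linear (0 : V -> R^o).
Proof. by move=> a x y; rewrite [RHS]addr0 [RHS]scaler0. Qed.

Lemma dual_submodP (a : R) (f g : V -> R^o) :
  linear f -> linear g -> linear (a *: f + g).
Proof.
move=> lf lg b x y; have E z : (a *: f + g) z = a *: f z + g z by [].
by rewrite !E lf lg !scalerDr !scalerA mulrC addrACA.
Qed.

Definition dual_submod : submod (V -> R^o) := Submod dual_submod0 dual_submodP.
Definition dual : lmodType R := submod_type dual_submod.

Definition dual_app (f : dual) (x : V) : R := val f x.

End Dual.

Section DualMap.
Variables (R : comNzRingType) (V W : lmodType R) (g : {linear V -> W}).

Lemma dual_map_subproof (f : dual W) : dual_submod V (fun x => dual_app f (g x)).
Proof. by move=> a x y; rewrite linearP; apply: (submod_typeP f). Qed.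

Definition dual_map (f : dual W) : dual V := to_submod (dual_map_subproof f).

Lemma dual_map_linear : linear dual_map.
Proof. by move=> a f h; apply: val_inj. Qed.
HB.instance Definition _ :=
  GRing.isLinear.Build R (dual W) (dual V) _ dual_map dual_map_linear.

End DualMap.

Section Torsion.
Variables (R : idomainType) (V : lmodType R).

Definition torsion_set (x : V) : Prop := exists2 a : R, a != 0 & a *: x = 0.

Lemma torsion0 : torsion_set 0.
Proof. by exists 1; rewrite ?oner_neq0 ?scaler0. Qed.

Lemma torsionP a x y : torsion_set x -> torsion_set y -> torsion_set (a *: x + y).
Proof.
move=> [b b0 bx] [c c0 cy]; exists (b * c); first by rewrite mulf_neq0.
have -> : (b * c) *: (a *: x + y) = (c * a) *: (b *: x) + b *: (c *: y).
  by rewrite scalerDr !scalerA; congr (_ *: _ + _); ring.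
by rewrite bx cy !scaler0 addr0.
Qed.

Definition torsion : submod V := Submod torsion0 torsionP.

End Torsion.

Section Ideals.
Variable R : comNzRingType.
Implicit Types (I p m : set R).
Local Open Scope classical_set_scope.

Definition ideal I : Prop :=
  [/\ I 0, (forall x y, I x -> I y -> I (x + y)) & (forall a x, I x -> I (a * x))].

Definition ideal_gen (s : seq R) : set R :=
  [set x | exists c : 'I_(size s) -> R, x = \sum_i c i * s`_i].

Definition noetherian : Prop := forall I, ideal I -> exists s, I = ideal_gen s.

Definition prime_ideal p : Prop :=
  [/\ ideal p, ~ p 1 & forall x y, p (x * y) -> p x \/ p y].

Definition maximal_ideal m : Prop :=
  [/\ ideal m, ~ m 1 & forall I, ideal I -> m `<=` I -> ~ I 1 -> I = m].

Definition local_ring : Prop := exists! m, maximal_ideal m.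

Definition ideal_exp I (n : nat) : set R :=
  [set x | exists k (c : 'I_k -> R) (t : 'I_k -> 'I_n -> R),
     (forall i j, I (t i j)) /\ x = \sum_(i < k) c i * \prod_(j < n) t i j].

(* Bijectivity of R -> lim R / I^n, a point of the limit being given by a
   sequence of representatives. *)
Definition adically_complete I : Prop :=
  (forall x, (forall n, ideal_exp I n x) -> x = 0) /\
  (forall u : nat -> R, (forall n, ideal_exp I n (u n.+1 - u n)) ->
     exists x, forall n, ideal_exp I n (x - u n)).

Definition complete_local_ring : Prop :=
  local_ring /\ forall m, maximal_ideal m -> adically_complete m.

Definition prime_chain (n : nat) : Prop :=
  exists q : nat -> set R,
    (forall i, (i <= n)%N -> prime_ideal (q i)) /\
    (forall i, (i < n)%N -> q i `<` q i.+1).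

Definition krull_dim (d : nat) : Prop :=
  prime_chain d /\ forall n, prime_chain n -> (n <= d)%N.

Definition regular_local_ring (d : nat) : Prop :=
  [/\ noetherian, local_ring, krull_dim d &
      forall m, maximal_ideal m -> exists s, size s = d /\ m = ideal_gen s].

End Ideals.

Definition is_dvr (R : idomainType) : Prop :=
  [/\ local_ring R,
      (forall I : set R, ideal I -> exists a, I = ideal_gen [:: a]) &
      exists a : R, a != 0 /\ a \isn't a GRing.unit].

Section Localization.
Variables (R : comNzRingType) (p : set R) (p_prime : prime_ideal p).

Record frac := Frac { fnum : R; fden : R; fdenP : ~ p fden }.
Arguments fdenP : clear implicits.
HB.instance Definition _ := gen_eqMixin frac.
HB.instance Definition _ := gen_choiceMixin frac.

Lemma notin_prime1 : ~ p 1. Proof. by case: p_prime. Qed.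

Lemma notin_primeM x y : ~ p x -> ~ p y -> ~ p (x * y).
Proof. by case: p_prime => _ _ pM px py /pM[]. Qed.

Lemma prime0 : p 0. Proof. by case: p_prime => -[]. Qed.

Definition frac_eq (x y : frac) : Prop :=
  exists2 u, ~ p u & u * (fnum x * fden y - fnum y * fden x) = 0.

Definition frac_rel (x y : frac) : bool := `[< frac_eq x y >].

Lemma frac_rel_equiv : equiv_class_of frac_rel.
Proof.
have fsym x y : frac_eq x y -> frac_eq y x.
  by move=> [u pu e]; exists u => //; rewrite -opprB mulrN e oppr0.
split=> [x|x y|y x z].
- by apply/asboolP; exists 1; [apply: notin_prime1 | rewrite subrr mulr0].
- by apply/asboolP/asboolP; apply: fsym.
- move=> /asboolP[u pu e] /asboolP[v pv e']; apply/asboolP.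
  exists (u * v * fden y); first exact: (notin_primeM (notin_primeM pu pv) (fdenP y)).
  have -> : u * v * fden y * (fnum x * fden z - fnum z * fden x) =
    v * fden z * (u * (fnum x * fden y - fnum y * fden x)) +
    u * fden x * (v * (fnum y * fden z - fnum z * fden y)) by ring.
  by rewrite e e' !mulr0 addr0.
Qed.

Canonical frac_equiv := EquivRelPack frac_rel_equiv.
Canonical frac_enc := defaultEncModRel frac_rel.

Definition loc := {eq_quot frac_rel}.
HB.instance Definition _ : EqQuotient frac frac_rel loc := EqQuotient.on loc.
HB.instance Definition _ := Choice.on loc.

Definition loc_pi (x : frac) : loc := \pi_loc x.

Lemma loc_eqP x y : loc_pi x = loc_pi y <-> frac_eq x y.
Proof.
split=> [/eqP|xy]; first by rewrite piE => /asboolP.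
by apply/eqP; rewrite piE; apply/asboolP.
Qed.

Lemma loc_reprK (x : loc) : loc_pi (repr x) = x.
Proof. exact: reprK. Qed.

Lemma loc_repr x : frac_eq (repr (loc_pi x)) x.
Proof. by apply/loc_eqP; rewrite loc_reprK. Qed.

Lemma locP (Q : loc -> Prop) : (forall x, Q (loc_pi x)) -> forall x, Q x.
Proof. by move=> H x; rewrite -[x]loc_reprK. Qed.

Definition frac_of (a : R) : frac := Frac a notin_prime1.
Definition frac_add (x y : frac) : frac :=
  Frac (fnum x * fden y + fnum y * fden x) (notin_primeM (fdenP x) (fdenP y)).
Definition frac_mul (x y : frac) : frac :=
  Frac (fnum x * fnum y) (notin_primeM (fdenP x) (fdenP y)).
Definition frac_opp (x : frac) : frac := Frac (- fnum x) (fdenP x).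

Definition loc_add (x y : loc) : loc := loc_pi (frac_add (repr x) (repr y)).
Definition loc_mul (x y : loc) : loc := loc_pi (frac_mul (repr x) (repr y)).
Definition loc_opp (x : loc) : loc := loc_pi (frac_opp (repr x)).

Lemma loc_addE x y : loc_add (loc_pi x) (loc_pi y) = loc_pi (frac_add x y).
Proof.
apply/loc_eqP; move: (loc_repr x) (loc_repr y).
move: (repr (loc_pi x)) (repr (loc_pi y)) => x' y' [u pu e] [v pv e'].
exists (u * v); first exact: notin_primeM.
rewrite /=; have -> : u * v * ((fnum x' * fden y' + fnum y' * fden x') * (fden x * fden y) -
   (fnum x * fden y + fnum y * fden x) * (fden x' * fden y')) =
   v * fden y * fden y' * (u * (fnum x' * fden x - fnum x * fden x')) +
   u * fden x * fden x' * (v * (fnum y' * fden y - fnum y * fden y')) by ring.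
by rewrite e e' !mulr0 addr0.
Qed.

Lemma loc_mulE x y : loc_mul (loc_pi x) (loc_pi y) = loc_pi (frac_mul x y).
Proof.
apply/loc_eqP; move: (loc_repr x) (loc_repr y).
move: (repr (loc_pi x)) (repr (loc_pi y)) => x' y' [u pu e] [v pv e'].
exists (u * v); first exact: notin_primeM.
rewrite /=; have -> : u * v * (fnum x' * fnum y' * (fden x * fden y) -
   fnum x * fnum y * (fden x' * fden y')) =
   v * fnum y' * fden y * (u * (fnum x' * fden x - fnum x * fden x')) +
   u * fnum x * fden x' * (v * (fnum y' * fden y - fnum y * fden y')) by ring.
by rewrite e e' !mulr0 addr0.
Qed.

Lemma loc_oppE x : loc_opp (loc_pi x) = loc_pi (frac_opp x).
Proof.
apply/loc_eqP; move: (loc_repr x); move: (repr (loc_pi x)) => x' [u pu e].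
exists u => //=; rewrite -[RHS]oppr0 -e; ring.
Qed.

Let frac_eqW x y : fnum x * fden y = fnum y * fden x -> loc_pi x = loc_pi y.
Proof.
move=> e; apply/loc_eqP; exists 1; first exact: notin_prime1.
by rewrite e subrr mulr0.
Qed.

Let addA : associative loc_add.
Proof.
elim/locP=> x; elim/locP=> y; elim/locP=> z; rewrite !loc_addE.
by apply: frac_eqW => /=; ring.
Qed.
Let addC : commutative loc_add.
Proof. by elim/locP=> x; elim/locP=> y; rewrite !loc_addE; apply: frac_eqW => /=; ring. Qed.
Let add0 : left_id (loc_pi (frac_of 0)) loc_add.
Proof. by elim/locP=> x; rewrite !loc_addE; apply: frac_eqW => /=; ring. Qed.
Let addN : left_inverse (loc_pi (frac_of 0)) loc_opp loc_add.
Proof. by elim/locP=> x; rewrite loc_oppE loc_addE; apply: frac_eqW => /=; ring. Qed.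

HB.instance Definition _ := GRing.isZmodule.Build loc addA addC add0 addN.

Let mulA : associative loc_mul.
Proof.
elim/locP=> x; elim/locP=> y; elim/locP=> z; rewrite !loc_mulE.
by apply: frac_eqW => /=; ring.
Qed.
Let mulC : commutative loc_mul.
Proof. by elim/locP=> x; elim/locP=> y; rewrite !loc_mulE; apply: frac_eqW => /=; ring. Qed.
Let mul1 : left_id (loc_pi (frac_of 1)) loc_mul.
Proof. by elim/locP=> x; rewrite !loc_mulE; apply: frac_eqW => /=; ring. Qed.
Let mulDl : left_distributive loc_mul +%R.
Proof.
elim/locP=> x; elim/locP=> y; elim/locP=> z.
rewrite [_ + _]loc_addE !loc_mulE [RHS]loc_addE.
by apply: frac_eqW => /=; ring.
Qed.
Let one_neq0 : loc_pi (frac_of 1) != 0.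
Proof.
apply/eqP => /loc_eqP[u pu /=]; rewrite !mulr1 subr0 mulr1 => u0.
by apply: pu; rewrite u0; apply: prime0.
Qed.

HB.instance Definition _ :=
  GRing.Zmodule_isComNzRing.Build loc mulA mulC mul1 mulDl one_neq0.

End Localization.

Section IdealPowers.
Variables (R : comNzRingType) (I : set R) (n : nat).

Lemma ideal_exp_ideal : ideal (ideal_exp I n).
Proof.
split=> [|x y|a x].
- by exists 0%N, (fun=> 0), (fun _ _ => 0); rewrite big_ord0; split=> // -[].
- move=> [k [c [t [It ->]]]] [l [d [s [Is ->]]]].
  exists (k + l)%N, (fun i => match fintype.split i with inl i => c i | inr i => d i end),
    (fun i => match fintype.split i with inl i => t i | inr i => s i end).
  split=> [i j|]; first by case: (fintype.split i).
  rewrite big_split_ord /=; congr (_ + _); apply: eq_bigr => i _.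
    by rewrite (unsplitK (inl i)).
  by rewrite (unsplitK (inr i)).
- move=> [k [c [t [It ->]]]]; exists k, (fun i => a * c i), t; split=> //.
  by rewrite mulr_sumr; apply: eq_bigr => i _; rewrite mulrA.
Qed.

End IdealPowers.

(* The product is indexed by a proof of k = m + n, which keeps associativity
   and the unit laws free of transports. *)
Record gradedAlg (R : comNzRingType) := GradedAlg {
  gcomp :> nat -> lmodType R;
  gone : gcomp 0;
  gmul : forall m n k, k = (m + n)%N -> gcomp m -> gcomp n -> gcomp k;
  gmulPl : forall m n k (e : k = (m + n)%N) a x y z,
    gmul e (a *: x + y) z = a *: gmul e x z + gmul e y z;
  gmulPr : forall m n k (e : k = (m + n)%N) a x y z,
    gmul e x (a *: y + z) = a *: gmul e x y + gmul e x z;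
  gmulA : forall m n p mn np k (e1 : mn = (m + n)%N) (e2 : k = (mn + p)%N)
    (e3 : np = (n + p)%N) (e4 : k = (m + np)%N) x y z,
    gmul e2 (gmul e1 x y) z = gmul e4 x (gmul e3 y z);
  gmul1l : forall n (e : n = (0 + n)%N) x, gmul e gone x = x;
  gmul1r : forall n (e : n = (n + 0)%N) x, gmul e x gone = x }.

Section GradedTheory.
Variables (R : comNzRingType) (E : gradedAlg R).
Variables (m n k : nat) (e : k = (m + n)%N).
Implicit Types (x : E m) (y : E n).

Lemma gmulDl x x' y : gmul e (x + x') y = gmul e x y + gmul e x' y.
Proof. by have := gmulPl e 1 x x' y; rewrite !scale1r. Qed.

Lemma gmulDr x y y' : gmul e x (y + y') = gmul e x y + gmul e x y'.
Proof. by have := gmulPr e 1 x y y'; rewrite !scale1r. Qed.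

Lemma gmul0l y : gmul e (0 : E m) y = 0.
Proof. by apply: (addrI (gmul e 0 y)); rewrite -gmulDl !addr0. Qed.

Lemma gmul0r x : gmul e x (0 : E n) = 0.
Proof. by apply: (addrI (gmul e x 0)); rewrite -gmulDr !addr0. Qed.

Lemma gmulZl a x y : gmul e (a *: x) y = a *: gmul e x y.
Proof. by rewrite -[a *: x]addr0 gmulPl gmul0l addr0. Qed.

Lemma gmulZr a x y : gmul e x (a *: y) = a *: gmul e x y.
Proof. by rewrite -[a *: y]addr0 gmulPr gmul0r addr0. Qed.

End GradedTheory.

Record gradedIso (R : comNzRingType) (E F : gradedAlg R) := GradedIso {
  giso :> forall n, {linear E n -> F n};
  giso_bij : forall n, bijective (giso n);
  giso1 : giso 0 (gone E) = gone F;
  gisoM : forall m n k (e : k = (m + n)%N) (x : E m) (y : E n),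
    giso k (gmul e x y) = gmul e (giso m x) (giso n y) }.

Section TorsionFree.
Variables (R : idomainType) (E : gradedAlg R).

Definition tf_comp n : lmodType R := qmod (torsion (E n)).
Definition tf_pi n (x : E n) : tf_comp n := qmod_pi (torsion (E n)) x.
Definition tf_one : tf_comp 0 := tf_pi (gone E).
Definition tf_mul m n k (e : k = (m + n)%N) (x : tf_comp m) (y : tf_comp n) :
  tf_comp k := tf_pi (gmul e (repr x) (repr y)).

Lemma tf_mulE m n k (e : k = (m + n)%N) x y :
  tf_mul e (tf_pi x) (tf_pi y) = tf_pi (gmul e x y).
Proof.
apply/qmod_eqP.
have [a a0 ax] := qmod_repr (torsion (E m)) x.
have [b b0 by_] := qmod_repr (torsion (E n)) y.
rewrite -[repr _](subrK x) -[repr (tf_pi y)](subrK y).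
move: (_ - x) (_ - y) ax by_ => u v au bv.
exists (a * b); first by rewrite mulf_neq0.
have Zu w : (a * b) *: gmul e u w = 0.
  by rewrite mulrC -scalerA -gmulZl au gmul0l scaler0.
have Zv w : (a * b) *: gmul e w v = 0 by rewrite -scalerA -gmulZr bv gmul0r scaler0.
by rewrite gmulDl (gmulDr e x) addrA addrK scalerDr Zu Zv addr0.
Qed.

Lemma tf_pi_linear n : linear (@tf_pi n).
Proof. exact: qmod_pi_linear. Qed.
HB.instance Definition _ n :=
  GRing.isLinear.Build R (E n) (tf_comp n) _ (@tf_pi n) (@tf_pi_linear n).

Lemma tfP n (Q : tf_comp n -> Prop) : (forall x, Q (tf_pi x)) -> forall x, Q x.
Proof. exact: qmodP. Qed.

Definition tf_alg : gradedAlg R.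
Proof.
refine (@GradedAlg R tf_comp tf_one tf_mul _ _ _ _ _).
- move=> m n k e a; elim/tfP=> x; elim/tfP=> y; elim/tfP=> z.
  by rewrite -tf_pi_linear tf_mulE gmulPl tf_pi_linear -!tf_mulE.
- move=> m n k e a; elim/tfP=> x; elim/tfP=> y; elim/tfP=> z.
  by rewrite -tf_pi_linear tf_mulE gmulPr tf_pi_linear -!tf_mulE.
- move=> m n p mn np k e1 e2 e3 e4; elim/tfP=> x; elim/tfP=> y; elim/tfP=> z.
  by rewrite !tf_mulE (gmulA e1 e2 e3 e4).
- by move=> n e; elim/tfP=> x; rewrite tf_mulE gmul1l.
- by move=> n e; elim/tfP=> x; rewrite tf_mulE gmul1r.
Defined.

End TorsionFree.

(* T(V) modulo the two-sided ideal generated by the squares v v, degree by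
   degree: homogeneous words in the generators modulo the congruence generated
   by the axioms of graded algebras, the linearity of V -> T(V) and v v = 0. *)
Section ExteriorTerms.
Variables (R : comNzRingType) (V : lmodType R).

Inductive wedge_term : nat -> Type :=
| WGen (v : V) : wedge_term 1
| WOne : wedge_term 0
| WZero n : wedge_term n
| WAdd n (s t : wedge_term n) : wedge_term n
| WScale n (a : R) (t : wedge_term n) : wedge_term n
| WMul m n k (e : k = (m + n)%N) (s : wedge_term m) (t : wedge_term n) : wedge_term k.

Inductive wedge_eq : forall n, wedge_term n -> wedge_term n -> Prop :=
| we_refl n (t : wedge_term n) : wedge_eq t t
| we_sym n (s t : wedge_term n) : wedge_eq s t -> wedge_eq t s
| we_trans n (s t u : wedge_term n) : wedge_eq s t -> wedge_eq t u -> wedge_eq s u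
| we_add n (s s' t t' : wedge_term n) :
    wedge_eq s s' -> wedge_eq t t' -> wedge_eq (WAdd s t) (WAdd s' t')
| we_scale n a (t t' : wedge_term n) :
    wedge_eq t t' -> wedge_eq (WScale a t) (WScale a t')
| we_mul m n k (e : k = (m + n)%N) (s s' : wedge_term m) (t t' : wedge_term n) :
    wedge_eq s s' -> wedge_eq t t' -> wedge_eq (WMul e s t) (WMul e s' t')
| we_addA n (s t u : wedge_term n) :
    wedge_eq (WAdd s (WAdd t u)) (WAdd (WAdd s t) u)
| we_addC n (s t : wedge_term n) : wedge_eq (WAdd s t) (WAdd t s)
| we_add0 n (t : wedge_term n) : wedge_eq (WAdd (WZero n) t) t
| we_scaleA n a b (t : wedge_term n) :
    wedge_eq (WScale a (WScale b t)) (WScale (a * b) t)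
| we_scale0 n (t : wedge_term n) : wedge_eq (WScale 0 t) (WZero n)
| we_scale1 n (t : wedge_term n) : wedge_eq (WScale 1 t) t
| we_scaleDr n a (s t : wedge_term n) :
    wedge_eq (WScale a (WAdd s t)) (WAdd (WScale a s) (WScale a t))
| we_scaleDl n a b (t : wedge_term n) :
    wedge_eq (WScale (a + b) t) (WAdd (WScale a t) (WScale b t))
| we_mulPl m n k (e : k = (m + n)%N) a (x y : wedge_term m) (z : wedge_term n) :
    wedge_eq (WMul e (WAdd (WScale a x) y) z)
           (WAdd (WScale a (WMul e x z)) (WMul e y z))
| we_mulPr m n k (e : k = (m + n)%N) a (x : wedge_term m) (y z : wedge_term n) :
    wedge_eq (WMul e x (WAdd (WScale a y) z))
           (WAdd (WScale a (WMul e x y)) (WMul e x z))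
| we_mulA m n p mn np k (e1 : mn = (m + n)%N) (e2 : k = (mn + p)%N)
    (e3 : np = (n + p)%N) (e4 : k = (m + np)%N)
    (x : wedge_term m) (y : wedge_term n) (z : wedge_term p) :
    wedge_eq (WMul e2 (WMul e1 x y) z) (WMul e4 x (WMul e3 y z))
| we_mul1l n (e : n = (0 + n)%N) (x : wedge_term n) : wedge_eq (WMul e WOne x) x
| we_mul1r n (e : n = (n + 0)%N) (x : wedge_term n) : wedge_eq (WMul e x WOne) x
| we_gen a (v w : V) :
    wedge_eq (WGen (a *: v + w)) (WAdd (WScale a (WGen v)) (WGen w))
| we_sqr (e : 2%N = (1 + 1)%N) (v : V) :
    wedge_eq (WMul e (WGen v) (WGen v)) (WZero 2).

HB.instance Definition _ n := gen_eqMixin (wedge_term n).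
HB.instance Definition _ n := gen_choiceMixin (wedge_term n).

Definition wedge_rel n (s t : wedge_term n) : bool := `[< wedge_eq s t >].

Lemma wedge_rel_equiv n : equiv_class_of (@wedge_rel n).
Proof.
split=> [x|x y|y x z].
- exact/asboolP/we_refl.
- by apply/asboolP/asboolP => /we_sym.
- by move=> /asboolP xy /asboolP yz; apply/asboolP/(we_trans xy).
Qed.

Canonical wedge_equiv n := EquivRelPack (wedge_rel_equiv n).
Canonical wedge_enc n := defaultEncModRel (@wedge_rel n).

Definition wedge n := {eq_quot (@wedge_rel n)}.
HB.instance Definition _ n : EqQuotient _ (@wedge_rel n) (wedge n) := EqQuotient.on (wedge n).
HB.instance Definition _ n := Choice.on (wedge n).

Definition wedge_pi n (t : wedge_term n) : wedge n := \pi_(wedge n) t.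

Lemma wedge_eqP n (s t : wedge_term n) : wedge_pi s = wedge_pi t <-> wedge_eq s t.
Proof.
split=> [/eqP|st]; first by rewrite piE => /asboolP.
by apply/eqP; rewrite piE; apply/asboolP.
Qed.

Lemma wedge_reprK n (x : wedge n) : wedge_pi (repr x) = x.
Proof. exact: reprK. Qed.

Lemma wedge_repr n (t : wedge_term n) : wedge_eq (repr (wedge_pi t)) t.
Proof. by apply/wedge_eqP; rewrite wedge_reprK. Qed.

Lemma wedgeP n (Q : wedge n -> Prop) : (forall t, Q (wedge_pi t)) -> forall x, Q x.
Proof. by move=> H x; rewrite -[x]wedge_reprK. Qed.

Definition wedge_gen v : wedge 1 := wedge_pi (WGen v).
Definition wedge_add n (x y : wedge n) : wedge n := wedge_pi (WAdd (repr x) (repr y)).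
Definition wedge_scale n a (x : wedge n) : wedge n := wedge_pi (WScale a (repr x)).
Definition wedge_mul m n k (e : k = (m + n)%N) (x : wedge m) (y : wedge n) : wedge k :=
  wedge_pi (WMul e (repr x) (repr y)).

Lemma wedge_addE n (s t : wedge_term n) :
  wedge_add (wedge_pi s) (wedge_pi t) = wedge_pi (WAdd s t).
Proof. by apply/wedge_eqP/we_add; apply: wedge_repr. Qed.

Lemma wedge_scaleE n a (t : wedge_term n) :
  wedge_scale a (wedge_pi t) = wedge_pi (WScale a t).
Proof. by apply/wedge_eqP/we_scale; apply: wedge_repr. Qed.

Lemma wedge_mulE m n k (e : k = (m + n)%N) (s : wedge_term m) (t : wedge_term n) :
  wedge_mul e (wedge_pi s) (wedge_pi t) = wedge_pi (WMul e s t).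
Proof. by apply/wedge_eqP/we_mul; apply: wedge_repr. Qed.

Section Degree.
Variable n : nat.

Let addA : associative (@wedge_add n).
Proof.
elim/wedgeP=> x; elim/wedgeP=> y; elim/wedgeP=> z; rewrite !wedge_addE.
exact/wedge_eqP/we_addA.
Qed.
Let addC : commutative (@wedge_add n).
Proof. by elim/wedgeP=> x; elim/wedgeP=> y; rewrite !wedge_addE; apply/wedge_eqP/we_addC. Qed.
Let add0 : left_id (wedge_pi (WZero n)) (@wedge_add n).
Proof. by elim/wedgeP=> x; rewrite wedge_addE; apply/wedge_eqP/we_add0. Qed.

HB.instance Definition _ := GRing.isNmodule.Build (wedge n) addA addC add0.

Let scaleA a b (x : wedge n) : wedge_scale a (wedge_scale b x) = wedge_scale (a * b) x.
Proof. by elim/wedgeP: x => x; rewrite !wedge_scaleE; apply/wedge_eqP/we_scaleA. Qed.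
Let scale0 (x : wedge n) : wedge_scale 0 x = 0.
Proof. by elim/wedgeP: x => x; rewrite wedge_scaleE; apply/wedge_eqP/we_scale0. Qed.
Let scale1 : left_id 1 (@wedge_scale n).
Proof. by elim/wedgeP=> x; rewrite wedge_scaleE; apply/wedge_eqP/we_scale1. Qed.
Let scaleDr : right_distributive (@wedge_scale n) +%R.
Proof.
move=> a; elim/wedgeP=> x; elim/wedgeP=> y.
rewrite [_ + _]wedge_addE !wedge_scaleE [RHS]wedge_addE; exact/wedge_eqP/we_scaleDr.
Qed.
Let scaleDl (x : wedge n) : {morph (@wedge_scale n)^~ x : a b / a + b}.
Proof.
elim/wedgeP: x => x a b; rewrite !wedge_scaleE [RHS]wedge_addE.
exact/wedge_eqP/we_scaleDl.
Qed.

HB.instance Definition _ := GRing.Nmodule_isLSemiModule.Build R (wedge n)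
  scaleA scale0 scale1 scaleDr scaleDl.
HB.instance Definition _ := GRing.LSemiModule_isLmodule.Build R (wedge n).

End Degree.

Lemma wedge_piD n (s t : wedge_term n) : wedge_pi (WAdd s t) = wedge_pi s + wedge_pi t.
Proof. by rewrite -wedge_addE. Qed.

Lemma wedge_piZ n a (t : wedge_term n) : wedge_pi (WScale a t) = a *: wedge_pi t.
Proof. by rewrite -wedge_scaleE. Qed.

Lemma wedge_gen_linear : linear wedge_gen.
Proof. by move=> a v w; rewrite -wedge_piZ -wedge_piD; apply/wedge_eqP/we_gen. Qed.
HB.instance Definition _ :=
  GRing.isLinear.Build R V (wedge 1) _ wedge_gen wedge_gen_linear.

Definition wedge_alg : gradedAlg R.
Proof.
refine (@GradedAlg R wedge (wedge_pi WOne) wedge_mul _ _ _ _ _).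
- move=> m n k e a; elim/wedgeP=> x; elim/wedgeP=> y; elim/wedgeP=> z.
  rewrite -wedge_piZ -wedge_piD !wedge_mulE -wedge_piZ -wedge_piD; exact/wedge_eqP/we_mulPl.
- move=> m n k e a; elim/wedgeP=> x; elim/wedgeP=> y; elim/wedgeP=> z.
  rewrite -wedge_piZ -wedge_piD !wedge_mulE -wedge_piZ -wedge_piD; exact/wedge_eqP/we_mulPr.
- move=> m n p mn np k e1 e2 e3 e4; elim/wedgeP=> x; elim/wedgeP=> y; elim/wedgeP=> z.
  rewrite !wedge_mulE; exact/wedge_eqP/we_mulA.
- by move=> n e; elim/wedgeP=> x; rewrite wedge_mulE; apply/wedge_eqP/we_mul1l.
- by move=> n e; elim/wedgeP=> x; rewrite wedge_mulE; apply/wedge_eqP/we_mul1r.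
Defined.

Lemma wedge_gen_sqr (e : 2%N = (1 + 1)%N) v : wedge_mul e (wedge_gen v) (wedge_gen v) = 0.
Proof. by rewrite wedge_mulE; apply/wedge_eqP/we_sqr. Qed.

End ExteriorTerms.

Section ExteriorLift.
Variables (R : comNzRingType) (V : lmodType R) (E : gradedAlg R).
Variable f : {linear V -> E 1%N}.

Fixpoint wedge_eval n (t : wedge_term V n) : E n :=
  match t in wedge_term _ k return E k with
  | WGen v => f v
  | WOne => gone E
  | WZero _ => 0
  | WAdd _ s t => wedge_eval s + wedge_eval t
  | WScale _ a t => a *: wedge_eval t
  | WMul _ _ _ e s t => gmul e (wedge_eval s) (wedge_eval t)
  end.

(* The algebra map wedge V -> E extending f, if f v * f v = 0 for all v. *)
Definition wedge_lift n (x : wedge V n) : E n := wedge_eval (repr x).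

Hypothesis f2 : forall (e : 2%N = (1 + 1)%N) v, gmul e (f v) (f v) = 0.

Lemma wedge_eval_eq n (s t : wedge_term V n) : wedge_eq s t -> wedge_eval s = wedge_eval t.
Proof.
elim=> //= {n s t}.
- by move=> n s t u _ -> _ ->.
- by move=> n s s' t t' _ -> _ ->.
- by move=> n a t t' _ ->.
- by move=> m n k e s s' t t' _ -> _ ->.
- by move=> *; rewrite addrA.
- by move=> *; rewrite addrC.
- by move=> *; rewrite add0r.
- by move=> *; rewrite scalerA.
- by move=> *; rewrite scale0r.
- by move=> *; rewrite scale1r.
- by move=> *; rewrite scalerDr.
- by move=> *; rewrite scalerDl.
- by move=> *; rewrite gmulPl.
- by move=> *; rewrite gmulPr.
- by move=> *; apply: gmulA.
- by move=> *; rewrite gmul1l.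
- by move=> *; rewrite gmul1r.
- by move=> *; rewrite linearP.
Qed.

Lemma wedge_liftE n (t : wedge_term V n) : wedge_lift (wedge_pi t) = wedge_eval t.
Proof. exact/wedge_eval_eq/wedge_repr. Qed.

Lemma wedge_lift_gen v : wedge_lift (wedge_gen v) = f v.
Proof. exact: wedge_liftE. Qed.

Lemma wedge_lift_linear n : linear (@wedge_lift n).
Proof.
move=> a; elim/wedgeP=> x; elim/wedgeP=> y.
by rewrite -wedge_piZ -wedge_piD !wedge_liftE.
Qed.

Lemma wedge_lift_one : wedge_lift (gone (wedge_alg V)) = gone E.
Proof. exact: wedge_liftE. Qed.

Lemma wedge_liftM m n k (e : k = (m + n)%N) (x : wedge_alg V m) (y : wedge_alg V n) :
  wedge_lift (gmul e x y) = gmul e (wedge_lift x) (wedge_lift y).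
Proof.
elim/wedgeP: x => x; elim/wedgeP: y => y.
have -> : @gmul _ (wedge_alg V) m n k e (wedge_pi x) (wedge_pi y) = wedge_pi (WMul e x y).
  exact: wedge_mulE.
by rewrite !wedge_liftE.
Qed.

End ExteriorLift.

Definition wedge_map (R : comNzRingType) (V W : lmodType R) (g : {linear V -> W}) n :
  wedge V n -> wedge W n :=
  @wedge_lift R V (wedge_alg W) (@wedge_gen R W \o g) n.

Record chainComplex (A : pzRingType) := ChainComplex {
  cc_obj :> nat -> lmodType A;
  cc_d : forall i, {linear cc_obj i.+1 -> cc_obj i};
  cc_dd : forall i x, cc_d i (cc_d i.+1 x) = 0 }.

(* Hom complexes along a ring map phi : A -> B.  A family (f i j : P i -> Q j)
   is homogeneous of cohomological degree n - m when it vanishes unless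
   i = j + (n - m); m is 1 for the homotopies and 0 otherwise.  The differential
   of Hom is D f = d f - (-1)^|f| f d.  Negative degrees are not needed, as
   Ext vanishes there. *)
Section HomComplex.
Variables (A B : pzRingType) (phi : A -> B).
Variables (P : chainComplex A) (Q : chainComplex B).

Definition homogeneous (m n : nat) (f : forall i j, P i -> Q j) : Prop :=
  (forall i j, linear_for (phi \; *:%R) (f i j)) /\
  (forall i j x, (i + m)%N <> (j + n)%N -> f i j x = 0).

Definition cocycle (n : nat) (f : forall i j, P i -> Q j) : Prop :=
  homogeneous 0 n f /\
  (forall i j x,
     cc_d Q j (f i.+1 j.+1 x) = (-1) ^+ n *: f i j (cc_d P i x)).

(* The case i = 0 is the general one with d = 0 on P 0. *)
Definition coboundary (n : nat) (f : forall i j, P i -> Q j) : Prop :=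
  exists2 h : forall i j, P i -> Q j, homogeneous 1 n h &
    (forall j x, f 0%N j x = cc_d Q j (h 0%N j.+1 x)) /\
    (forall i j x, f i.+1 j x =
       cc_d Q j (h i.+1 j.+1 x) + (-1) ^+ n *: h i j (cc_d P i x)).

End HomComplex.

Section ExtAlgebra.
Variables (R : comNzRingType) (A : comAlgType R) (P : chainComplex A).

Definition endo := forall i j, P i -> P j.
HB.instance Definition _ := gen_eqMixin endo.
HB.instance Definition _ := gen_choiceMixin endo.

Lemma endoP (f g : endo) : (forall i j x, f i j x = g i j x) -> f = g.
Proof.
move=> fg; apply/functional_extensionality_dep => i.
by apply/functional_extensionality_dep => j; apply/funext => x.
Qed.

Definition endo_zero : endo := fun i j x => 0.
Definition endo_add (f g : endo) : endo := fun i j x => f i j x + g i j x.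
Definition endo_opp (f : endo) : endo := fun i j x => - f i j x.
Definition endo_scale (a : R) (f : endo) : endo := fun i j x => a%:A *: f i j x.

Let endo_addA : associative endo_add.
Proof. by move=> f g h; apply: endoP => i j x; apply: addrA. Qed.
Let endo_addC : commutative endo_add.
Proof. by move=> f g; apply: endoP => i j x; apply: addrC. Qed.
Let endo_add0 : left_id endo_zero endo_add.
Proof. by move=> f; apply: endoP => i j x; apply: add0r. Qed.
Let endo_addN : left_inverse endo_zero endo_opp endo_add.
Proof. by move=> f; apply: endoP => i j x; apply: addNr. Qed.
HB.instance Definition _ :=
  GRing.isZmodule.Build endo endo_addA endo_addC endo_add0 endo_addN.

Let endo_scaleA a b f : endo_scale a (endo_scale b f) = endo_scale (a * b) f.
Proof.
apply: endoP => i j x; rewrite /endo_scale scalerA; congr (_ *: _).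
by rewrite -scalerAl mul1r scalerA.
Qed.
Let endo_scale1 : left_id 1 endo_scale.
Proof. by move=> f; apply: endoP => i j x; rewrite /endo_scale !scale1r. Qed.
Let endo_scaleDr : right_distributive endo_scale +%R.
Proof. by move=> a f g; apply: endoP => i j x; apply: scalerDr. Qed.
Let endo_scaleDl f : {morph endo_scale^~ f : a b / a + b}.
Proof.
move=> a b; apply: endoP => i j x.
by rewrite /endo_scale scalerDl; apply: scalerDl.
Qed.
HB.instance Definition _ := GRing.Zmodule_isLmodule.Build R endo
  endo_scaleA endo_scale1 endo_scaleDr endo_scaleDl.

Lemma homogeneous0 m n : homogeneous idfun m n (0 : endo).
Proof. by split=> // i j a x y; rewrite [RHS]addr0 [RHS]scaler0. Qed.

Lemma homogeneousP m n a (f g : endo) :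
  homogeneous idfun m n f -> homogeneous idfun m n g ->
  homogeneous idfun m n (a *: f + g).
Proof.
move=> [lf zf] [lg zg]; split=> [i j b x y|i j x ij]; last first.
  by rewrite /= [LHS](_ : _ = a%:A *: f i j x + g i j x) // zf // zg // scaler0 addr0.
have E z : (a *: f + g) i j z = a%:A *: f i j z + g i j z by [].
by rewrite !E lf lg /= !scalerDr !scalerA [b * _]mulrC addrACA.
Qed.

Lemma cocycle0 n : cocycle idfun n (0 : endo).
Proof. by split=> [|i j x]; [apply: homogeneous0 | rewrite raddf0 scaler0]. Qed.

Lemma cocycleP n a (f g : endo) :
  cocycle idfun n f -> cocycle idfun n g -> cocycle idfun n (a *: f + g).
Proof.
move=> [hf zf] [hg zg]; split=> [|i j x]; first exact: homogeneousP.
have E k l z : (a *: f + g) k l z = a%:A *: f k l z + g k l z by [].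
by rewrite !E linearP zf zg scalerDr !scalerA mulrC.
Qed.

Definition cocycles n : submod endo := Submod (@cocycle0 n) (@cocycleP n).

Lemma coboundary0 n : coboundary idfun n (val (0 : submod_type (cocycles n))).
Proof.
exists (0 : endo); first exact: homogeneous0.
have E i j x : (val (0 : submod_type (cocycles n)) : endo) i j x = 0 by [].
by split=> *; rewrite E [(0 : endo) _ _ _](_ : _ = 0) // raddf0 // add0r scaler0.
Qed.

Lemma coboundaryP n a (f g : submod_type (cocycles n)) :
  coboundary idfun n (val f) -> coboundary idfun n (val g) ->
  coboundary idfun n (val (a *: f + g)).
Proof.
move=> [h hh [h0 h1]] [k hk [k0 k1]].
exists (a *: (h : endo) + (k : endo)); first exact: homogeneousP.
have E (u v : endo) i j z : (a *: u + v) i j z = a%:A *: u i j z + v i j z by [].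
have -> : val (a *: f + g) = a *: val f + val g by [].
split=> [j x|i j x]; rewrite !E linearP; first by rewrite h0 k0.
rewrite h1 k1 !scalerDr !scalerA [a%:A * _]mulrC; exact: addrACA.
Qed.

Definition coboundaries n : submod (submod_type (cocycles n)) :=
  @Submod R (submod_type (cocycles n)) (fun f => coboundary idfun n (val f))
    (@coboundary0 n) (@coboundaryP n).

(* For P a projective resolution of M, this is H^n(Hom_A(P, P)) = Ext^n_A(M, M);
   the Yoneda product is induced by composition. *)
Definition Ext_comp n : lmodType R := qmod (coboundaries n).
Definition Ext_pi n (f : submod_type (cocycles n)) : Ext_comp n := qmod_pi (coboundaries n) f.

Definition endo_one : endo :=
  fun i j => if i =P j is ReflectT e then fun x => ecast j (P j) e x else fun=> 0.

(* Composition f o g of graded maps, f being of degree m. *)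
Definition endo_mul m (f g : endo) : endo :=
  fun i j x => f (j + m)%N j (g i (j + m)%N x).

Arguments endo_one : clear implicits.
Arguments endo_mul : clear implicits.

Lemma endo_oneE i x : endo_one i i x = x.
Proof. by rewrite /endo_one; case: eqP => // e; rewrite eq_axiomK. Qed.

Lemma endo_one0 i j x : i <> j -> endo_one i j x = 0.
Proof. by rewrite /endo_one; case: eqP. Qed.

Lemma endo_one_cocycle : cocycles 0 endo_one.
Proof.
split; first split.
- move=> i j a x y; case: (i =P j) => [<-|ij]; first by rewrite !endo_oneE.
  by rewrite !endo_one0 // [RHS]addr0 [RHS]scaler0.
- by move=> i j x; rewrite !addn0; apply: endo_one0.
- move=> i j x; rewrite expr0 scale1r.
  case: (i =P j) => [<-|ij]; first by rewrite !endo_oneE.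
  by rewrite !endo_one0 ?raddf0 // => -[] //.
Qed.

Lemma homogeneous_lin m n f : homogeneous idfun m n f ->
  forall i j, linear (f i j : P i -> P j).
Proof. by case. Qed.

Lemma lin0 i j (f : P i -> P j) : linear f -> f 0 = 0.
Proof. by move=> lf; have := lf (-1) 0 0; rewrite scaler0 addr0 scaleN1r addNr. Qed.

Lemma linZ i j (f : P i -> P j) a x : linear f -> f (a *: x) = a *: f x.
Proof. by move=> lf; rewrite -[a *: x]addr0 lf lin0 // addr0. Qed.

Lemma linD i j (f : P i -> P j) x y : linear f -> f (x + y) = f x + f y.
Proof. by move=> lf; have := lf 1 x y; rewrite !scale1r. Qed.

Lemma linB i j (f : P i -> P j) x y : linear f -> f (x - y) = f x - f y.
Proof. by move=> lf; rewrite -[- y]scaleN1r addrC lf scaleN1r addrC. Qed.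

Lemma endo_mul_cocycle m n k (e : k = (m + n)%N) (f g : endo) :
  cocycles m f -> cocycles n g -> cocycles k (endo_mul m f g).
Proof.
move=> [[lf df] zf] [[lg dg] zg]; split; first split.
- by move=> i j a x y; rewrite /endo_mul lg lf.
- move=> i j x; rewrite addn0 e addnA /endo_mul => ij.
  by rewrite dg ?addn0 // lin0 //; apply: lf.
- move=> i j x; rewrite /endo_mul zf (zg i (j + m)%N) (linZ _ _ (lf _ _)).
  by rewrite scalerA -exprD e.
Qed.

Definition cocycle_mul m n k (e : k = (m + n)%N)
  (f : submod_type (cocycles m)) (g : submod_type (cocycles n)) : submod_type (cocycles k) :=
  to_submod (endo_mul_cocycle e (submod_typeP f) (submod_typeP g)).

Definition Ext_one : Ext_comp 0 := Ext_pi (to_submod endo_one_cocycle).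
Definition Ext_mul m n k (e : k = (m + n)%N) (x : Ext_comp m) (y : Ext_comp n) :
  Ext_comp k := Ext_pi (cocycle_mul e (repr x) (repr y)).

Lemma coboundary_mull m n k (e : k = (m + n)%N) (f g : endo) :
  cocycles m f -> coboundary idfun n g -> coboundary idfun k (endo_mul m f g).
Proof.
move=> [[lf df] zf] [h [lh dh] [h0 h1]].
have lF i j : linear (f i j : P i -> P j) by apply: lf.
have mm : (-1) ^+ m * (-1) ^+ m = 1 :> A.
  by rewrite -exprD addnn -mul2n exprM sqrrN !expr1n.
have fd i j x : f i j (cc_d P i x) = (-1) ^+ m *: cc_d P j (f i.+1 j.+1 x).
  by rewrite zf scalerA mm scale1r.
exists (fun i j x => (-1) ^+ m *: f (j + m)%N j (h i (j + m)%N x)).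
  split=> [i j a x y|i j x ij].
    by rewrite lh lf scalerDr /= !scalerA mulrC.
  by rewrite dh -?addnA -?e // lin0 // scaler0.
split=> [j x|i j x]; rewrite /endo_mul.
  by rewrite h0 fd [RHS]linearZ.
rewrite h1 linD // linZ // fd [in RHS]linearZ scalerA; congr (_ + _ *: _).
by rewrite e exprD mulrC mulrA mm mul1r.
Qed.

Lemma coboundary_mulr m n k (e : k = (m + n)%N) (f g : endo) :
  coboundary idfun m f -> cocycles n g -> coboundary idfun k (endo_mul m f g).
Proof.
move=> [h [lh dh] [h0 h1]] [[lg dg] zg].
have lH i j : linear (h i j : P i -> P j) by apply: lh.
exists (fun i j x => h (j + m).-1 j (g i (j + m).-1 x)).
  split=> [i j a x y|i j x ij]; first by rewrite lg lh.
  case q: (j + m)%N => [|p] /=; first by rewrite dh // q.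
  rewrite dg ?lin0 // addn0 => ei; apply: ij.
  by rewrite e addnA q ei addn1.
split=> [j x|i j x]; rewrite /endo_mul addSn.
  case q: (j + m)%N => [|p] /=; first by rewrite h0.
  by rewrite dg // h1 (raddf0 (cc_d P p)) (lin0 (lH p j)) scaler0 addr0.
case q: (j + m)%N => [|p] /=.
  by rewrite h0 [X in _ *: X]dh ?q // scaler0 addr0.
by rewrite h1 zg (linZ _ _ (lH p j)) scalerA -exprD -e.
Qed.

Lemma Ext_mulE m n k (e : k = (m + n)%N) x y :
  Ext_mul e (Ext_pi x) (Ext_pi y) = Ext_pi (cocycle_mul (m := m) (n := n) e x y).
Proof.
apply/qmod_eqP.
have Bx : coboundary idfun m (val (repr (Ext_pi x) - x)) := qmod_repr (coboundaries m) x.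
have By : coboundary idfun n (val (repr (Ext_pi y) - y)) := qmod_repr (coboundaries n) y.
move: (repr (Ext_pi x)) (repr (Ext_pi y)) Bx By => x' y' Bx By.
have -> : cocycle_mul e x' y' - cocycle_mul e x y =
  cocycle_mul e x' (y' - y) + cocycle_mul e (x' - x) y.
  apply: val_inj; apply: endoP => i j z.
  have [[lx _] _] := submod_typeP x'.
  pose u := val y' i (j + m)%N z; pose w := val y i (j + m)%N z.
  rewrite -[LHS]/(val x' (j + m)%N j u - val x (j + m)%N j w).
  rewrite -[RHS]/(val x' (j + m)%N j (u - w) +
                  (val x' (j + m)%N j w - val x (j + m)%N j w)).
  by rewrite [in RHS](linB _ _ (lx (j + m)%N j)) addrA subrK.
apply: submodD.
  exact: (coboundary_mull e (submod_typeP x') By).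
exact: (coboundary_mulr e Bx (submod_typeP y)).
Qed.

Lemma Ext_pi_linear n : linear (@Ext_pi n).
Proof. exact: qmod_pi_linear. Qed.
HB.instance Definition _ n := GRing.isLinear.Build R (submod_type (cocycles n))
  (Ext_comp n) _ (@Ext_pi n) (@Ext_pi_linear n).

Lemma ExtP n (Q : Ext_comp n -> Prop) : (forall x, Q (Ext_pi x)) -> forall x, Q x.
Proof. exact: qmodP. Qed.

Definition Ext_alg : gradedAlg R.
Proof.
refine (@GradedAlg R Ext_comp Ext_one Ext_mul _ _ _ _ _).
- move=> m n k e a; elim/ExtP=> x; elim/ExtP=> y; elim/ExtP=> z.
  rewrite -Ext_pi_linear !Ext_mulE -Ext_pi_linear; congr Ext_pi.
  by apply: val_inj; apply: endoP.
- move=> m n k e a; elim/ExtP=> x; elim/ExtP=> y; elim/ExtP=> z.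
  rewrite -Ext_pi_linear !Ext_mulE -Ext_pi_linear; congr Ext_pi.
  apply: val_inj; apply: endoP => i j t.
  by have [[lx _] _] := submod_typeP x; apply: lx.
- move=> m n p mn np k e1 e2 e3 e4; elim/ExtP=> x; elim/ExtP=> y; elim/ExtP=> z.
  rewrite !Ext_mulE; congr Ext_pi; apply: val_inj; apply: endoP => i j t.
  by rewrite /= /endo_mul e1 addnA.
- move=> n e; elim/ExtP=> x; rewrite Ext_mulE; congr Ext_pi.
  apply: val_inj; apply: endoP => i j t /=.
  suff H q : q = j -> endo_one q j (val x i q t) = val x i j t by exact/H/addn0.
  by move=> ->; rewrite endo_oneE.
- move=> n e; elim/ExtP=> x; rewrite Ext_mulE; congr Ext_pi.
  apply: val_inj; apply: endoP => i j t /=; rewrite /endo_mul.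
  have [[lx dx] _] := submod_typeP x.
  case: (i =P (j + n)%N) => ij; first by subst i; rewrite endo_oneE.
  by rewrite endo_one0 // lin0 ?dx ?addn0 //; apply: lx.
Defined.

End ExtAlgebra.

Section Augmentation.
Variables (R : idomainType) (A : comAlgType R) (lam : {lrmorphism A -> R | *%R}).

Definition aug_ker : set A := [set x | lam x = 0]%classic.

Lemma aug_ker_prime : prime_ideal aug_ker.
Proof.
split; first split.
- by rewrite /aug_ker /= rmorph0.
- by move=> x y kx ky; rewrite /aug_ker /= rmorphD /= (kx : lam x = 0) ky addr0.
- by move=> a x kx; rewrite /aug_ker /= rmorphM /= (kx : lam x = 0) mulr0.
- by rewrite /aug_ker /= rmorph1; apply/eqP/oner_neq0.
- move=> x y /eqP; rewrite rmorphM mulf_eq0.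
  by case/orP => /eqP; [left | right].
Qed.

Lemma aug_kerP (a : R) (x y : A) : aug_ker x -> aug_ker y -> aug_ker (a *: x + y).
Proof.
rewrite /aug_ker /= => kx ky.
by rewrite linearP /= kx ky addr0 mulr0.
Qed.

Definition ker_submod : submod A := @Submod R A aug_ker (rmorph0 lam) aug_kerP.

Definition ker_sqr (x : submod_type ker_submod) : Prop := ideal_exp aug_ker 2 (val x).

Lemma ker_sqr0 : ker_sqr 0.
Proof. by case: (ideal_exp_ideal aug_ker 2). Qed.

Lemma ker_sqrP (a : R) x y : ker_sqr x -> ker_sqr y -> ker_sqr (a *: x + y).
Proof.
case: (ideal_exp_ideal aug_ker 2) => _ iD iM kx ky.
apply: iD => //; rewrite (_ : val _ = a%:A * val x); first exact: iM.
by rewrite -scalerAl mul1r.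
Qed.

Definition ker_sqr_submod : submod (submod_type ker_submod) := Submod ker_sqr0 ker_sqrP.

Definition cotangent : lmodType R := qmod ker_sqr_submod.

Definition cot_pi (x : submod_type ker_submod) : cotangent := qmod_pi ker_sqr_submod x.

End Augmentation.

Record augAlg (O : idomainType) (c : nat) := AugAlg {
  aug_ring :> comAlgType O;
  aug : {lrmorphism aug_ring -> O | *%R};
  aug_noetherian : noetherian aug_ring;
  aug_complete : complete_local_ring aug_ring;
  aug_surj : forall a, exists x, aug x = a;
  aug_regular : regular_local_ring (loc (aug_ker_prime aug)) c }.

Record augHom (O : idomainType) (c : nat) (X Y : augAlg O c) := AugHom {
  ah_fun :> {lrmorphism X -> Y};
  ah_local : forall m m', maximal_ideal m -> maximal_ideal m' ->
    forall x, m x -> m' (ah_fun x);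
  ah_aug : forall x, aug Y (ah_fun x) = aug X x }.

Section CotangentMap.
Variables (O : idomainType) (c : nat) (X Y : augAlg O c) (phi : augHom X Y).

Lemma ker_map_subproof (x : submod_type (ker_submod (aug X))) :
  ker_submod (aug Y) (phi (val x)).
Proof. by rewrite /= /aug_ker /= ah_aug; apply: (submod_typeP x). Qed.

Definition ker_map (x : submod_type (ker_submod (aug X))) :
  submod_type (ker_submod (aug Y)) := to_submod (ker_map_subproof x).

Definition cot_map (x : cotangent (aug X)) : cotangent (aug Y) :=
  cot_pi (ker_map (repr x)).

Lemma ker_map_sqr x : ker_sqr x -> ker_sqr (ker_map x).
Proof.
move=> [k [a [t [It e]]]]; exists k, (fun i => phi (a i)), (fun i j => phi (t i j)).
split=> [i j|]; first by rewrite /aug_ker /= ah_aug; apply: It.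
rewrite /= [LHS](_ : _ = phi (val x)) // e rmorph_sum; apply: eq_bigr => i _ /=.
by rewrite rmorphM rmorph_prod.
Qed.

Lemma ker_map_linear : linear ker_map.
Proof. by move=> a x y; apply: val_inj; rewrite /= [LHS]linearP. Qed.
HB.instance Definition _ := GRing.isLinear.Build O _ _ _ ker_map ker_map_linear.

Lemma cot_mapE x : cot_map (cot_pi x) = cot_pi (ker_map x).
Proof.
apply/qmod_eqP; rewrite -raddfB.
exact/ker_map_sqr/(qmod_repr (ker_sqr_submod (aug X)) x).
Qed.

Lemma cot_map_linear : linear cot_map.
Proof.
move=> a; elim/qmodP=> x; elim/qmodP=> y.
rewrite -(qmod_pi_linear (ker_sqr_submod (aug X)) a x y).
rewrite (cot_mapE (a *: x + y)) (cot_mapE x) (cot_mapE y) linearP.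
exact: qmod_pi_linear.
Qed.
HB.instance Definition _ := GRing.isLinear.Build O _ _ _ cot_map cot_map_linear.

End CotangentMap.

Definition projective (A : pzRingType) (M : lmodType A) : Prop :=
  forall (N N' : lmodType A) (g : {linear N -> N'}) (f : {linear M -> N'}),
    (forall y, exists x, g x = y) ->
    exists h : {linear M -> N}, forall x, g (h x) = f x.

(* O is an A-module through the augmentation, whence the type of res_eps. *)
Record projRes (O : idomainType) (c : nat) (X : augAlg O c) := ProjRes {
  res_cc :> chainComplex X;
  res_eps : {linear res_cc 0%N -> O | aug X \; *%R};
  res_projective : forall i, projective (res_cc i);
  res_surj : forall a, exists x, res_eps x = a;
  res_exact0 : forall x, res_eps x = 0 <-> exists y, cc_d res_cc 0 y = x;
  res_exact : forall i x, cc_d res_cc i x = 0 <-> exists y, cc_d res_cc i.+1 y = x }.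

Section ExtTorsionFree.
Variables (O : idomainType) (c : nat) (X : augAlg O c) (P : projRes X).

Definition Ext_tf : gradedAlg O := tf_alg (Ext_alg P).

Definition Ext_tf_class n (z : submod_type (cocycles P n)) : Ext_tf n :=
  tf_pi (Ext_pi z : Ext_alg P n).

End ExtTorsionFree.

Section ExtDegreeOne.
Variables (O : idomainType) (c : nat) (X : augAlg O c) (P : projRes X).

(* The class of z in Ext^1 is the image of psi under
   Hom_O(p/p^2, O) = Hom_A(p, O) -> Ext^1_A(O, O), the second map being the
   connecting map of 0 -> p -> A -> O -> 0: alpha lifts the identity of O to
   P 0 -> A, so alpha o d maps P 1 to p, and the cocycle z of Hom(P, P) is sent
   by eps to the cocycle psi o alpha o d of Hom(P, O). *)
Definition represents (psi : dual (cotangent (aug X)))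
  (z : submod_type (cocycles P 1)) : Prop :=
  exists alpha : {linear P 0%N -> (aug_ring X)^o},
    (forall x, aug X (alpha x) = res_eps P x) /\
    (forall (x : P 1%N) (p : submod_type (ker_submod (aug X))),
       val p = alpha (cc_d P 0 x) ->
       res_eps P (val z 1%N 0%N x) = dual_app psi (cot_pi p)).

End ExtDegreeOne.

Section ExtFunctoriality.
Variables (O : idomainType) (c : nat) (X Y : augAlg O c) (phi : augHom X Y).
Variables (P : projRes X) (Q : projRes Y).

Definition comparison (u : forall i, P i -> Q i) : Prop :=
  [/\ forall i, linear_for (phi \; *:%R) (u i),
      forall i x, cc_d Q i (u i.+1 x) = u i (cc_d P i x) &
      forall x, res_eps Q (u 0%N x) = res_eps P x].

(* The graph of the restriction map Ext_B(O, O)^tf -> Ext_A(O, O)^tf along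
   phi : A -> B: f restricts g when u f and g u are homotopic for a comparison
   map u : P -> Q over the identity of O. *)
Definition Ext_restr n (y : Ext_tf Q n) (x : Ext_tf P n) : Prop :=
  exists (u : forall i, P i -> Q i)
         (g : submod_type (cocycles Q n)) (f : submod_type (cocycles P n)),
    [/\ comparison u,
        coboundary phi n (fun i j t => u j (val f i j t) - val g i j (u i t)),
        y = Ext_tf_class g & x = Ext_tf_class f].

End ExtFunctoriality.

(* Main.v *)
From HB Require Import structures.
Require Import Defs.
From mathcomp Require Import all_boot all_algebra.
From mathcomp Require Import ring boolp classical_sets.

Set Implicit Arguments.
Unset Strict Implicit.
Unset Printing Implicit Defensive.

Import GRing.Theory.

(** Let A be the ring of X, lam : A -> O its augmentation, p the kernel of lam,
    V the dual of p / p^2, and E the algebra Ext_A(O, O) computed by a projective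
    resolution P of O.

    The class of psi : V in E^1 is that of the form psi o alpha o d on P 1, where
    alpha : P 0 -> A lifts the identity of O.  If the squares of these classes are
    torsion, the exterior algebra of V maps to E^tf.  Both this and the
    bijectivity of the map are read off from Koszul complexes.  For a sequence g
    of N elements of p the Koszul complex K(g) is free, so it maps to P over the
    identity of O, and its differential vanishes after Hom(-, O).  Restriction of
    forms therefore gives maps rho : E^n -> Hom(K_n(g), O) to the forms on an
    exterior power of O^N, and there the product with the class of psi on the
    right is composition with the contraction by the vector (psi (g_i))_i
    ([rho_mul], [rho_represents]).  Two sequences are used.

    The first one, x_1, ..., x_c, generates p A_p, where c is the dimension of the
    regular ring A_p.  It is a regular sequence at p ([regular_parameters]), so
    its Koszul complex becomes a resolution of the residue field at p
    ([koszul_acyclic]), and rho has torsion kernel ([rho_kernel]).  Contracting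
    twice by one vector gives zero: hence the squares are torsion
    ([ext_gen_sqr]).  Moreover a multiple of each coordinate form of O^c comes
    from V ([dual_parameters]) and every form on K_n(x) is a combination of
    iterated contractions ([kos_forms_ind]), so every class of E^tf has a nonzero
    multiple in the image of the exterior algebra ([ext_map_generic]).

    The second one, y_1, ..., y_N, generates p itself.  Evaluation at the y_i
    embeds V in O^N with torsion-free cokernel; as O is a discrete valuation ring
    V is then a direct summand, that is, there are u_i in V such that every psi
    is the sum of the psi(y_i) u_i ([dual_retraction]).  Replacing the coordinate
    forms by the u_i maps the forms on K_n(y) to the exterior power of V
    ([form_eval]).  Composed with rho this gives r : E^tf -> wedge V, a left
    inverse of the map Phi : wedge V -> E^tf.  It is also a right inverse:
    if b x = Phi w with b != 0, then b (r x) = w, so b (x - Phi (r x)) = 0 and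
    x = Phi (r x) because E^tf has no torsion ([ext_map_bij]).

    Naturality reduces to the classes of degree one, since restriction along
    phi : A -> B respects products: a cocycle of Hom(P, Q), for resolutions P and
    Q over A and B, is determined up to homotopy by the form on P n that its
    component P n -> Q 0 induces ([null_coboundary], [ext_map_natural]). *)

(** * Chains of primes in a noetherian ring *)

Section Noetherian.
Variable A : comNzRingType.
Implicit Types (I J M N p q r : set A) (x y z s : A).
Local Open Scope ring_scope.
Local Open Scope classical_set_scope.

Lemma ideal_sum I (k : nat) (c : 'I_k -> A) (t : 'I_k -> A) :
  ideal I -> (forall i, I (t i)) -> I (\sum_i c i * t i).
Proof.
by case=> I0 ID IM It; apply: big_ind => // i _; apply: IM.
Qed.

Lemma idealN I x : ideal I -> I x -> I (- x).
Proof. by case=> _ _ IM Ix; rewrite -mulN1r; apply: IM. Qed.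

Lemma idealB I x y : ideal I -> I x -> I y -> I (x - y).
Proof. by move=> iI Ix Iy; case: (iI) => _ ID _; apply: ID => //; apply: idealN. Qed.

Lemma idealMr I a x : ideal I -> I x -> I (x * a).
Proof. by case=> _ _ IM Ix; rewrite mulrC; apply: IM. Qed.

(** The maximum principle for ideals; a strictly increasing chain would have a
    union without a finite set of generators. *)
Lemma noetherian_max (F : set A -> Prop) :
  noetherian A -> (forall I, F I -> ideal I) -> (exists I, F I) ->
  exists2 I, F I & forall J, F J -> I `<=` J -> J = I.
Proof.
move=> nA Fi [I0 FI0]; apply/not_exists2P => noM.
have next (u : {I | F I}) : {v : {I | F I} | sval u `<` sval v}.
  apply: cid; case: u => I FI /=; have [//|] := noM I.
  move=> /existsNP[J /not_implyP[FJ /not_implyP[IJ JI]]]; exists (exist _ J FJ) => /=.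
  by split=> // JI'; apply: JI; apply/seteqP; split.
pose u n := iter n (fun v => sval (next v)) (exist _ I0 FI0).
have uS n : sval (u n) `<` sval (u n.+1) := svalP (next (u n)).
have umono m n : (m <= n)%N -> sval (u m) `<=` sval (u n).
  move=> /subnK <-; elim: (n - m)%N => // k IH x /IH.
  by have [+ _] := uS (k + m)%N; apply.
have iu n : ideal (sval (u n)) by apply/Fi/(svalP (u n)).
have [] := nA [set x | exists n, sval (u n) x].
  split=> [|x y [m xm] [n yn]|a x [n xn]].
  - by exists 0%N; case: (iu 0%N).
  - exists (maxn m n); case: (iu (maxn m n)) => _ ID _; apply: ID.
      by apply: umono xm; rewrite leq_maxl.
    by apply: umono yn; rewrite leq_maxr.
  - by exists n; case: (iu n) => _ _; apply.
move=> s Es.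
have sP (i : 'I_(size s)) : {n | sval (u n) s`_i}.
  apply: cid.
  suff : [set x | exists n, sval (u n) x] s`_i by [].
  rewrite Es; exists (fun j => (j == i)%:R); rewrite (bigD1 i) //= eqxx mul1r.
  by rewrite big1 ?addr0 // => j /negPf ->; rewrite mul0r.
pose n := \max_i sval (sP i).
have [_] := uS n; apply=> x xS.
have : [set x | exists n, sval (u n) x] x by exists n.+1.
rewrite Es => -[c ->]; apply: ideal_sum => // i.
exact: umono (leq_bigmax _) _ (svalP (sP i)).
Qed.

(** The contraction of the extension of I to the local ring at r.  Saturated
    ideals of the one ring A stand for the ideals of its localizations, so that
    several primes can be treated together. *)
Definition sat r I : set A := [set a | exists2 s, ~ r s & I (s * a)].

Lemma satW r I : prime_ideal r -> I `<=` sat r I.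
Proof. by case=> _ r1 _ x Ix; exists 1; rewrite ?mul1r. Qed.

Lemma satS r I J : I `<=` J -> sat r I `<=` sat r J.
Proof. by move=> IJ x [s rs Ix]; exists s => //; apply: IJ. Qed.

Lemma sat_ideal r I : prime_ideal r -> ideal I -> ideal (sat r I).
Proof.
move=> [ir r1 rM] [I0 ID IM]; split=> [|x y [s rs Ix] [t rt Iy]|a x [s rs Ix]].
- by exists 1; rewrite ?mulr0.
- exists (s * t); first by case/rM.
  by rewrite mulrDr; apply: ID; [rewrite mulrAC mulrC|rewrite -mulrA]; apply: IM.
- by exists s => //; rewrite mulrCA; apply: IM.
Qed.

Lemma satK r I : prime_ideal r -> sat r (sat r I) `<=` sat r I.
Proof.
move=> [ir r1 rM] x [s rs [t rt Ix]]; exists (t * s); first by case/rM.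
by rewrite -mulrA.
Qed.

Lemma sat_prime r q : prime_ideal q -> q `<=` r -> sat r q `<=` q.
Proof. by move=> [_ _ qM] qr x [s rs /qM[/qr|]]. Qed.

Definition add_gen I x : set A := [set a | exists2 b, I b & exists c, a = b + c * x].

Lemma add_gen_ideal I x : ideal I -> ideal (add_gen I x).
Proof.
move=> [I0 ID IM]; split.
- by exists 0 => //; exists 0; rewrite mul0r addr0.
- move=> _ _ [b Ib [c ->]] [b' Ib' [c' ->]]; exists (b + b'); first exact: ID.
  by exists (c + c'); ring.
- move=> a _ [b Ib [c ->]]; exists (a * b); first exact: IM.
  by exists (a * c); ring.
Qed.

Lemma add_genW I x : I `<=` add_gen I x.
Proof. by move=> a Ia; exists a => //; exists 0; rewrite mul0r addr0. Qed.

Lemma add_genx I x : ideal I -> add_gen I x x.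
Proof. by case=> I0 _ _; exists 0 => //; exists 1; rewrite mul1r add0r. Qed.

Lemma add_gen_sub I J x : ideal J -> I `<=` J -> J x -> add_gen I x `<=` J.
Proof.
by move=> [J0 JD JM] IJ Jx _ [b /IJ Jb [c ->]]; apply: JD => //; apply: JM.
Qed.

(** Nakayama's lemma over the local ring at r: M = N + x M implies M = N.  If
    not, choose a saturated ideal I maximal among those between N and M that
    differ from M.  Then x M lies in I, for if x m did not, I + (x m) would
    contain s m for some s outside r, say s m = b + c x m with b in I; then
    (s - c x) m, and hence m, would lie in I.  So M = N + x M
    lies in I. *)
Lemma nakayama r M N x : noetherian A -> prime_ideal r -> r x ->
  ideal M -> sat r M `<=` M -> ideal N -> N `<=` M ->
  (forall a, M a -> exists2 s, ~ r s & exists2 c, M c & N (s * a - c * x)) ->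
  M `<=` sat r N.
Proof.
move=> nA pr rx iM sM iN NM H.
have [ir r1 rM] := pr.
apply: contrapT => MN.
pose F I := [/\ ideal I, sat r I `<=` I, N `<=` I, I `<=` M & ~ M `<=` I].
have [||I [iI sI NI IM MI] Imax] := @noetherian_max F nA; first by move=> K [].
  exists (sat r N); split=> //; [exact: sat_ideal|exact: satK|exact: satW|].
  by move=> a /(satS NM) /sM.
have xMI m : M m -> I (x * m).
  move=> Mm; apply: contrapT => Ixm.
  have Im : ~ I m by move=> Im; apply: Ixm; case: iI => _ _; apply.
  pose J := sat r (add_gen I (x * m)).
  have iJ : ideal J by apply/sat_ideal/add_gen_ideal.
  have Jxm : J (x * m) by apply/satW/add_genx.
  have MJ : M `<=` J.
    apply: contrapT => MJ.
    have FJ : F J.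
      split=> //; first exact: satK.
      - by move=> a /NI Ia; apply/satW/add_genW.
      - apply: subset_trans sM; apply: satS; apply: add_gen_sub => //.
        by case: iM => _ _; apply.
    have IJ : I `<=` J by move=> a Ia; apply/satW/add_genW.
    by apply: Ixm; rewrite -(Imax J FJ IJ).
  have [s rs [b Ib [c e]]] := MJ _ Mm.
  apply: Im; apply: sI; exists (s - c * x).
    by move=> rscx; apply: rs; rewrite -[s](subrK (c * x));
      case: ir => _ D IMr; apply: D => //; apply: IMr.
  by rewrite mulrBl e [X in X - _](_ : _ = b + c * x * m) ?addrK // mulrA.
apply: MI => a Ma.
have [s rs [c Mc Nc]] := H a Ma; apply: sI; exists s => //.
rewrite -[s * a](subrK (c * x)); case: (iI) => _ ID _; apply: ID; first exact: NI.
by rewrite mulrC; apply: xMI.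
Qed.

(** If z is chosen outside J with the annihilator of its class modulo J as large
    as possible, that annihilator is prime. *)
Lemma associated_prime J : noetherian A -> ideal J -> ~ J 1 ->
  exists2 z, ~ J z & prime_ideal [set a | J (a * z)].
Proof.
move=> nA iJ J1; have [J0 JD JM] := iJ.
pose F I := ideal I /\ exists2 z, ~ J z & I = [set a | J (a * z)].
have ann z : ideal [set a | J (a * z)].
  split=> /= [|a b Ja Jb|a b Jb]; first by rewrite mul0r.
    by rewrite mulrDl; apply: JD.
  by rewrite -mulrA; apply: JM.
have [||I [iI [z Jz eI]] Imax] := @noetherian_max F nA; first by move=> K [].
  by exists [set a | J (a * 1)]; split=> //; exists 1.
rewrite {}eI in Imax; exists z => //; split=> //=; first by rewrite mul1r.
move=> x y Jxyz; have [Jyz|Jyz] := pselect (J (y * z)); first by right.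
left; suff : [set a | J (a * z)] x by [].
rewrite -(Imax [set a | J (a * (y * z))]) /= ?mulrA //.
  by split=> //; exists (y * z).
by move=> a /= Jaz; rewrite mulrCA; apply: JM.
Qed.

(** The quotient of the local ring at r by J has only one prime, so it is
    artinian.  Let K be maximal among the ideals above which some descending
    chain does not stabilize.  An associated prime of K can only be r, so there
    is z outside K with r z in K, and at r nothing lies strictly between K and
    K + (z).  The chain of the I n + (z) stabilizes, and either all I n
    contain z or I n meets K + (z) in K for large n; both make I stabilize. *)
Lemma local_artinian r J (I : nat -> set A) : noetherian A -> prime_ideal r ->
  ideal J -> sat r J `<=` J ->
  (forall q, prime_ideal q -> J `<=` q -> q `<=` r -> r `<=` q) ->
  (forall n, [/\ ideal (I n), sat r (I n) `<=` I n, J `<=` I n & I n.+1 `<=` I n]) ->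
  exists n, forall m, (n <= m)%N -> I n `<=` I m.
Proof.
move=> nA pr iJ sJ Jr HI; have [ir r1 rM] := pr; apply: contrapT => Ist.
pose F K := [/\ ideal K, sat r K `<=` K, J `<=` K & exists I' : nat -> set A,
  (forall n, [/\ ideal (I' n), sat r (I' n) `<=` I' n, K `<=` I' n & I' n.+1 `<=` I' n]) /\
  ~ exists n, forall m, (n <= m)%N -> I' n `<=` I' m].
have [||K [iK sK JK {I HI Ist}[I [HI Ist]]] Kmax] := @noetherian_max F nA.
- by move=> K [].
- by exists J; split=> //; exists I.
have Imono m n : (m <= n)%N -> I n `<=` I m.
  move=> /subnK <-; elim: (n - m)%N => // k IH x Ix; apply: IH.
  by have [_ _ _] := HI (k + m)%N; apply.
have K1 : ~ K 1.
  move=> K1; apply: Ist; exists 0%N => m _ x _.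
  have [[_ _ IM] _ KI _] := HI m.
  by rewrite -[x]mulr1; apply/IM/KI.
have [z Kz pz] := associated_prime nA iK K1.
have rz a : r a -> K (a * z).
  move: a; apply: (Jr _ pz) => [a /JK Ka|a /= Kaz]; first exact: idealMr.
  by apply: contrapT => ra; apply: Kz; apply: sK; exists a.
pose K' := sat r (add_gen K z).
have K'z : K' z by apply/satW/add_genx.
pose I' n := sat r (add_gen (I n) z).
have [n1 st1] : exists n, forall m, (n <= m)%N -> I' n `<=` I' m.
  apply: contrapT => I'st; suff FK' : F K'.
    apply: Kz; rewrite -(Kmax K') // => a Ka; exact/satW/add_genW.
  split; first exact/sat_ideal/add_gen_ideal.
  - exact: satK.
  - by move=> a /JK Ka; apply/satW/add_genW.
  exists I'; split=> // n; have [iI sI KI II] := HI n; split.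
  - exact/sat_ideal/add_gen_ideal.
  - exact: satK.
  - apply/satS => _ [b /KI Ib [c ->]]; exists b => //; exact: (ex_intro _ c).
  - apply/satS => _ [b /II Ib [c ->]]; exists b => //; exact: (ex_intro _ c).
have [Iz|] := pselect (forall n, I n z).
  apply: Ist; exists n1 => m nm a Ia.
  have [s rs [b Ib [c e]]] : I' m a by apply: st1 => //; apply/satW/add_genW.
  have [[_ ID IM] sI _ _] := HI m; apply: sI; exists s => //; rewrite e.
  exact/ID/IM/Iz.
move=> /existsNP[n2 Iz]; apply: Ist; exists (maxn n1 n2) => m.
rewrite geq_max => /andP[n1m n2m] a Ia; have {}Ia1 : I n1 a.
  by apply: Imono Ia; rewrite leq_maxl.
have [s rs [b Ib [c e]]] : I' m a by apply: st1 => //; apply/satW/add_genW.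
have [iI sI KI _] := HI m; have [_ ID IM] := iI; apply: sI; exists s => //; rewrite e.
apply: ID => //; apply: KI; apply: rz; apply: contrapT => rc; apply: Iz.
have [iI2 sI2 _ _] := HI n2; apply: sI2; exists c => //.
have -> : c * z = s * a - b by rewrite e addrC addKr.
apply: idealB => //; last exact: (Imono n2 m).
have [_ _ IM2] := iI2; apply: IM2; apply: Imono Ia; exact: leq_maxr.
Qed.

Lemma prime_exp q x n : prime_ideal q -> ~ q x -> ~ q (x ^+ n).
Proof.
move=> [_ q1 qM] qx; elim: n => [|n IH]; rewrite ?expr0 // exprS.
by case/qM.
Qed.

(** Krull's principal ideal theorem: a prime minimal over a + (x) cannot lie two
    steps above a.  If there were no q', the only prime between a + (x) and r
    would be r itself, and descending chains above a + (x) would stabilize at r.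
    For u in q outside a this applies to the S n + (x), where S n is the ideal
    a + (u^n) saturated at q.  As x is not in q, S n = S (n+1) + x S n results,
    and Nakayama's lemma gives S n = S (n+1).  Then s u^n lies in a + (u^(n+1))
    for some s outside q, so s lies in a + (u), which is contained in q. *)
Lemma krull_between a q r x : noetherian A ->
  prime_ideal a -> prime_ideal q -> prime_ideal r ->
  a `<` q -> q `<` r -> r x ->
  exists q', [/\ prime_ideal q', a `<` q', q' `<` r & q' x].
Proof.
move=> nA pa pq pr [aq qa] [qr rq] rx; apply: contrapT => no.
have qx : ~ q x by move=> qx; apply: no; exists q.
have ax : ~ a x by move/aq.
have [ia a1 aM] := pa; have [iq q1 qM] := pq; have [ir r1 rM] := pr.
have [u qu au] : exists2 u, q u & ~ a u.
  by apply: contrapT => h; apply: qa => u qu; apply: contrapT => au; apply: h; exists u.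
pose S n := sat q (add_gen a (u ^+ n)).
have iS n : ideal (S n) by apply/sat_ideal/add_gen_ideal.
have SS n : S n.+1 `<=` S n.
  apply: satS => _ [b ab [c ->]]; exists b => //; exists (c * u).
  by rewrite exprS mulrA.
have srS n : sat r (S n) `<=` S n.
  by move=> y [s rs Sy]; apply: satK => //; exists s => // /qr.
pose J := sat r (add_gen a x).
have [||||n st] := @local_artinian r J (fun n => sat r (add_gen (S n) x)) nA pr.
- exact/sat_ideal/add_gen_ideal.
- exact: satK.
- move=> q' pq' Jq' q'r; apply: contrapT => rq'; apply: no; exists q'; split=> //.
    split=> [y ay|q'a]; first exact/Jq'/satW/add_genW.
    by apply/ax/q'a/Jq'/satW/add_genx.
  by apply/Jq'/satW/add_genx.
- move=> n; split.
  + exact/sat_ideal/add_gen_ideal.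
  + exact: satK.
  + by apply: satS => _ [b ab [c ->]]; exists b; [apply/satW/add_genW|exists c].
  + by apply: satS => _ [b /SS ? [c ->]]; exists b => //; exists c.
have : S n `<=` sat r (S n.+1).
  (* an equation s y = b + c x with y in S n and b in S n.+1 forces c in S n,
     because S n is saturated at q and x is not in q *)
  apply: (nakayama nA pr rx (iS n) (srS n) (iS n.+1) (SS n)) => y Sy.
  have [s rs [b Sb [c e]]] := st n.+1 (leqnSn n) y (satW pr (add_genW x Sy)).
  exists s => //; exists c; last by rewrite e addrK.
  apply: satK => //; exists x => //; rewrite mulrC; suff : S n (c * x) by [].
  have -> : c * x = s * y - b by rewrite e addrC addKr.
  by apply: idealB => //; [case: (iS n) => _ _; apply|apply: SS].
move=> /(_ (u ^+ n)) []; first exact/satW/add_genx.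
move=> t rt [s qs [b ab [c e]]].
have : a (u ^+ n * (s * t - c * u)).
  have -> : u ^+ n * (s * t - c * u) = s * (t * u ^+ n) - c * u ^+ n.+1.
    by rewrite exprS; ring.
  by rewrite e addrK.
move=> /aM[|/aq qd]; first exact: prime_exp.
have /qM[//|/qr//] : q (s * t).
rewrite -[s * t](subrK (c * u)); case: iq => _ qD qIM; apply: qD => //; exact: qIM.
Qed.

(** Strictly increasing chains of n + 1 primes from a to b, as a recursive
    predicate so that their lower end can be modified one step at a time. *)
Fixpoint chain_to (n : nat) (a b : set A) : Prop :=
  prime_ideal a /\
  if n is m.+1 then exists q, a `<` q /\ chain_to m q b else a = b.

Lemma chain_to_prime n a b : chain_to n a b -> prime_ideal a.
Proof. by case: n => [|n] []. Qed.

Lemma chain_to_sub n a b : chain_to n a b -> a `<=` b.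
Proof.
elim: n a => [|n IH] a [_]; first by move=> ->.
by move=> [q [[aq _] /IH qb]] x /aq/qb.
Qed.

(** Any element of the top of a chain can be made to lie in its second member:
    starting from the top, [krull_between] replaces the members one after
    another. *)
Lemma chain_to_through n a b x : noetherian A -> chain_to n.+1 a b -> b x ->
  exists q, [/\ a `<` q, q x & chain_to n q b].
Proof.
move=> nA; elim: n a => [|n IH] a [pa [q1 [aq1 c1]]] bx.
  by exists q1; split=> //; case: c1 => _ ->.
have {}c1 : chain_to n.+1 q1 b := c1.
have [q2 [q12 q2x c2]] := IH _ c1 bx.
have [q' [pq' aq' q'2 q'x]] :=
  krull_between nA pa (chain_to_prime c1) (chain_to_prime c2) aq1 q12 q2x.
by exists q'; split=> //; split=> //; exists q2.
Qed.

Fixpoint ideal_upto (w : nat -> A) (k : nat) : set A :=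
  if k is k'.+1 then add_gen (ideal_upto w k') (w k') else [set a | a = 0].

Lemma ideal_upto_ideal w k : ideal (ideal_upto w k).
Proof.
elim: k => [|k IH]; last exact: add_gen_ideal.
by split=> [|_ _ -> ->|a _ ->] //=; rewrite ?addr0 ?mulr0.
Qed.

(** If r is generated at r by w 0, ..., w (k + m - 1) and a chain of length m
    leads to r from a prime q0 that contains w 0, ..., w (k - 1), the latter
    generate q0 at r, and so each w i is a nonzerodivisor modulo its
    predecessors.  A chain through w k shows by induction that w 0, ..., w k
    generate the next prime q1 at r; as q1 <> q0, w k is not in q0, whence
    q0 = (w 0, ..., w (k - 1)) + w k q0 at r, and Nakayama's lemma applies. *)
Lemma regular_sequence r w m k q0 : noetherian A -> prime_ideal r ->
  (forall i, (i < k + m)%N -> r (w i)) -> r `<=` sat r (ideal_upto w (k + m)) ->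
  chain_to m q0 r -> ideal_upto w k `<=` q0 ->
  q0 `<=` sat r (ideal_upto w k) /\
  forall i a, (k <= i < k + m)%N -> sat r (ideal_upto w i) (a * w i) -> sat r (ideal_upto w i) a.
Proof.
move=> nA pr; elim: m k q0 => [|m IH] k q0 ry rg c0 kq0.
  case: c0 => _ ->; rewrite addn0 in rg; split=> // i a.
  by rewrite addn0 ltnNge; case/andP=> ->.
have pq0 := chain_to_prime c0; have q0r := chain_to_sub c0.
have [iq0 q01 q0M] := pq0.
have ryk : r (w k) by apply: ry; rewrite -addSnnS leq_addr.
have [q1 [[q01s q10] q1y c1]] := chain_to_through nA c0 ryk.
rewrite -addSnnS in ry rg.
have iq1 : ideal q1 by case: (chain_to_prime c1).
have kq1 : ideal_upto w k.+1 `<=` q1 by apply: add_gen_sub => // a /kq0 /q01s.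
have [q1g reg] := IH k.+1 q1 ry rg c1 kq1.
have q0y : ~ q0 (w k).
  move=> q0y; apply: q10 => a /q1g; move: a; suff : sat r (ideal_upto w k.+1) `<=` q0 by [].
  by move=> a /(satS (add_gen_sub iq0 kq0 q0y)) /(sat_prime pq0 q0r).
have q0g : q0 `<=` sat r (ideal_upto w k).
  apply: (nakayama nA pr ryk iq0 (sat_prime pq0 q0r) (ideal_upto_ideal w k) kq0) => a q0a.
  have [s rs [b gb [c e]]] := q1g _ (q01s _ q0a).
  exists s => //; exists c; last by rewrite e addrK.
  have /q0M[//|//] : q0 (c * w k).
  have -> : c * w k = s * a - b by rewrite e addrC addKr.
  by apply: idealB => //; [case: iq0 => _ _; apply|apply: kq0].
split=> // i a /andP[]; rewrite leq_eqVlt => /predU1P[<- _|ki]; last first.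
  by rewrite -addSnnS => im; apply: reg; rewrite ki.
move=> gay; apply: q0g.
have : q0 (a * w k) by apply: (sat_prime pq0 q0r); apply: satS gay.
by case/q0M.
Qed.

End Noetherian.

(** * Parameters of a regular localization *)

Section Uniform.
Variable A : comNzRingType.
Local Open Scope ring_scope.
Local Open Scope classical_set_scope.

(** A single denominator serves for the whole ideal I since I is finitely
    generated. *)
Lemma sat_uniform (p I J : set A) : noetherian A -> prime_ideal p -> ideal I ->
  ideal J -> I `<=` sat p J -> exists2 t, ~ p t & forall a, I a -> J (t * a).
Proof.
move=> nA pp iI iJ IJ; have [ip p1 pM] := pp; have [_ _ JM] := iJ.
have [s Es] := nA I iI.
have sI (i : 'I_(size s)) : I s`_i.
  rewrite Es; exists (fun j => (j == i)%:R); rewrite (bigD1 i) //= eqxx mul1r.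
  by rewrite big1 ?addr0 // => j /negPf ->; rewrite mul0r.
have tP (i : 'I_(size s)) : {t | ~ p t /\ J (t * s`_i)}.
  by apply: cid; have [t pt Jt] := IJ _ (sI i); exists t.
exists (\prod_i sval (tP i)).
  apply: (big_ind (fun t => ~ p t)) => // [x y px py /pM[]//|i _].
  by case: (tP i) => ? [].
move=> a; rewrite Es => -[c ->]; rewrite mulr_sumr; case: (iJ) => J0 JD _.
apply: big_ind => // i _; rewrite (bigD1 i) //=.
case: (tP i) => t /= [_ Jt]; set b := (X in _ * X * _).
by rewrite (_ : _ * _ = b * c i * (t * s`_i)); [apply: JM|ring].
Qed.

Variables (p : set A) (pp : prime_ideal p).
Local Notation "'A_p'" := (loc pp).

Let num (a : A) : A_p := loc_pi pp (frac_of pp a).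

Let frac_num x (s : A) (ps : ~ p s) : loc_pi pp (Frac x ps) * num s = num x.
Proof.
rewrite [LHS]loc_mulE; apply/loc_eqP; exists 1; first by case: pp.
by rewrite /=; ring.
Qed.

Let numM a b : num (a * b) = num a * num b.
Proof.
rewrite [RHS]loc_mulE; apply/loc_eqP; exists 1; first by case: pp.
by rewrite /=; ring.
Qed.

Let numD a b : num (a + b) = num a + num b.
Proof.
rewrite [RHS]loc_addE; apply/loc_eqP; exists 1; first by case: pp.
by rewrite /=; ring.
Qed.

Let num_inv s : ~ p s -> exists y, y * num s = 1.
Proof. by move=> ps; exists (loc_pi pp (Frac 1 ps)); apply: frac_num. Qed.

Let contract (Q : set A_p) : set A := [set a | Q (num a)].

Let contract_prime Q : prime_ideal Q -> prime_ideal (contract Q).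
Proof.
move=> [[Q0 QD QM] Q1 QP]; split; first split=> [|x y|a x]; rewrite /contract /=.
- exact: Q0.
- by rewrite numD; apply: QD.
- by rewrite numM; apply: QM.
- exact: Q1.
- by move=> x y; rewrite numM; apply: QP.
Qed.

Let contract_sub Q : prime_ideal Q -> contract Q `<=` p.
Proof.
move=> [[_ _ QM] Q1 _] a Qa; apply: contrapT => /num_inv[y ya].
by apply: Q1; rewrite -ya; apply: QM.
Qed.

Let contract_proper Q Q' : prime_ideal Q -> prime_ideal Q' -> Q `<` Q' ->
  contract Q `<` contract Q'.
Proof.
move=> [[_ _ QM] _ _] [[_ _ QM'] _ _] [QQ' Q'Q]; split; first by move=> a /QQ'.
move=> h; apply: Q'Q; elim/locP=> -[x s ps] Q'x.
have [y ys] := num_inv ps.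
have -> : loc_pi pp (Frac x ps) = y * num x.
  by rewrite -(frac_num x ps) mulrCA ys mulr1.
by apply/QM/h; rewrite /contract /= -(frac_num x ps) mulrC; apply: QM'.
Qed.

(** The top of the contracted chain is replaced by p, which contains it. *)
Let contract_chain d : prime_chain A_p d -> exists q, chain_to d q p.
Proof.
move=> [q [qP qS]]; pose e i := if i == d then p else contract (q i).
have eS i : (i < d)%N -> e i `<` e i.+1.
  move=> id; rewrite /e (ltn_eqF id).
  have [ei|ei] := eqVneq; last by apply: contract_proper; auto; apply: qP; rewrite // ltnW.
  have [s1 s2] : contract (q i) `<` contract (q i.+1).
    by apply: contract_proper; auto; apply: qP; rewrite // ltnW.
  have ss : contract (q i.+1) `<=` p by apply/contract_sub/qP.
  by split=> [x /s1/ss //|h]; apply: s2 => x /ss/h.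
have eP i : (i <= d)%N -> prime_ideal (e i).
  by move=> id; rewrite /e; case: eqP => // _; apply/contract_prime/qP.
exists (e 0%N); suff H m : (m <= d)%N -> chain_to m (e (d - m)%N) p.
  by have := H d (leqnn d); rewrite subnn.
elim: m => [_|m IH md]; first by split; [exact/eP/leq_subr|rewrite subn0 /e eqxx].
split; first exact/eP/leq_subr.
exists (e (d - m)%N); split; last exact/IH/ltnW.
by rewrite -(subnSK md); apply: eS; rewrite ltn_subrL /=; apply: leq_trans md.
Qed.

Let num_sat (w : nat -> A) k (c : nat -> A_p) :
  exists2 t, ~ p t & exists2 a, ideal_upto w k a & num t * (\sum_(i < k) c i * num (w i)) = num a.
Proof.
have [ip p1 pM] := pp.
elim: k => [|k [t pt [a ga e]]].
  by exists 1 => //; exists 0 => //; rewrite big_ord0 mulr0.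
rewrite big_ord_recr /=; elim/locP: (c k) => -[x s ps].
exists (t * s); first by case/pM.
exists (s * a + t * x * w k).
  by exists (s * a); [case: (ideal_upto_ideal w k) => _ _; apply|exists (t * x)].
rewrite numD !numM mulrDr -e -[in RHS](frac_num x ps); ring.
Qed.

Lemma regular_loc_chain c : regular_local_ring A_p c ->
  exists w : nat -> A, [/\ forall i, (i < c)%N -> p (w i), p `<=` sat p (ideal_upto w c) &
    exists q, chain_to c q p].
Proof.
have [ip p1 pM] := pp.
move=> [_ [m [mm _]] [/contract_chain hc _] /(_ m mm) [s [ss em]]].
have [[m0 mD mM] m1 mmax] := mm.
pose I : set A_p := [set x | exists a, exists2 t, p a & ~ p t /\ num t * x = num a].
have Ip a : I (num a) -> p a.
  move=> [b [t pb [pt]]]; rewrite -numM => /loc_eqP[u pu /= e].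
  have /pM[//|] : p (u * (t * a)).
    have -> : u * (t * a) = u * (t * a * 1 - b * 1) + u * b by ring.
    by rewrite e add0r; case: ip => _ _; apply.
  by case/pM.
have iI : ideal I.
  split=> [|x y [a [t pa [pt ea]]] [b [u pb [pu eb]]]|x y [a [t pa [pt ea]]]].
  - by exists 0, 1; [case: ip|rewrite mulr0].
  - exists (u * a + t * b), (t * u).
      by case: ip => _ D M; apply: D; apply: M.
    by split; [case/pM|rewrite numD !numM -ea -eb; ring].
  - elim/locP: x => -[x v pv]; exists (x * a), (v * t).
      by case: ip => _ _; apply.
    by split; [case/pM|rewrite !numM -ea -(frac_num x pv); ring].
have mI : m = I.
  apply/esym/mmax => //; last by move=> /Ip.
  elim/locP=> -[x v pv] mx; exists x, v; last by split=> //; rewrite mulrC frac_num.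
  apply: contrapT => /num_inv[y yx]; apply: m1; rewrite -yx; apply: (mM).
  by rewrite -(frac_num x pv) mulrC; apply: mM.
have Im a : p a -> m (num a).
  by rewrite mI => pa; exists a, 1 => //; split=> //; apply: mul1r.
have sP i : {w | exists2 t, ~ p t & num t * s`_i = num w /\ ((i < c)%N -> p w)}.
  apply: cid; case: (ltnP i c) => ic.
    have : m s`_i.
      rewrite em; rewrite -ss in ic; exists (fun j => (j == Ordinal ic)%:R).
      rewrite (bigD1 (Ordinal ic)) //= eqxx mul1r big1 ?addr0 // => j /negPf ->.
      by rewrite mul0r.
    by rewrite mI => -[a [t pa [pt e]]]; exists a, t.
  by exists 0, 1 => //; rewrite nth_default ?ss // mulr0; split.
pose w i := sval (sP i).
exists w; split=> //.
  by move=> i; rewrite /w; case: (sP i) => ? [? ? []].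
move=> a /Im; rewrite em => -[d e]; subst c.
have tP i : {y | y * num (w i) = s`_i}.
  apply: cid; rewrite /w; case: (sP i) => a' [t pt [<- _]].
  by have [y yt] := num_inv pt; exists y; rewrite mulrA yt mul1r.
pose d' (i : nat) := (if insub i is Some j then d j else 0) * sval (tP i).
have [t pt [b gb]] := num_sat w (size s) d'.
have -> : \sum_(i < size s) d' i * num (w i) = num a.
  rewrite e; apply: eq_bigr => i _; rewrite /d' valK -mulrA; congr (_ * _).
  by case: (tP i).
rewrite -numM => /loc_eqP[u pu /= e'].
exists (u * t); first by case/pM.
have -> : u * t * a = u * (t * a * 1 - b * 1) + u * b by ring.
by rewrite e' add0r; case: (ideal_upto_ideal w (size s)) => _ _; apply.
Qed.

(** The form in which regularity of A_p is used: numerators of c generators of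
    p A_p are a regular sequence at p, with one denominator for all relations. *)
Lemma regular_parameters c : noetherian A -> regular_local_ring A_p c ->
  exists w : nat -> A, [/\ forall i, (i < c)%N -> p (w i),
    exists2 t, ~ p t & forall a, p a -> ideal_upto w c (t * a) &
    forall i, (i < c)%N -> exists2 t, ~ p t &
      forall a, ideal_upto w i (a * w i) -> ideal_upto w i (t * a)].
Proof.
move=> nA /regular_loc_chain[w [pw pg [q cq]]]; exists w; split=> //.
  by apply: sat_uniform => //; [case: pp|exact: ideal_upto_ideal].
move=> i ic.
have [] := @regular_sequence A p w c 0 q nA pp pw pg cq.
  by move=> _ ->; case: (chain_to_prime cq) => -[].
move=> _ /(_ i) reg.
pose I : set A := [set a | ideal_upto w i (a * w i)].
have [||t pt tI] := @sat_uniform p I (ideal_upto w i) nA pp _ (ideal_upto_ideal w i);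
  last by exists t.
- have [g0 gD gM] := ideal_upto_ideal w i; split; rewrite /I /=.
  + by rewrite mul0r.
  + by move=> x y gx gy; rewrite mulrDl; apply: gD.
  + by move=> a x gx; rewrite -mulrA; apply: gM.
- by move=> a Ia; apply: reg => //; apply: satW.
Qed.

End Uniform.

(** * Koszul complexes *)

Definition lin_of (R : pzRingType) (U V : lmodType R) (f : U -> V) (lf : linear f) :
  {linear U -> V} := HB.pack f (GRing.isLinear.Build R U V _ f lf).

Section Koszul.
Variable A : comNzRingType.
Local Open Scope ring_scope.
Local Open Scope classical_set_scope.

(** The n-th exterior power of A^N, by the decomposition of the exterior power
    of a sum: a pair (a, b) of [kos N.+1 n.+1] stands for a + b e_N. *)
Fixpoint kos (N : nat) : nat -> lmodType A :=
  match N with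
  | 0 => fun n => if n is 0 then A^o else 'rV[A]_0
  | N'.+1 => fun n => if n is n'.+1 then (kos N' n'.+1 * kos N' n')%type : lmodType A
                      else kos N' 0
  end.

(** Contraction by the linear form with coordinates g.  The Koszul differential
    of a sequence and the operators that represent classes of degree one are
    both of this kind, so that they anticommute. *)
Fixpoint kcon (g : nat -> A) (N : nat) : forall n, kos N n.+1 -> kos N n :=
  match N return forall n, kos N n.+1 -> kos N n with
  | 0 => fun n _ => 0
  | N'.+1 => fun n =>
    match n return kos N'.+1 n.+1 -> kos N'.+1 n with
    | 0 => fun x => kcon g x.1 + g N' *: x.2
    | n'.+1 => fun x => (kcon g x.1 + g N' *: x.2, - kcon g x.2)
    end
  end.

Lemma kcon_linear g N n : linear (@kcon g N n).
Proof.
elim: N n => [|N IH] [|n] a x y /=; rewrite ?scaler0 ?addr0 //.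
  by rewrite IH !scalerDr !scalerA [g N * a]mulrC addrACA.
congr (_, _) => /=.
  by rewrite IH !scalerDr !scalerA [g N * a]mulrC addrACA.
by rewrite IH opprD scalerN.
Qed.
HB.instance Definition _ g N n :=
  GRing.isLinear.Build A (kos N n.+1) (kos N n) _ (@kcon g N n) (@kcon_linear g N n).

Lemma kconN g N n (x : kos N n.+1) : kcon g (- x) = - kcon g x.
Proof. exact: raddfN. Qed.

Lemma kcon0 g N n : kcon g (0 : kos N n.+1) = 0.
Proof. exact: raddf0. Qed.

Lemma kconD g N n (x y : kos N n.+1) : kcon g (x + y) = kcon g x + kcon g y.
Proof. exact: raddfD. Qed.

Lemma kconZ g N n a (x : kos N n.+1) : kcon g (a *: x) = a *: kcon g x.
Proof. exact: linearZ. Qed.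

Lemma kcon_anti g h N n (x : kos N n.+2) :
  kcon g (kcon h x) = - kcon h (kcon g x).
Proof.
elim: N n x => [|N IH] n x; first by rewrite /= oppr0.
case: n x => [|n] [a b] /=.
  by rewrite !linearD !linearZ /= IH opprK addrAC.
congr (_, _) => /=.
  by rewrite !linearD !linearZ /= IH opprK addrAC.
by rewrite !kconN IH !opprK.
Qed.

Lemma kcon_sqr g N n (x : kos N n.+2) : kcon g (kcon g x) = 0.
Proof.
elim: N n x => [|N IH] n x //.
case: n x => [|n] [a b] /=.
  by rewrite kconD kconZ IH add0r scalerN subrr.
by rewrite kconD kconZ kconN !IH add0r scalerN subrr !oppr0.
Qed.

Definition koszul (g : nat -> A) (N : nat) : chainComplex A :=
  @ChainComplex A (kos N) (fun n => @kcon g N n : {linear kos N n.+1 -> kos N n})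
    (fun n x => @kcon_sqr g N n x).

Lemma projective_prod (M M' : lmodType A) :
  projective M -> projective M' -> projective (M * M')%type.
Proof.
move=> pM pM' N N' g f sg.
have l1 : linear (fun x : M => f (x, 0)).
  by move=> a x y; rewrite -linearP /=; congr (f (_, _)); rewrite /= scaler0 addr0.
have l2 : linear (fun x : M' => f (0, x)).
  by move=> a x y; rewrite -linearP /=; congr (f (_, _)); rewrite /= scaler0 addr0.
have [h1 e1] := pM N N' g (lin_of l1) sg.
have [h2 e2] := pM' N N' g (lin_of l2) sg.
have lh : linear (fun x : M * M' => h1 x.1 + h2 x.2).
  by move=> a x y /=; rewrite !linearP /= scalerDr addrACA.
exists (lin_of lh) => -[x y] /=.
rewrite linearD e1 e2 /= -linearD; congr (f (_, _)); [exact: addr0|exact: add0r].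
Qed.

Lemma projective_regular : projective (A^o).
Proof.
move=> N N' g f sg; have [n gn] := sg (f 1).
have lh : linear (fun x : A^o => x *: n).
  by move=> a x y /=; rewrite scalerDl scalerA.
exists (lin_of lh) => x /=.
by rewrite linearZ gn -linearZ /=; congr (f _); apply: mulr1.
Qed.

Lemma projective_rV0 : projective ('rV[A]_0).
Proof.
move=> N N' g f sg.
have lh : linear (fun x : 'rV[A]_0 => 0 : N) by move=> a x y; rewrite scaler0 addr0.
exists (lin_of lh) => x.
by rewrite /= raddf0 [x](thinmx0) raddf0.
Qed.

Lemma kos_projective N n : projective (kos N n).
Proof.
elim: N n => [|N IH] [|n] /=; [exact: projective_regular|exact: projective_rV0|exact: IH|].
exact: projective_prod.
Qed.

(** The identification of the 0-th exterior power with A. *)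
Fixpoint kaug (N : nat) : kos N 0 -> A :=
  if N is N'.+1 then @kaug N' else id.

Lemma kaugD N (x y : kos N 0) : kaug (x + y) = kaug x + kaug y.
Proof. by elim: N x y. Qed.

Lemma kaugZ N a (x : kos N 0) : kaug (a *: x) = a * kaug x.
Proof. by elim: N x. Qed.

Lemma kaug0 N : kaug (0 : kos N 0) = 0.
Proof. by elim: N. Qed.

Fixpoint kone (N : nat) : kos N 0 := if N is N'.+1 then kone N' else 1 : A^o.

Lemma kaug_one N : kaug (kone N) = 1.
Proof. by elim: N. Qed.

Lemma kaugK N (x : kos N 0) : x = kaug x *: kone N.
Proof. by elim: N x => //= x; rewrite [RHS]mulr1. Qed.

Lemma kaug_kcon_ideal g N (x : kos N 1) : ideal_upto g N (kaug (kcon g x)).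
Proof.
elim: N x => [|N IH] x //=; exists (kaug (kcon g x.1)); first exact: IH.
by exists (kaug x.2); rewrite kaugD kaugZ mulrC.
Qed.

Lemma ideal_upto_kcon g N a : ideal_upto g N a -> exists x : kos N 1, kaug (kcon g x) = a.
Proof.
elim: N a => [|N IH] a /=; first by move=> ->; exists 0.
move=> [b /IH[x <-] [c ->]]; exists (x, c *: kone N) => /=.
by rewrite kaugD !kaugZ kaug_one mulr1 mulrC.
Qed.

(** The complex on N + 1 elements is the cone of multiplication by g N on the
    complex on N elements.  In a cycle (a, b) the component b is a cycle, hence
    up to a factor a boundary: by induction in positive degree, and by
    regularity in degree 0, where g N b is a boundary.  Subtracting it leaves a
    cycle of the smaller complex. *)
Lemma koszul_acyclic (p : set A) g N : prime_ideal p ->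
  (forall i, (i < N)%N -> exists2 t, ~ p t &
      forall a, ideal_upto g i (a * g i) -> ideal_upto g i (t * a)) ->
  forall n, exists2 t, ~ p t &
    forall z : kos N n.+1, kcon g z = 0 -> exists x, kcon g x = t *: z.
Proof.
move=> [ip p1 pM]; elim: N => [|N IH] reg n.
  exists 1 => // z _; exists 0; rewrite raddf0; symmetry; exact: thinmx0.
have {}IH := IH (fun i iN => reg i (ltnW iN)).
have [t pt tP] := IH n.
case: n t pt tP => [|n] t pt tP.
  have [u pu uP] := reg N (leqnn _).
  exists (t * u); first by case/pM.
  move=> [a b] /= e.
  have /uP/ideal_upto_kcon[x ex] : ideal_upto g N (kaug b * g N).
    have := congr1 (@kaug N) e; rewrite kaugD kaugZ kaug0 addrC => /eqP.
    rewrite addr_eq0 mulrC => /eqP ->.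
    by apply: idealN; [exact: ideal_upto_ideal|exact: kaug_kcon_ideal].
  have ex' : kcon g x = u *: b.
    rewrite [LHS]kaugK ex [in RHS](kaugK b) scalerA //.
  have [y ey] : exists y, kcon g y = t *: (u *: a + g N *: x).
    apply: tP; rewrite kconD !kconZ ex' scalerA [g N * u]mulrC -scalerA -scalerDr.
    by rewrite e scaler0.
  exists (y, - (t *: x)) => /=; congr (_, _).
    by rewrite ey scalerN scalerDr !scalerA [t * g N]mulrC addrK.
  by rewrite kconN kconZ opprK ex' scalerA.
have [u pu uP] := IH n.
exists (t * u); first by case/pM.
move=> [a b] /= [ea /eqP]; rewrite oppr_eq0 => /eqP eb.
have [x ex'] := uP b eb.
have [y ey] : exists y, kcon g y = t *: (u *: a + g N *: x).
  apply: tP; rewrite kconD !kconZ ex' scalerA [g N * u]mulrC -scalerA -scalerDr.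
  by rewrite ea scaler0.
exists (y, - (t *: x)) => /=; congr (_, _).
  by rewrite ey scalerN scalerDr !scalerA [t * g N]mulrC addrK.
by rewrite kconN kconZ opprK ex' scalerA.
Qed.

End Koszul.

(** * Forms on Koszul complexes *)

(** Forms on an A-module with values in O, where A acts on O through lam. *)
Definition sform (A O : pzRingType) (lam : A -> O) (M : lmodType A) (f : M -> O) : Prop :=
  forall a x y, (f (a *: x + y) = lam a * f x + f y)%R.

Section Forms.
Variables (A O : comNzRingType) (lam : {rmorphism A -> O}).
Local Open Scope ring_scope.
Local Open Scope classical_set_scope.

Section SformTheory.
Variables (M : lmodType A) (f : M -> O).
Hypothesis sf : sform lam f.

Lemma sformD x y : f (x + y) = f x + f y.
Proof. by rewrite -[x]scale1r sf rmorph1 mul1r scale1r. Qed.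

Lemma sform0 : f 0 = 0.
Proof. by apply: (addrI (f 0)); rewrite -sformD !addr0. Qed.

Lemma sformZ a x : f (a *: x) = lam a * f x.
Proof. by rewrite -[_ *: _]addr0 sf sform0 addr0. Qed.

Lemma sformN x : f (- x) = - f x.
Proof. by rewrite -scaleN1r sformZ rmorphN1 mulN1r. Qed.
End SformTheory.

Lemma sform_kaug N : sform lam (fun k : kos A N 0 => lam (kaug k)).
Proof. by move=> a x y; rewrite kaugD kaugZ rmorphD rmorphM. Qed.

Lemma kcon_eq0 g N : (forall i, (i < N)%N -> g i = 0) ->
  forall n (x : kos A N n.+1), kcon g x = 0.
Proof.
elim: N => [|N IH] g0 [|n] x //=; rewrite !IH ?g0 // ?scale0r ?addr0 ?oppr0 //.
all: by move=> i iN; apply/g0/ltnW.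
Qed.

(** The forms on the exterior powers of A^N are spanned by the iterated
    contractions by coordinate forms, followed by lam. *)
Lemma kos_forms_ind N (C : forall n, (kos A N n -> O) -> Prop) :
  (forall n, C n (fun=> 0)) ->
  (forall n a f g, C n f -> C n g -> C n (fun k => a * f k + g k)) ->
  C 0%N (fun k => lam (kaug k)) ->
  (forall n i f, (i < N)%N -> sform lam f -> C n f ->
     C n.+1 (fun k => f (kcon (fun j => (j == i)%:R) k))) ->
  forall n f, sform lam f -> C n f.
Proof.
have C0 N' (C' : forall n, (kos A N' n -> O) -> Prop) :
  (forall n, C' n (fun=> 0)) ->
  (forall n a f g, C' n f -> C' n g -> C' n (fun k => a * f k + g k)) ->
  C' 0%N (fun k => lam (kaug k)) -> forall f, sform lam f -> C' 0%N f.
  move=> Cz CD C1 f sf.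
  suff -> : f = fun k => f (kone A N') * lam (kaug k) + 0 by apply: CD.
  by apply/funext => k; rewrite [k in LHS]kaugK sformZ // addr0 mulrC.
elim: N C => [|N IH] C Cz CD C1 CM [|n] f sf; try exact: C0.
  suff -> : f = fun=> 0 by [].
  by apply/funext => k; rewrite [k]thinmx0 sform0.
pose C' n : (kos A N n -> O) -> Prop :=
  if n is n'.+1 then fun f => C n'.+1 (fun k => f k.1) else fun f => C 0%N f.
have {}IH m g : sform lam g -> C' m g.
  apply: IH => [[|k]|[|k] b h h'||[|k] i h iN sh Ch] //=.
  - exact: CD.
  - exact: CD.
  - have := CM 0%N i h (ltnW iN) sh Ch; congr C; apply/funext => x /=.
    by rewrite gtn_eqF // scale0r addr0.
  - have sh' : sform lam (fun k0 : kos A N.+1 k.+1 => h k0.1) by move=> a x y; rewrite sh.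
    have := CM k.+1 i (fun k => h k.1) (ltnW iN) sh' Ch; congr C; apply/funext => x /=.
    by rewrite gtn_eqF // scale0r addr0.
pose f1 (k : kos A N n.+1) : O := f (k, 0 : kos A N n).
pose f2 (k : kos A N n) : O := f (0 : kos A N n.+1, k).
have s1 : sform lam f1.
  move=> a x y; rewrite /f1 -sf; congr f; congr (_, _); rewrite /=.
  by rewrite scaler0 addr0.
have s2 : sform lam f2.
  move=> a x y; rewrite /f2 -sf; congr f; congr (_, _); rewrite /=.
  by rewrite scaler0 addr0.
have -> : f = fun k => 1 * f1 k.1 + f2 k.2.
  apply/funext => -[x y]; rewrite mul1r /f1 /f2 -sformD //; congr f; congr (_, _).
    by rewrite /= addr0.
  by rewrite /= add0r.
apply: CD; first exact: (IH n.+1 f1).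
have := IH n f2 s2; clearbody f1 f2; clear f sf.
case: n f1 f2 s1 s2 => [|n] f1 f2 s1 s2 /= h.
  (* contraction by the last coordinate is (x, y) |-> y up to terms that vanish *)
  have := CM 0%N N f2 (ltnSn N) s2 h; congr C; apply/funext => x /=.
  by rewrite eqxx scale1r kcon_eq0 ?add0r // => j jN; rewrite ltn_eqF.
have s2' : sform lam (fun k0 : kos A N.+1 n.+1 => f2 k0.1) by move=> a x y; rewrite s2.
have := CM n.+1 N (fun k => f2 k.1) (ltnSn N) s2' h; congr C; apply/funext => x /=.
by rewrite eqxx scale1r kcon_eq0 ?add0r // => j jN; rewrite ltn_eqF.
Qed.

Variables (E : gradedAlg O) (v : nat -> E 1%N).

(** Products with a factor of degree one on the right, with a fixed proof of the
    degree equation. *)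
Definition mul1 n (x : E n) (y : E 1%N) : E n.+1 := gmul (esym (addn1 n)) x y.

Lemma mul1Pl n a (x x' : E n) y : mul1 (a *: x + x') y = a *: mul1 x y + mul1 x' y.
Proof. exact: gmulPl. Qed.

Lemma mul1Dl n (x x' : E n) y : mul1 (x + x') y = mul1 x y + mul1 x' y.
Proof. exact: gmulDl. Qed.

Lemma mul1Dr n (x : E n) y y' : mul1 x (y + y') = mul1 x y + mul1 x y'.
Proof. exact: gmulDr. Qed.

Lemma mul1Nl n (x : E n) y : mul1 (- x) y = - mul1 x y.
Proof. by rewrite -!scaleN1r /mul1 gmulZl. Qed.

(** Forms on the n-th exterior power of A^N are elements of the n-th exterior
    power of the dual O^N; this is the effect on them of the algebra map that
    sends the i-th coordinate form to v i. *)
Fixpoint form_eval N : forall n, (kos A N n -> O) -> E n :=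
  match N with
  | 0 => fun n => if n is 0 then fun f => f (1 : A^o) *: gone E else fun=> 0
  | N'.+1 => fun n =>
    match n return (kos A N'.+1 n -> O) -> E n with
    | 0 => fun f => @form_eval N' 0%N f
    | n'.+1 => fun f => @form_eval N' n'.+1 (fun k => f (k, 0 : kos A N' n')) +
        mul1 (@form_eval N' n' (fun k => f (0 : kos A N' n'.+1, k))) (v N')
    end
  end.

Lemma form_evalP (N n : nat) b (f g : kos A N n -> O) :
  form_eval (fun k => b * f k + g k) = b *: form_eval f + form_eval g.
Proof.
elim: N n f g => [|N IH] [|n] f g /=.
- by rewrite scalerDl scalerA.
- by rewrite scaler0 addr0.
- exact: IH.
- by rewrite !IH mul1Pl !scalerDr addrACA.
Qed.

Lemma form_eval0 (N n : nat) : @form_eval N n (fun=> 0) = 0.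
Proof.
elim: N n => [|N IH] [|n] //=; first exact: scale0r.
by rewrite !IH add0r /mul1 gmul0l.
Qed.

Lemma form_evalZ (N n : nat) b (f : kos A N n -> O) :
  form_eval (fun k => b * f k) = b *: form_eval f.
Proof.
rewrite -[RHS]addr0 -[in RHS](form_eval0 N n) -form_evalP; congr form_eval.
by apply/funext => k; rewrite addr0.
Qed.

Hypothesis v2 : forall (e : 2%N = (1 + 1)%N) i, gmul e (v i) (v i) = 0.
Hypothesis vN : forall (e : 2%N = (1 + 1)%N) i j, gmul e (v i) (v j) = - gmul e (v j) (v i).

Definition lincomb N (g : nat -> A) : E 1%N := \sum_(i < N) lam (g i) *: v i.

Lemma mul1_anti n (x : E n) N g : mul1 (mul1 x (lincomb N g)) (v N) =
  - mul1 (mul1 x (v N)) (lincomb N g).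
Proof.
have e3 : n.+2 = (n + 2)%N by rewrite addn2.
rewrite /mul1 (gmulA (esym (addn1 n)) (esym (addn1 n.+1)) (erefl 2%N) e3).
rewrite (gmulA (esym (addn1 n)) (esym (addn1 n.+1)) (erefl 2%N) e3).
rewrite -scaleN1r -gmulZr scaleN1r; congr gmul.
elim: N {x e3} (N in v N) => [|N IH] M; rewrite /lincomb ?big_ord0 ?big_ord_recr /=.
  by rewrite gmul0l gmul0r oppr0.
by rewrite gmulDl gmulDr IH opprD gmulZl gmulZr vN scalerN.
Qed.

Lemma mul1_sqr n (x : E n) i : mul1 (mul1 x (v i)) (v i) = 0.
Proof.
have e3 : n.+2 = (n + 2)%N by rewrite addn2.
by rewrite /mul1 (gmulA (esym (addn1 n)) _ (erefl 2%N) e3) v2 gmul0r.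
Qed.

(** Composing a form with a contraction is multiplying the corresponding element
    of the exterior algebra by the contracting form. *)
Lemma form_eval_kcon N n (f : kos A N n -> O) g : sform lam f ->
  form_eval (fun k => f (kcon g k)) = mul1 (form_eval f) (lincomb N g).
Proof.
elim: N n f => [|N IH] n f sf.
  rewrite /lincomb big_ord0 /mul1 gmul0r /=.
  by rewrite /form_eval; case: n f sf.
have lS : lincomb N.+1 g = lincomb N g + lam (g N) *: v N.
  by rewrite /lincomb big_ord_recr.
rewrite lS mul1Dr; case: n f sf => [|n] f sf /=.
  congr (_ + _).
    by rewrite -IH //; congr form_eval; apply/funext => k; rewrite scaler0 addr0.
  rewrite /mul1 gmulZr -gmulZl -form_evalZ; congr (gmul _ _ _).
  by congr form_eval; apply/funext => k; rewrite kcon0 add0r sformZ.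
pose f1 (k : kos A N n.+1) : O := f (k, 0 : kos A N n).
pose f2 (k : kos A N n) : O := f (0 : kos A N n.+1, k).
have s1 : sform lam f1.
  move=> a x y; rewrite /f1 -sf; congr f; congr (_, _); rewrite /=.
  by rewrite scaler0 addr0.
have s2 : sform lam f2.
  move=> a x y; rewrite /f2 -sf; congr f; congr (_, _); rewrite /=.
  by rewrite scaler0 addr0.
rewrite mul1Dl -IH // /mul1 gmulZr -!/(mul1 _ _).
have -> : (fun k => f (kcon g k + g N *: 0, - kcon g 0)) = fun k => f1 (kcon g k).
  by apply/funext => k; rewrite scaler0 addr0 kcon0 oppr0.
have -> : (fun k => f (kcon g 0 + g N *: k, - kcon g k)) =
    fun k => lam (g N) * f1 k + (- 1) * f2 (kcon g k).
  apply/funext => k; rewrite kcon0 add0r mulN1r -sformZ // -sformN //.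
  rewrite /f1 /f2 -sformD //; congr f; congr (_, _); rewrite /=.
    by rewrite addr0.
  by rewrite add0r.
rewrite (form_evalP _ f1 (fun k => - 1 * f2 (kcon g k))).
rewrite (form_evalZ _ (fun k => f2 (kcon g k))) !IH //.
rewrite mul1Pl scaleN1r -/f1 -/f2 mul1Nl mul1_anti opprK.
rewrite -!addrA; congr (_ + _); rewrite addrC; congr (_ + _).
by rewrite mul1Dl mul1_sqr addr0.
Qed.

End Forms.

(** * Chain maps from projective complexes to resolutions *)

Section Restriction.
Variables (A B : pzRingType) (phi : {rmorphism A -> B}) (N : lmodType B).
Local Open Scope ring_scope.

(** N as a module over A, for the use of projectivity over A with targets that
    are modules over B. *)
Definition restr : Type := N.
HB.instance Definition _ := GRing.Zmodule.on restr.

Definition restr_scale (a : A) (x : restr) : restr := phi a *: (x : N).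
Let restrA a b x : restr_scale a (restr_scale b x) = restr_scale (a * b) x.
Proof. by rewrite /restr_scale scalerA rmorphM. Qed.
Let restr1 : left_id 1 restr_scale.
Proof. by move=> x; rewrite /restr_scale rmorph1 scale1r. Qed.
Let restrDr : right_distributive restr_scale +%R.
Proof. by move=> a x y; apply: scalerDr. Qed.
Let restrDl x : {morph restr_scale^~ x : a b / a + b}.
Proof. by move=> a b; rewrite /restr_scale rmorphD scalerDl. Qed.
HB.instance Definition _ := GRing.Zmodule_isLmodule.Build A restr
  restrA restr1 restrDr restrDl.

(** All lifts out of projective modules are linear choices of this kind: the
    graph of the relation is a module over A that maps onto M, and a section of
    this map selects related elements. *)
Lemma projective_select (M : lmodType A) (S : N -> M -> Prop) : projective M ->
  (forall a n m n' m', S n m -> S n' m' -> S (phi a *: n + n') (a *: m + m')) ->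
  (forall m, exists n, S n m) ->
  exists2 h : M -> N, linear_for (phi \; *:%R) h & forall m, S (h m) m.
Proof.
move=> pM SP St.
have S0 : S 0 0.
  have [n Sn] := St 0; have := SP (-1) _ _ _ _ Sn Sn.
  by rewrite rmorphN1 !scaleN1r !addNr.
pose G : submod (restr * M)%type :=
  @Submod A (restr * M)%type (fun u => S u.1 u.2) S0
    (fun a u v Su Sv => SP a _ _ _ _ Su Sv).
have lp : linear (fun u : submod_type G => (val u).2) by [].
have li : linear (fun x : M => x) by [].
have [y|h hP] := pM _ _ (lin_of lp) (lin_of li).
  have [n Sn] := St y.
  by exists (@to_submod _ _ G (n, y) Sn).
exists (fun m => (val (h m)).1 : N).
  by move=> a x y; rewrite linearP.
move=> m; have /= e := hP m; rewrite -[in X in S _ X]e.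
exact: (submod_typeP (h m)).
Qed.

End Restriction.

Lemma dependent_choice_family (T : nat -> Type) (good : forall j, T j -> Prop)
    (step : forall j, T j -> T j.+1 -> Prop) :
  (exists f, good 0%N f) ->
  (forall j f, good j f -> exists g, good j.+1 g /\ step j f g) ->
  exists F : forall j, T j, forall j, good j (F j) /\ step j (F j) (F j.+1).
Proof.
move=> g0 gS.
have start : {f : T 0%N | good 0%N f} by apply: cid.
have next j (u : {f : T j | good j f}) : {g : T j.+1 | good j.+1 g /\ step j (sval u) g}.
  by apply: cid; apply: gS; case: u.
pose F := nat_rect (fun j => {f : T j | good j f}) start
  (fun j u => exist _ (sval (next j u)) (proj1 (svalP (next j u)))).
exists (fun j => sval (F j)) => j; split; first exact: (svalP (F j)).
exact: (proj2 (svalP (next j (F j)))).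
Qed.

Lemma signK (R : pzRingType) n : ((-1) ^+ n * (-1) ^+ n = 1 :> R)%R.
Proof. by rewrite -exprD addnn -mul2n exprM sqrrN !expr1n. Qed.

(** The forms on P n that vanish in H^n(Hom(P, O)), O being an A-module through
    lam. *)
Definition null (A O : pzRingType) (lam : A -> O) (P : chainComplex A) n :
    (P n -> O) -> Prop :=
  match n with
  | 0 => fun f => forall x, f x = 0%R
  | n'.+1 => fun f => exists2 h : P n' -> O, sform lam h & forall x, f x = h (cc_d P n' x)
  end.

Section HomCochains.
Variables (O : idomainType) (c : nat) (Y : augAlg O c) (Q : projRes Y).
Variables (A : comNzRingType) (phi : {rmorphism A -> Y}) (P : chainComplex A).
Hypothesis projP : forall i, projective (P i).
Local Open Scope ring_scope.

Local Notation lam := (aug Y \o phi).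
Local Notation eps := (res_eps Q).

Let epsP b x y : eps (b *: x + y) = aug Y b * eps x + eps y.
Proof. exact: linearP. Qed.

Let epsZ b x : eps (b *: x) = aug Y b * eps x.
Proof. exact: linearZ. Qed.

Lemma eps_sign n x : eps ((-1) ^+ n *: x) = (-1) ^+ n * eps x.
Proof. by rewrite epsZ rmorphXn rmorphN1. Qed.

Definition slin (M : lmodType A) (N : lmodType Y) (f : M -> N) : Prop :=
  forall a x y, f (a *: x + y) = phi a *: f x + f y.

Section SlinTheory.
Variables (M : lmodType A) (N : lmodType Y) (f : M -> N).
Hypothesis lf : slin f.

Lemma slinD x y : f (x + y) = f x + f y.
Proof. by rewrite -[x]scale1r lf rmorph1 !scale1r. Qed.

Lemma slin0 : f 0 = 0.
Proof. by apply: (addrI (f 0)); rewrite -slinD !addr0. Qed.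

End SlinTheory.

Let cyc j : Q j -> Prop :=
  match j with
  | 0 => fun z => eps z = 0
  | j'.+1 => fun z => cc_d Q j' z = 0
  end.

Let exact_cyc j z : @cyc j z -> exists y, cc_d Q j y = z.
Proof. by case: j z => [|j] z /=; [move/res_exact0|move/res_exact]. Qed.

Let cycP j b z z' : @cyc j z -> @cyc j z' -> @cyc j (b *: z + z').
Proof.
case: j z z' => [|j] z z' /= ez ez'; first by rewrite epsP ez ez' mulr0 addr0.
by rewrite linearP ez ez' scaler0 addr0.
Qed.

Let cyc_d j y : @cyc j (cc_d Q j y).
Proof. by case: j y => [|j] y /=; [apply/res_exact0; exists y|apply: cc_dd]. Qed.

Let lift_step j i (r : P i -> Q j) : slin r -> (forall x, cyc (r x)) ->
  exists2 g : P i -> Q j.+1, slin g & forall x, cc_d Q j (g x) = r x.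
Proof.
move=> lr cr.
have [||h lh hP] := @projective_select _ _ phi (Q j.+1) (P i)
    (fun y x => cc_d Q j y = r x) (@projP i); last by exists h.
  by move=> a y x y' x' e e'; rewrite linearP lr e e'.
by move=> x; apply: exact_cyc.
Qed.

(** Surjectivity of H^n(Hom(P, Q)) -> H^n(Hom(P, O)): the components
    P (j + n) -> Q j of a chain map with prescribed form on P n are chosen one
    after another, as P is projective and Q is exact.  Each stage consists of
    maps P i -> Q j for all i, which vanish for i <> j + n; this avoids
    transports between P i and P (j + n). *)
Lemma cocycle_exists n (f0 : P n -> O) : sform lam f0 ->
  (forall x, f0 (cc_d P n x) = 0) ->
  exists2 F : forall i j, P i -> Q j, cocycle phi n F & forall x, eps (F n 0%N x) = f0 x.
Proof.
move=> s0 f0d.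
pose good j (f : forall i, P i -> Q j) := [/\ forall i, slin (f i),
  forall i x, i <> (j + n)%N -> f i x = 0 & forall i x, cyc (f i (cc_d P i x))].
pose step j (f : forall i, P i -> Q j) (g : forall i, P i -> Q j.+1) :=
  forall i x, cc_d Q j (g i.+1 x) = (-1) ^+ n *: f i (cc_d P i x).
have [f gf ef] : exists2 f, good 0%N f & forall x, eps (f n x) = f0 x.
  have [g lg eg] : exists2 g : P n -> Q 0%N, slin g & forall x, eps (g x) = f0 x.
    have [||h lh hP] := @projective_select _ _ phi (Q 0%N) (P n)
      (fun y x => eps y = f0 x) (@projP n); last by exists h.
      by move=> a y x y' x' e e'; rewrite epsP s0 e e'.
    by move=> x; apply: res_surj.
  pose f i : P i -> Q 0%N :=
    if i =P n is ReflectT e then fun x => g (ecast i (P i) e x) else fun=> 0.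
  have fn : f n = g by rewrite /f; case: eqP => // e; apply/funext => x; rewrite eq_axiomK.
  have f0' i : i <> n -> f i = fun=> 0 by rewrite /f; case: eqP.
  exists f; last by rewrite fn.
  split=> [i|i x /f0' ->//|i x].
  - have [->|/eqP/f0' ->] := eqVneq i n; first by rewrite fn.
    by move=> a x y; rewrite scaler0 addr0.
  - have [ei|/eqP/f0' ->] := eqVneq i n; last exact: (raddf0 eps).
    by move: x; rewrite ei fn => x; rewrite /= eg.
have [||F HF] := @dependent_choice_family (fun j => forall i, P i -> Q j)
    (fun j => if j is j'.+1 then @good j'.+1 else fun g => g = f) step.
- by exists f.
- move=> j g; have {}gj : (if j is j'.+1 then @good j'.+1 else fun g => g = f) g -> good j g.
    by case: j g => // g ->.
  move=> /gj[lg g0 gd].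
  have H i : exists h : P i -> Q j.+1, [/\ slin h, i <> (j.+1 + n)%N -> forall x, h x = 0 &
      match i return (P i -> Q j.+1) -> Prop with
      | 0 => fun=> True
      | i'.+1 => fun h => forall x, cc_d Q j (h x) = (-1) ^+ n *: g i' (cc_d P i' x)
      end h].
    case: i => [|i].
      by exists (fun=> 0); split=> // a x y; rewrite scaler0 addr0.
    have [ei|ei] := eqVneq i (j + n)%N; last first.
      exists (fun=> 0); split=> // [a x y|x]; first by rewrite scaler0 addr0.
      by rewrite raddf0 g0 ?scaler0 //; apply/eqP.
    have lr : slin (fun x : P i.+1 => (-1) ^+ n *: g i (cc_d P i x)).
      move=> a x y; rewrite linearP lg scalerDr !scalerA; congr (_ *: _ + _).
      exact: mulrC.
    have [x|h lh hP] := lift_step lr; last by exists h; split=> // -[]; rewrite ei.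
    rewrite -[_ *: _]addr0; apply: cycP => //; have := cyc_d (0 : Q j.+1).
    by rewrite raddf0.
  pose h i := sval (cid (H i)); exists h; split.
    split=> [i|i x ne|i x]; rewrite /h; case: (cid (H i)) => u /= [lu u0 eu] //.
      by rewrite u0.
    case: i u lu u0 eu x => [|i] u lu u0 eu x; first by rewrite u0 // raddf0.
    by rewrite eu cc_dd slin0 // scaler0.
  by move=> i x; rewrite /h; case: (cid (H i.+1)) => u [].
have HF0 := HF 0%N.
have {}HF j : good j (F j) /\ step j (F j) (F j.+1).
  by have := HF j; case: j => [|j] [// e st]; split=> //; rewrite e.
exists (fun i j => F j i); last first.
  by move=> x; have [-> _] := HF0; rewrite ef.
split; first split.
- by move=> i j; have [[lF _ _] _] := HF j; apply: lF.
- by move=> i j x; rewrite addn0; have [[_ zF _] _] := HF j; apply: zF.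
- by move=> i j x; have [_ stF] := HF j; apply: stF.
Qed.

(** Injectivity of H^n(Hom(P, Q)) -> H^n(Hom(P, O)): the components of a homotopy
    are chosen one after another, starting with a lift of the form that makes
    the bottom form null. *)
Lemma null_coboundary n (F : forall i j, P i -> Q j) : cocycle phi n F ->
  null lam (fun x => eps (F n 0%N x)) -> coboundary phi n F.
Proof.
move=> [[lF zF] dF] nF.
have F0 i j x : i <> (j + n)%N -> F i j x = 0 by move=> ne; apply: zF; rewrite addn0.
have H0 i : exists h : P i -> Q 0%N, [/\ slin h, i.+1 <> n -> forall x, h x = 0 &
    forall x, eps (F i.+1 0%N x - (-1) ^+ n *: h (cc_d P i x)) = 0].
  have [ei|ei] := eqVneq i.+1 n; last first.
    exists (fun=> 0); split=> // [a x y|x]; first by rewrite scaler0 addr0.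
    by rewrite scaler0 subr0 F0 ?raddf0 //; apply/eqP.
  subst n; case: nF => h0 s0 eh0.
  have [||h lh hP] := @projective_select _ _ phi (Q 0%N) (P i)
      (fun y x => eps y = (-1) ^+ i.+1 * h0 x) (@projP i).
  - by move=> a y x y' x' e e'; rewrite epsP s0 e e' mulrDr mulrCA.
  - by move=> x; apply: res_surj.
  exists h; split=> // x.
  by rewrite raddfB /= eps_sign hP mulrA signK mul1r eh0 subrr.
(* what the next component of the homotopy has to bound *)
pose res j (h : forall i, P i -> Q j) i : P i -> Q j :=
  match i with
  | 0 => fun x => F 0%N j x
  | i'.+1 => fun x => F i'.+1 j x - (-1) ^+ n *: h i' (cc_d P i' x)
  end.
pose good j (h : forall i, P i -> Q j) := [/\ forall i, slin (h i),
  forall i x, i.+1 <> (j + n)%N -> h i x = 0 & forall i x, cyc (res j h i x)].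
pose step j (h : forall i, P i -> Q j) (g : forall i, P i -> Q j.+1) :=
  forall i x, cc_d Q j (g i x) = res j h i x.
have lres j h i : good j h -> slin (res j h i).
  move=> [lh _ _]; case: i => [|i] a x y /=; first exact: lF.
  rewrite lF linearP lh !scalerDr !scalerN !scalerA [_ * phi a]mulrC opprD.
  by rewrite addrACA.
have [||h Hh] := @dependent_choice_family (fun j => forall i, P i -> Q j) good step.
- exists (fun i => sval (cid (H0 i))).
  split=> [i|i x|i x]; last first.
  + case: i x => [|i] x /=; last by case: (cid (H0 i)) => h [].
    case: n nF {F0 H0 res good step lres zF dF} (@F0) => [nF _|n _ F0].
      by rewrite nF.
    by rewrite F0 ?raddf0.
  + by move=> ne; case: (cid (H0 i)) => h /= [_ zh _]; apply: zh.
  + by case: (cid (H0 i)) => h [].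
- move=> j h gh; have [lh zh ch] := gh.
  have H i : exists g : P i -> Q j.+1, [/\ slin g, i <> (j + n)%N -> forall x, g x = 0 &
      forall x, cc_d Q j (g x) = res j h i x].
    have [ei|/eqP ei] := eqVneq i (j + n)%N; last first.
      exists (fun=> 0); split=> // [a x y|x]; first by rewrite scaler0 addr0.
      rewrite raddf0; case: i ei x => [|i] ei x /=; rewrite F0 // zh ?scaler0 ?subr0 //.
    by have [g lg eg] := lift_step (lres j h i gh) (ch i); exists g; split.
  exists (fun i => sval (cid (H i))); split.
    split=> [i|i x ne|i x]; last first.
    + case: i x => [|i] x /=; first by rewrite F0 ?raddf0.
      rewrite raddfB /= linearZ /= dF.
      case: (cid (H i)) => g /= [_ _ ->] {g}.
      case: i x => [|i] x /=; first by rewrite subrr.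
      by rewrite cc_dd (slin0 (lh i)) scaler0 subr0 subrr.
    + by case: (cid (H i)) => g /= [_ + _]; apply=> ei; apply: ne; rewrite ei.
    + by case: (cid (H i)) => g [].
  by move=> i x /=; case: (cid (H i)) => g /= [].
exists (fun i j => h j i).
  split=> [i j|i j x ne].
    by have [[lh _ _] _] := Hh j; apply: lh.
  by have [[_ zh _] _] := Hh j; apply: zh => e; apply: ne; rewrite addn1.
split=> [j x|i j x].
  by have [_ ->] := Hh j.
by have [_ ->] := Hh j; rewrite /= subrK.
Qed.

Lemma coboundary_null n (F : forall i j, P i -> Q j) :
  coboundary phi n F -> null lam (fun x => eps (F n 0%N x)).
Proof.
move=> [h [lh zh] [F0 FS]].
have ed x : eps (cc_d Q 0 x) = 0 by apply/res_exact0; exists x.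
case: n lh zh F0 FS => [|n] lh zh F0 FS /=; first by move=> x; rewrite F0 ed.
exists (fun x => (-1) ^+ n.+1 * eps (h n 0%N x)).
  by move=> a x y; rewrite lh epsP /= mulrDr mulrCA.
by move=> x; rewrite FS raddfD /= ed add0r eps_sign.
Qed.

End HomCochains.

(** * Null forms *)

Lemma nullP (A O : comNzRingType) (lam : A -> O) (P : chainComplex A) n (a : O)
    (f g : P n -> O) :
  null lam f -> null lam g -> null lam (fun x => (a * f x + g x)%R).
Proof.
case: n f g => [|n] f g /=; first by move=> f0 g0 x; rewrite f0 g0 mulr0 addr0.
move=> [h sh fh] [k sk gk]; exists (fun x => (a * h x + k x)%R).
  by move=> b x y; rewrite sh sk !mulrDr mulrCA addrACA.
by move=> x; rewrite fh gk.
Qed.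

Section NullComposition.
Local Open Scope ring_scope.
Variables (O : comNzRingType) (A A' : comNzRingType) (phi : {rmorphism A' -> A}).
Variables (lam : {rmorphism A -> O}) (P' : chainComplex A') (P : chainComplex A).

(** With the next lemma: the class of the composite of cocycles, read off from
    its bottom form, depends only on the classes of the factors. *)
Lemma null_comp_cocycle m n (f : P m -> O) (G : forall i j, P' i -> P j) :
  null lam f -> cocycle phi n G -> null (lam \o phi) (fun x => f (G (m + n)%N m x)).
Proof.
case: m f => [|m] f /=; last first.
  move=> [h sh fh] [[lG zG] dG]; exists (fun x => (-1) ^+ n * h (G (m + n)%N m x)).
    by move=> a x y; rewrite lG sh /= mulrDr mulrCA.
  by move=> x; rewrite fh dG (sformZ sh) rmorphXn rmorphN1.
move=> f0; case: n => [|n] /= _; first by move=> x; rewrite f0.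
exists (fun=> 0); last by move=> x; rewrite f0.
by move=> a x y; rewrite mulr0 addr0.
Qed.

Lemma cocycle_comp_coboundary m n (f : P m -> O) (F : forall i j, P' i -> P j) :
  sform lam f -> (forall x, f (cc_d P m x) = 0) -> coboundary phi n F ->
  null (lam \o phi) (fun x => f (F (m + n)%N m x)).
Proof.
move=> sf fd [h [lh zh] [F0 FS]].
case: m f sf fd => [|m] f sf fd; last first.
  exists (fun x => (-1) ^+ n * f (h (m + n)%N m.+1 x)).
    by move=> a x y; rewrite lh sf mulrDr mulrCA.
  move=> x; rewrite FS (sformD sf) fd add0r (sformZ sf) rmorphXn rmorphN1 //.
case: n lh zh F0 FS => [|n] lh zh F0 FS; first by move=> x; rewrite F0 fd.
exists (fun x => (-1) ^+ n.+1 * f (h n 0%N x)).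
  by move=> a x y; rewrite lh sf mulrDr mulrCA.
by move=> x; rewrite FS (sformD sf) fd add0r (sformZ sf) rmorphXn rmorphN1.
Qed.

End NullComposition.

Section KoszulNull.
Local Open Scope ring_scope.
Variables (O A : comNzRingType) (lam : {rmorphism A -> O}) (g : nat -> A) (N : nat).
Hypothesis lg : forall i, (i < N)%N -> lam (g i) = 0.

(** The Koszul differential has values in the multiples of the g i, on which
    forms vanish. *)
Lemma sform_kcon n (f : kos A N n -> O) x : sform lam f -> f (kcon g x) = 0.
Proof.
elim: N lg n f x => [|M IH] lg' [|n] f x sf /=; try by rewrite (sform0 sf).
  rewrite (sformD sf) (sformZ sf) lg' // mul0r addr0.
  by apply: IH => // i iM; apply/lg'/ltnW.
have -> : (kcon g x.1 + g M *: x.2, - kcon g x.2) =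
    g M *: (x.2, 0) + ((kcon g x.1, 0) + (0, - kcon g x.2)) :> kos A M.+1 n.+1.
  by congr (_, _); rewrite /= ?scaler0 ?addr0 ?add0r // addrC.
rewrite sf lg' // mul0r add0r (sformD sf).
pose f1 (k : kos A M n.+1) : O := f (k, 0 : kos A M n).
pose f2 (k : kos A M n) : O := f (0 : kos A M n.+1, k).
rewrite -[X in X + _]/(f1 (kcon g x.1)) -[X in _ + X]/(f2 (- kcon g x.2)) -kconN.
have lgM i : (i < M)%N -> lam (g i) = 0 by move=> iM; apply/lg'/ltnW.
rewrite !IH ?addr0 // => a y z; rewrite /f1 /f2 -sf; congr f; congr (_, _).
  by rewrite /= scaler0 addr0.
by rewrite /= scaler0 addr0.
Qed.

Lemma null_koszul n (f : koszul g N n -> O) : null lam f -> forall x, f x = 0.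
Proof.
case: n f => [|n] f //= [h sh fh] x; rewrite fh; exact: sform_kcon.
Qed.

End KoszulNull.

Section KoszulDegreeOne.
Local Open Scope ring_scope.
Variables (O A : comNzRingType) (lam : {rmorphism A -> O}) (g : nat -> A).

(** Both sides are sums over i of lam(k_i) L(g i), where L is a form on the kernel
    of lam that is known only through the two properties assumed. *)
Lemma sform_kos1 (L : A -> O) (h : nat -> A) N :
  (forall y y', lam y = 0 -> lam y' = 0 -> L (y + y') = L y + L y') ->
  (forall b y, lam y = 0 -> L (b * y) = lam b * L y) ->
  (forall i, (i < N)%N -> lam (g i) = 0) ->
  (forall i, (i < N)%N -> lam (h i) = L (g i)) ->
  forall k : kos A N 1, L (kaug (kcon g k)) = lam (kaug (kcon h k)).
Proof.
move=> LD LM; elim: N => [|N IH] lg lh k /=.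
  have := LM 0 0 (rmorph0 lam); rewrite mul0r rmorph0 mul0r => -> //.
have lg' i : (i < N)%N -> lam (g i) = 0 by move=> iN; apply/lg/ltnW.
rewrite !kaugD !kaugZ rmorphD rmorphM lh // -IH //; last by move=> i iN; apply/lh/ltnW.
rewrite LD ?[g N * _]mulrC ?LM //; first by rewrite [lam _ * _]mulrC.
- exact: lg.
- exact: (sform_kcon lg' _ (sform_kaug lam (N:=N))).
- by rewrite rmorphM lg ?mulr0.
Qed.

Lemma kos_basis1 N i : (i < N)%N -> exists k : kos A N 1, forall h, kaug (kcon h k) = h i.
Proof.
elim: N => // N IH; rewrite ltnS leq_eqVlt => /predU1P[->|/IH[k kP]].
  by exists (0, kone A N) => h; rewrite /= kcon0 add0r kaugZ kaug_one mulr1.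
by exists (k, 0) => h; rewrite /= scaler0 addr0 kP.
Qed.

End KoszulDegreeOne.

(** * Restriction of Ext to a Koszul complex *)

Section KoszulRestriction.
Local Open Scope ring_scope.
Variables (O : idomainType) (c : nat) (X : augAlg O c) (P : projRes X).
Local Notation A := (aug_ring X).
Local Notation lam := (aug X : {rmorphism A -> O}).
Local Notation eps := (res_eps P).

Lemma res_epsP : sform lam eps.
Proof. by move=> a x y; rewrite linearP. Qed.

Lemma res_eps_d x : eps (cc_d P 0 x) = 0.
Proof. by apply/res_exact0; exists x. Qed.

Lemma aug_alg (a : O) : lam a%:A = a.
Proof.
have -> : lam a%:A = aug X (a *: 1) by [].
by rewrite linearZ rmorph1; apply: mulr1.
Qed.

Section Comparison.
Variables (g : nat -> A) (N : nat).
Hypothesis lg : forall i, (i < N)%N -> lam (g i) = 0.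

Lemma koszul_compare : exists2 W : forall i j, koszul g N i -> P j,
  cocycle (idfun : A -> A) 0 W & forall k, eps (W 0%N 0%N k) = lam (kaug k).
Proof.
apply: (@cocycle_exists O c X P A idfun (koszul g N) (@kos_projective A N) 0
  (fun k => lam (kaug k))).
  exact: sform_kaug.
by move=> x; exact: (sform_kcon lg _ (@sform_kaug _ _ lam N)).
Qed.

Variable W : forall i j, koszul g N i -> P j.
Arguments W : clear implicits.
Hypothesis cW : cocycle (idfun : A -> A) 0 W.
Hypothesis eW : forall k, eps (W 0%N 0%N k) = lam (kaug k).

Let lW i j a x y : W i j (a *: x + y) = a *: W i j x + W i j y.
Proof. by have [[lW _] _] := cW; rewrite lW. Qed.

Let lWN i j x : W i j (- x) = - W i j x.
Proof.
have W0 : W i j 0 = 0 by have := @lW i j (- 1) 0 0; rewrite scaler0 addr0 scaleN1r addNr.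
by have := @lW i j (- 1) x 0; rewrite W0 !addr0 !scaleN1r.
Qed.

Let dW i x : cc_d P i (W i.+1 i.+1 x) = W i i (kcon g x).
Proof. by have [_ ->] := cW; rewrite expr0 scale1r. Qed.

(** Restriction of a class of Ext(O, O) to the Koszul complex.  As the Koszul
    differential vanishes after Hom(-, O), a class becomes a form on K_n rather
    than a form up to coboundaries. *)
Definition rho n (z : submod_type (cocycles P n)) (k : kos A N n) : O :=
  eps (val z n 0%N (W n n k)).

Lemma rho_form n z : sform lam (@rho n z).
Proof.
have [[lz _] _] := submod_typeP z.
by move=> a x y; rewrite /rho lW lz res_epsP.
Qed.

Lemma rhoP n a z z' k : @rho n (a *: z + z') k = a * rho z k + rho z' k.
Proof.
rewrite /rho; have -> : val (a *: z + z') n 0%N (W n n k) =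
  a%:A *: val z n 0%N (W n n k) + val z' n 0%N (W n n k) by [].
by rewrite res_epsP aug_alg.
Qed.

Lemma eps_cocycle n (z : submod_type (cocycles P n)) x :
  eps (val z n 0%N (cc_d P n x)) = 0.
Proof.
have [_ dz] := submod_typeP z.
rewrite -[LHS]mul1r -(signK O n) -mulrA -eps_sign -dz res_eps_d mulr0 //.
Qed.

Lemma eps_cocycle_form n (z : submod_type (cocycles P n)) :
  sform lam (fun x => eps (val z n 0%N x)).
Proof.
have [[lz _] _] := submod_typeP z.
by move=> a x y; rewrite lz res_epsP.
Qed.

Lemma rho_coboundary n z k : coboundaries P n z -> rho z k = 0.
Proof.
move=> Bz; have N0 := @coboundary_null O c X P A idfun P n _ Bz.
have cW' : cocycle (idfun : A -> A) 0 (W : forall i j, koszul g N i -> P j) by [].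
have := @null_comp_cocycle O A A idfun lam (koszul g N) P n 0 _ W N0 cW'.
rewrite addn0 => /(null_koszul lg); exact.
Qed.

(** The class y restricts to a cocycle K -> P of degree 1 with the same bottom
    form as the contraction by h followed by W, which is a cocycle because
    contractions anticommute.  The two are homotopic, and composing with z kills
    the difference in H(Hom(K, O)). *)
Lemma rho_mul n (z : submod_type (cocycles P n)) (y : submod_type (cocycles P 1))
    (h : nat -> A) (e : n.+1 = (n + 1)%N) :
  (forall k, rho y k = lam (kaug (kcon h k))) ->
  forall k, rho (cocycle_mul e z y) k = rho z (kcon h k).
Proof.
move=> yh k.
have [[ly zy] dy] := submod_typeP y.
have [[_ zW] dW'] := cW.
(* the contraction by h followed by W, as a family indexed by all i and j *)
pose V i j : kos A N i -> P j :=
  match i with 0 => fun=> 0 | i'.+1 => fun x => W i' j (kcon h x) end.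
pose F : forall i j, koszul g N i -> P j := fun i j x => val y i j (W i i x) - V i j x.
have lV i j a u v : V i j (a *: u + v) = a *: V i j u + V i j v.
  case: i u v => [|i] u v /=; first by rewrite scaler0 addr0.
  by rewrite kcon_linear lW.
have cF : cocycle (idfun : A -> A) 1 F.
  split; first split.
  - move=> i j a u v; rewrite /F lW ly lV /= scalerBr opprD; exact: addrACA.
  - move=> i j u ij; rewrite /F zy //.
    case: i u ij => [|i] u ij /=; first by rewrite subrr.
    have ne : (i + 0)%N <> (j + 0)%N by rewrite !addn0 => ei; apply: ij; rewrite ei addn0 addn1.
    by rewrite (zW _ _ _ ne) subr0.
  - move=> i j u; rewrite /F raddfB /= dy dW scalerBr; congr (_ - _).
    rewrite expr1 scaleN1r.
    case: i u => [|i] u /=; first by rewrite zW // raddf0 oppr0.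
    by rewrite dW' expr0 scale1r /= kcon_anti lWN.
have NF : null lam (fun x => eps (F 1%N 0%N x)).
  exists (fun=> 0); first by move=> a u v; rewrite mulr0 addr0.
  move=> u; rewrite /F raddfB /=; apply/eqP; rewrite subr_eq0; apply/eqP.
  by rewrite eW -yh.
have := @null_coboundary O c X P A idfun (koszul g N) (@kos_projective A N) 1 F cF NF.
move=> /(@cocycle_comp_coboundary O A A idfun lam (koszul g N) P n 1 _ F
  (eps_cocycle_form z) (eps_cocycle z)) /(null_koszul lg).
rewrite addn1 => /(_ k) /=; rewrite /F /rho /=.
have [[lz _] _] := submod_typeP z.
rewrite (linB _ _ (lz n 0%N)) raddfB /= => /eqP; rewrite subr_eq0 => /eqP <-.
by rewrite /endo_mul.
Qed.

End Comparison.
End KoszulRestriction.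

(** * Classes of degree one *)

Section CotangentForms.
Local Open Scope ring_scope.
Variables (O : idomainType) (c : nat) (X : augAlg O c).
Local Notation A := (aug_ring X).
Local Notation lam := (aug X : {rmorphism A -> O}).
Local Notation V := (dual (cotangent (aug X))).
Implicit Types (psi : V) (y b : A).

(** psi as a form on A, extended by zero outside the kernel of lam. *)
Definition cot_form psi y : O :=
  match pselect (ker_submod (aug X) y) with
  | left h => dual_app psi (cot_pi (to_submod h))
  | right _ => 0
  end.

Lemma cot_formE psi (p : submod_type (ker_submod (aug X))) :
  cot_form psi (val p) = dual_app psi (cot_pi p).
Proof.
rewrite /cot_form; case: pselect => [h|[]]; last exact: submod_typeP.
by congr (dual_app _ (cot_pi _)); apply: val_inj.
Qed.

Let to_ker y : lam y = 0 -> exists p : submod_type (ker_submod (aug X)), val p = y.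
Proof. by move=> ly; exists (@to_submod _ _ (ker_submod (aug X)) y ly). Qed.

Let appP psi a x x' : dual_app psi (a *: x + x') = a * dual_app psi x + dual_app psi x'.
Proof. by have := submod_typeP psi a x x'. Qed.

Lemma cot_formP psi psi' a y :
  cot_form (a *: psi + psi') y = a * cot_form psi y + cot_form psi' y.
Proof. by rewrite /cot_form; case: pselect => // _; rewrite mulr0 addr0. Qed.

Lemma cot_formD psi y y' : lam y = 0 -> lam y' = 0 ->
  cot_form psi (y + y') = cot_form psi y + cot_form psi y'.
Proof.
move=> /to_ker[p <-] /to_ker[p' <-].
have -> : val p + val p' = val (p + p') by [].
rewrite !cot_formE -[p + p'](congr1 (fun q => q + p') (scale1r p)).
by rewrite [cot_pi _](qmod_pi_linear (ker_sqr_submod (aug X)) 1 p p') appP mul1r.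
Qed.

(** b y and lam(b) y differ by (b - lam b) y, which lies in p^2. *)
Lemma cot_formM psi b y : lam y = 0 -> cot_form psi (b * y) = lam b * cot_form psi y.
Proof.
move=> ly; have [p ep] := to_ker ly; subst y.
have lby : lam (b * val p) = 0 by rewrite rmorphM ly mulr0.
have [q eq] := to_ker lby; rewrite -eq !cot_formE.
have -> : cot_pi q = lam b *: cot_pi p + cot_pi 0.
  transitivity (cot_pi (lam b *: p + 0)); last exact: qmod_pi_linear.
  rewrite addr0; apply/qmod_eqP.
  exists 1%N, (fun=> 1), (fun _ (j : 'I_2) => if j == 0 then b - (lam b)%:A else val p).
  split=> [_ j|]; last first.
    rewrite big_ord1 !big_ord_recl big_ord0 /= mulr1 mul1r mulrBl -eq.
    by rewrite -scalerAl mul1r.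
  case: ifP => _; last exact: ly.
  by rewrite /aug_ker /= rmorphB /= aug_alg subrr.
have -> : cot_pi (0 : submod_type (ker_submod (aug X))) = 0 by [].
rewrite appP; have := appP psi (-1) 0 0; rewrite scaler0 addr0 mulN1r addNr => ->.
by rewrite addr0.
Qed.

(** Two lifts of the same form P 0 -> O differ by a map to p, to which psi can be
    applied before composing with d; hence the class of psi o alpha o d does not
    depend on alpha. *)
Lemma cot_form_null (A' : comNzRingType) (phi : {rmorphism A' -> A})
    (P' : chainComplex A') psi (d1 d2 : P' 0%N -> A) :
  (forall a (x z : P' 0%N), d1 (a *: x + z) = phi a * d1 x + d1 z) ->
  (forall a (x z : P' 0%N), d2 (a *: x + z) = phi a * d2 x + d2 z) ->
  (forall x, lam (d1 x) = lam (d2 x)) -> (forall x, lam (d2 (cc_d P' 0 x)) = 0) ->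
  null (lam \o phi) (fun x : P' 1%N =>
    cot_form psi (d1 (cc_d P' 0 x)) - cot_form psi (d2 (cc_d P' 0 x))).
Proof.
move=> l1 l2 e12 e2.
have k12 x : lam (d1 x - d2 x) = 0 by rewrite rmorphB e12 subrr.
exists (fun x => cot_form psi (d1 x - d2 x)).
  move=> a x y; have -> : d1 (a *: x + y) - d2 (a *: x + y) =
    phi a * (d1 x - d2 x) + (d1 y - d2 y) by rewrite l1 l2; ring.
  rewrite (cot_formD psi _ (k12 y)); first by rewrite cot_formM.
  by rewrite rmorphM k12 mulr0.
move=> x; apply/eqP; rewrite subr_eq -(cot_formD psi (k12 _) (e2 x)) subrK //.
Qed.

End CotangentForms.

Section DegreeOne.
Local Open Scope ring_scope.
Variables (O : idomainType) (c : nat) (X : augAlg O c) (P : projRes X).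
Local Notation A := (aug_ring X).
Local Notation lam := (aug X : {rmorphism A -> O}).
Local Notation V := (dual (cotangent (aug X))).
Local Notation eps := (res_eps P).

Lemma representsE psi z : represents (P := P) psi z ->
  exists alpha : {linear P 0%N -> (aug_ring X)^o},
    (forall x, lam (alpha x) = eps x) /\
    (forall x, eps (val z 1%N 0%N x) = cot_form psi (alpha (cc_d P 0 x))).
Proof.
move=> [alpha [ea ez]]; exists alpha; split=> // x.
have k : ker_submod (aug X) (alpha (cc_d P 0 x)).
  by rewrite /= /aug_ker /= ea; apply: res_eps_d.
by rewrite (ez x (to_submod k) erefl) -cot_formE.
Qed.

Lemma represents_exists psi : exists z, represents (P := P) psi z.
Proof.
have [||al lal ea] := @projective_select A A idfun A^o (P 0%N) (fun y x => lam y = eps x)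
    (@res_projective _ _ _ P 0%N).
- move=> a y x y' x' e e'; rewrite rmorphD rmorphM /= e e'.
  by rewrite res_epsP.
- by move=> x; apply: aug_surj.
have lal' : linear (al : P 0%N -> A^o) by [].
have k x : lam (al (cc_d P 0 x)) = 0 by rewrite ea res_eps_d.
have [||F cF eF] := @cocycle_exists O c X P A idfun P (@res_projective _ _ _ P) 1
  (fun x => cot_form psi (al (cc_d P 0 x))).
- move=> a x y; rewrite linearP lal' cot_formD ?k //; last by rewrite rmorphM k mulr0.
  by rewrite cot_formM.
- move=> x; rewrite cc_dd; have := lal' (- 1) 0 0; rewrite scaler0 addr0 scaleN1r addNr => ->.
  by have := cot_formM psi 0 (rmorph0 lam); rewrite mul0r rmorph0 mul0r.
exists (@to_submod _ _ (cocycles P 1) F cF), (lin_of lal'); split=> //= x p ep.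
by rewrite eF -ep cot_formE.
Qed.

Lemma representsP a psi psi' z z' z'' : represents (P := P) psi z -> represents psi' z' ->
  represents (a *: psi + psi') z'' -> coboundaries P 1 (z'' - (a *: z + z')).
Proof.
move=> /representsE[al [ea ez]] /representsE[be [eb ez']] /representsE[ga [eg ez'']].
apply: (@null_coboundary O c X P A idfun P (@res_projective _ _ _ P) 1 _
  (submod_typeP (z'' - (a *: z + z')))).
have [||||h sh hP] := @cot_form_null O c X A idfun P psi ga al.
- by move=> b x y; rewrite linearP.
- by move=> b x y; rewrite linearP.
- by move=> x; rewrite ea eg.
- by move=> x; rewrite ea res_eps_d.
have [||||h' sh' hP'] := @cot_form_null O c X A idfun P psi' ga be.
- by move=> b x y; rewrite linearP.
- by move=> b x y; rewrite linearP.
- by move=> x; rewrite eb eg.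
- by move=> x; rewrite eb res_eps_d.
exists (fun x => a * h x + h' x) => [b x y|x].
  by rewrite sh sh' /= !mulrDr mulrCA addrACA.
have -> : val (z'' - (a *: z + z')) 1%N 0%N x =
  val z'' 1%N 0%N x - (a%:A *: val z 1%N 0%N x + val z' 1%N 0%N x) by [].
rewrite -hP -hP' raddfB /= res_epsP aug_alg ez ez' ez'' cot_formP; ring.
Qed.

(** The restriction of the class of psi is psi o alpha o W o d.  On K_0 = A the
    map alpha o W is multiplication by an element b with lam b = 1, so this is
    psi o d, and d is the contraction by g. *)
Lemma rho_represents (g : nat -> A) N (W : forall i j, koszul g N i -> P j) psi z :
  (forall i, (i < N)%N -> lam (g i) = 0) ->
  cocycle (idfun : A -> A) 0 W -> (forall k, eps (W 0%N 0%N k) = lam (kaug k)) ->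
  represents psi z ->
  forall h : nat -> A, (forall i, (i < N)%N -> lam (h i) = cot_form psi (g i)) ->
  forall k, rho W z k = lam (kaug (kcon h k)).
Proof.
move=> lg [[lW zW] dW] eW /representsE[al [ea ez]] h hP k.
rewrite -(sform_kos1 _ _ lg hP) => [||b y]; [|exact: cot_formD|exact: cot_formM].
rewrite /rho ez dW expr0 scale1r.
rewrite [cc_d (koszul g N) 0 k]kaugK.
have -> : W 0%N 0%N (kaug (cc_d (koszul g N) 0 k) *: kone A N) =
    kaug (kcon g k) *: W 0%N 0%N (kone A N).
  have W0 : W 0%N 0%N 0 = 0.
    by have := lW 0%N 0%N (- 1) 0 0; rewrite scaler0 addr0 /= scaleN1r addNr.
  by have := lW 0%N 0%N (kaug (kcon g k)) (kone A N) 0; rewrite W0 !addr0.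
rewrite linearZ /= [_ *: _]mulrC cot_formM ?ea ?eW ?kaug_one ?rmorph1 ?mul1r //.
exact: (sform_kcon lg _ (@sform_kaug _ _ lam N)).
Qed.

End DegreeOne.

(** * The kernel of restriction to a system of parameters *)

Section GenericAcyclicity.
Local Open Scope ring_scope.
Variables (O : idomainType) (c : nat) (X : augAlg O c).
Local Notation A := (aug_ring X).
Local Notation lam := (aug X : {rmorphism A -> O}).

(** Cycles of the complex augmented by lam. *)
Definition kos_cycle (g : nat -> A) N n : kos A N n -> Prop :=
  match n with
  | 0 => fun y => lam (kaug y) = 0
  | n'.+1 => fun y => kcon g y = 0
  end.

(** The augmented Koszul complex of the parameters is acyclic at p; in degree 0
    this says that they generate p at p. *)
Lemma regular_koszul : exists g : nat -> A, (forall i, (i < c)%N -> lam (g i) = 0) /\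
  forall n, exists2 t, lam t <> 0 &
    forall y : kos A c n, kos_cycle g y -> exists x, kcon g x = t *: y.
Proof.
have [g [lg [t0 lt0 t0P] reg]] := regular_parameters (@aug_noetherian _ _ X) (@aug_regular _ _ X).
exists g; split=> // -[|n]; last exact: (koszul_acyclic (aug_ker_prime (aug X)) reg).
exists t0 => // y ly; have [x ex] := ideal_upto_kcon (t0P _ ly).
by exists x; rewrite [LHS]kaugK ex [in RHS](kaugK y) scalerA.
Qed.

Variable P : projRes X.
Local Notation eps := (res_eps P).

Section Kernel.
Variables (g : nat -> A) (N : nat) (W : forall i j, koszul g N i -> P j).
Arguments W : clear implicits.
Hypothesis acyclic : forall n, exists2 t, lam t <> 0 &
    forall y : kos A N n, kos_cycle g y -> exists x, kcon g x = t *: y.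
Hypothesis cW : cocycle (idfun : A -> A) 0 W.
Hypothesis eW : forall k, eps (W 0%N 0%N k) = lam (kaug k).

Let kos_cycle_d n (v : P n -> kos A N n) : Prop := forall x, kos_cycle g (v (cc_d P n x)).

(** At p the Koszul complex is a resolution of O too, so W has an inverse v up to
    homotopy; without localizing, v exists degree by degree up to a factor s
    outside p, with h and k the two terms of the homotopy.  Passing from n to
    n + 1 multiplies s by the factor t that makes v o d a boundary. *)
Let inverse_at n : exists s : A, lam s <> 0 /\
  exists v : P n -> kos A N n, [/\ linear v, kos_cycle_d v &
  exists h : P n -> P n.+1, linear h /\
  exists k : P n -> P n,
    (forall x, W n n (v x) = s *: x + cc_d P n (h x) + k x) /\
    match n return (P n -> P n) -> Prop with
    | 0 => fun k => forall x, k x = 0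
    | n'.+1 => fun k => exists2 h' : P n' -> P n'.+1, linear h' & forall x, k x = h' (cc_d P n' x)
    end k].
Proof.
have [[lW zW] dW] := cW.
elim: n => [|n [s [ls [v [lv cv [h [lh [k [eWv ek]]]]]]]]].
  exists 1; split; first by rewrite rmorph1; apply/eqP/oner_neq0.
  have [||v lv ev] := @projective_select A A idfun (kos A N 0) (P 0%N)
    (fun y x => lam (kaug y) = eps x) (@res_projective _ _ _ P 0%N).
  - by move=> a y x y' x' e e'; rewrite sform_kaug e e' res_epsP.
  - move=> x; have [a ea] := aug_surj X (eps x); exists (a *: kone A N).
    by rewrite kaugZ kaug_one mulr1.
  exists v; split=> //; first by move=> x; rewrite /= ev res_eps_d.
  have [||h lh eh] := @projective_select A A idfun (P 1%N) (P 0%N)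
    (fun y x => cc_d P 0 y = W 0%N 0%N (v x) - x) (@res_projective _ _ _ P 0%N).
  - move=> a y x y' x' e e'; rewrite linearP e e' lv lW /= scalerBr opprD; exact: addrACA.
  - by move=> x; apply/res_exact0; rewrite raddfB /= eW ev subrr.
  exists h; split=> //; exists (fun=> 0); split=> // x.
  by rewrite eh scale1r addr0 addrC subrK.
have [t lt tP] := acyclic n.
have kd x : k (cc_d P n x) = 0.
  case: n v lv cv h lh k eWv ek t lt tP x => [|n] v lv cv h lh k eWv ek t lt tP x; first exact: ek.
  by case: ek => h' lh' ->; rewrite cc_dd; exact: (raddf0 (lin_of lh')).
have [||v' lv' ev'] := @projective_select A A idfun (kos A N n.+1) (P n.+1)
    (fun y x => kcon g y = t *: v (cc_d P n x)) (@res_projective _ _ _ P n.+1).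
- move=> a y x y' x' e e'; rewrite kcon_linear e e' linearP lv scalerDr !scalerA.
  by rewrite [t * a]mulrC.
- by move=> x; apply/tP/cv.
have lth : linear (fun x => t *: h x : P n.+1).
  by move=> a x y; rewrite lh scalerDr !scalerA mulrC.
exists (t * s); split.
  by rewrite rmorphM => /eqP; rewrite mulf_eq0 => /orP[]/eqP.
exists v'; split=> //.
  move=> x /=; rewrite ev' cc_dd; have := lv (- 1) 0 0.
  by rewrite scaler0 addr0 scaleN1r addNr => ->; rewrite scaler0.
have [||h' lh' eh'] := @projective_select A A idfun (P n.+2) (P n.+1)
    (fun y x => cc_d P n.+1 y = W n.+1 n.+1 (v' x) - ((t * s) *: x + t *: h (cc_d P n x)))
    (@res_projective _ _ _ P n.+1).
- move=> a y x y' x' e e'; rewrite linearP e e' lv' lW /= linearP lth scalerBr.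
  have ls' : (t * s) *: (a *: x + x') = a *: ((t * s) *: x) + (t * s) *: x'.
    by rewrite scalerDr !scalerA [t * s * a]mulrC.
  rewrite ls' [in RHS](addrACA (a *: _)) -scalerDr [in RHS]opprD; exact: addrACA.
- move=> x; apply/res_exact; rewrite raddfB /= dW expr0 scale1r /= ev'.
  have W0 : W n n 0 = 0.
    by have := lW n n (- 1) 0 0; rewrite scaler0 addr0 /= scaleN1r addNr.
  have lWZ : W n n (t *: v (cc_d P n x)) = t *: W n n (v (cc_d P n x)).
    by have := lW n n t (v (cc_d P n x)) 0; rewrite W0 !addr0.
  rewrite lWZ eWv kd addr0 [cc_d P n (_ + _)]raddfD /= !linearZ /= scalerDr scalerA subrr //.
exists h'; split=> //; exists (fun x => t *: h (cc_d P n x)); split.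
  by move=> x; rewrite eh' addrAC addrC subrK //.
by exists (fun x => t *: h x).
Qed.

(** Write f for the bottom form of z.  From W v = s + d h + k and f W = 0 the form
    s f is - f k, since f d = 0; and k factors through d. *)
Lemma rho_kernel n z : (forall k, @rho O c X P g N W n z k = 0) ->
  exists2 a : O, a != 0 & coboundaries P n (a *: z).
Proof.
move=> rz; have [s [ls [v [lv cv [h [lh [k [eWv ek]]]]]]]] := inverse_at n.
exists (lam s); first exact/eqP.
apply: (@null_coboundary O c X P A idfun P (@res_projective _ _ _ P) n _
  (submod_typeP (lam s *: z))).
pose f x := eps (val z n 0%N x).
have sz : sform lam f := eps_cocycle_form z.
have dz x : f (cc_d P n x) = 0 := eps_cocycle z x.
have E x : eps (val (lam s *: z) n 0%N x) = - f (k x).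
  have -> : val (lam s *: z) n 0%N x = (lam s)%:A *: val z n 0%N x by [].
  rewrite (sformZ (res_epsP (P := P))) aug_alg.
  have := rz (v x); rewrite /rho eWv -/(f _) (sformD sz) (sformD sz) (sformZ sz) dz addr0.
  by move/eqP; rewrite addr_eq0 => /eqP.
move: f sz dz E; case: n z rz v lv cv h lh k eWv ek => [|n] z rz v lv cv h lh k eWv ek f sz dz E.
  by move=> x; rewrite E ek (sform0 sz) oppr0.
case: ek => h' lh' ek; exists (fun x => - f (h' x)); last by move=> x; rewrite E ek.
by move=> a x y; rewrite lh' sz opprD mulrN.
Qed.

End Kernel.
End GenericAcyclicity.

(** * The dual of the cotangent module *)

Section DualParameters.
Local Open Scope ring_scope.
Variables (O : idomainType) (c : nat) (X : augAlg O c).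
Local Notation A := (aug_ring X).
Local Notation lam := (aug X : {rmorphism A -> O}).
Local Notation V := (dual (cotangent (aug X))).
Variables (g : nat -> A) (N : nat).
Hypothesis lg : forall i, (i < N)%N -> lam (g i) = 0.
Hypothesis acyclic : forall n, exists2 t, lam t <> 0 &
    forall y : kos A N n, kos_cycle g y -> exists x, kcon g x = t *: y.

(** A nonzero multiple of each coordinate form on the parameters extends to
    p / p^2.  An element y of p has a multiple t y that is a combination of the
    parameters, and the images in O of its coefficients are well defined:
    by acyclicity in degree one, relations among the parameters have
    coefficients in p up to a factor outside p. *)
Lemma dual_parameters j : exists psi : V, exists2 b : O, b != 0 &
  forall i, (i < N)%N -> cot_form psi (g i) = if i == j then b else 0.
Proof.
pose d i : A := (i == j)%:R.
have [t lt tP] := acyclic 0; have [u lu uP] := acyclic 1.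
(* r is the image in O of a j-th coefficient of t y *)
pose R y r := exists2 k : kos A N 1, kaug (kcon g k) = t * y & lam (kaug (kcon d k)) = r.
have Rex y : lam y = 0 -> {r | R y r}.
  move=> ly; apply: cid.
  have [|k ek] := tP (y *: kone A N); first by rewrite /= kaugZ kaug_one mulr1.
  by exists (lam (kaug (kcon d k))), k => //; rewrite ek !kaugZ kaug_one mulr1.
have RP a y y' r r' : R y r -> R y' r' -> R (a * y + y') (lam a * r + r').
  move=> [k ek <-] [k' ek' <-]; exists (a *: k + k').
    by rewrite kconD kconZ kaugD kaugZ ek ek'; ring.
  by rewrite kconD kconZ kaugD kaugZ rmorphD rmorphM.
have Ru y r r' : R y r -> R y r' -> r = r'.
  move=> [k ek <-] [k' ek' <-].
  have [|x ex] := uP (k - k').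
    by rewrite /= kconD kconN [LHS]kaugK kaugD -scaleN1r kaugZ ek ek' mulN1r subrr scale0r.
  have : lam (kaug (kcon d (kcon g x))) = 0.
    rewrite kcon_anti -scaleN1r kaugZ rmorphM.
    by rewrite (sform_kcon lg _ (@sform_kaug _ _ lam N)) mulr0.
  rewrite ex kconZ kaugZ rmorphM => /eqP; rewrite mulf_eq0 => /orP[/eqP//|].
  by rewrite kconD kconN kaugD -scaleN1r kaugZ mulN1r rmorphB subr_eq0 => /eqP.
have R0 : R 0 0 by exists 0; rewrite kcon0 kaug0 ?mulr0 ?rmorph0.
pose L (p : submod_type (ker_submod (aug X))) : O := sval (Rex (val p) (submod_typeP p)).
have LR p : R (val p) (L p) := svalP (Rex _ _).
have LP a p p' : L (a *: p + p') = a * L p + L p'.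
  apply: (Ru _ _ _ (LR _)).
  have := RP a%:A _ _ _ _ (LR p) (LR p'); rewrite aug_alg.
  by rewrite -scalerAl mul1r.
have Lsqr p : ker_sqr p -> L p = 0.
  move=> [m [a [s [sk ep]]]]; apply: (Ru _ _ _ (LR _)); rewrite ep.
  elim/big_ind: _ => //.
    move=> x y Rx Ry; have := RP 1 _ _ _ _ Rx Ry.
    by rewrite mul1r rmorph1 mulr0 addr0.
  move=> i _; rewrite !big_ord_recl big_ord0 mulr1.
  set x := s i _; set y := s i _.
  have lx : lam x = 0 := sk i _.
  have ly : lam y = 0 := sk i _.
  have [r Rr] := Rex y ly; have := RP (a i * x) _ _ _ _ Rr R0.
  by rewrite !addr0 rmorphM lx mulr0 mul0r mulrA.
have Leq p p' : ker_sqr (p - p') -> L p = L p'.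
  move=> /Lsqr e; have := LP (- 1) p' p.
  by rewrite scaleN1r addrC e mulN1r addrC => /esym/eqP; rewrite subr_eq0 => /eqP.
pose f (x : cotangent (aug X)) : O^o := L (repr x).
have fpi p : f (cot_pi p) = L p by apply/Leq/(qmod_repr (ker_sqr_submod (aug X))).
have lf : dual_submod (cotangent (aug X)) f.
  move=> a; elim/qmodP=> x; elim/qmodP=> y.
  by rewrite -(qmod_pi_linear (ker_sqr_submod (aug X)) a x y) [LHS]fpi LP !fpi.
exists (to_submod lf : V), (lam t); first exact/eqP.
move=> i iN; have k := lg iN.
have -> : g i = val (@to_submod _ _ (ker_submod (aug X)) (g i) k) by [].
rewrite cot_formE [LHS]fpi; apply: (Ru _ _ _ (LR _)) => /=.
have [e eP] := @kos_basis1 A N i iN.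
exists (t *: e); first by rewrite kconZ kaugZ eP.
by rewrite kconZ kaugZ eP /d rmorphM; case: eqP; rewrite ?rmorph1 ?rmorph0 ?mulr1 ?mulr0.
Qed.

End DualParameters.

Section SaturatedDual.
Local Open Scope ring_scope.
Variable O : idomainType.
Hypothesis O_dvr : is_dvr O.

(** A generator of the ideal (a, b) divides both, with quotients a' and b' that
    generate the unit ideal; one of these is a unit since O is local. *)
Lemma dvr_total (a b : O) : (exists x, b = x * a) \/ (exists x, a = x * b).
Proof.
have [[m [mm mu]] pid _] := O_dvr.
pose I : set O := [set x | exists u v, x = u * a + v * b]%classic.
have iI : ideal I.
  split=> [|_ _ [u [v ->]] [u' [v' ->]]|x _ [u [v ->]]].
  - by exists 0, 0; rewrite !mul0r addr0.
  - by exists (u + u'), (v + v'); ring.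
  - by exists (x * u), (x * v); ring.
have [d Id] := pid I iI.
have dI x : I x <-> exists y, x = y * d.
  rewrite Id; split=> [[y ->]|[y ->]]; first by exists (y ord0); rewrite big_ord1.
  by exists (fun=> y); rewrite big_ord1.
have [a' ea] : exists y, a = y * d by apply/dI; exists 1, 0; rewrite mul1r mul0r addr0.
have [b' eb] : exists y, b = y * d by apply/dI; exists 0, 1; rewrite mul1r mul0r add0r.
have [d0|d0] := eqVneq d 0.
  by left; exists 0; rewrite eb d0 mulr0 mul0r.
have [u [v ed]] : I d by apply/dI; exists 1; rewrite mul1r.
have e1 : u * a' + v * b' = 1.
  apply: (mulIf d0); rewrite mul1r [RHS]ed ea eb; ring.
have nO : noetherian O by move=> J /pid[x ->]; exists [:: x].
have unitP x : (exists y, y * x = 1) \/ m x.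
  have [|nx] := pselect (exists y, y * x = 1); [by left|right].
  pose F (J : set O) := [/\ ideal J, ~ J 1 & J x].
  have [||M [iM M1 Mx] Mmax] := @noetherian_max O F nO; first by move=> J [].
    exists [set z | exists y, z = y * x]%classic; split=> //.
    - split=> [|_ _ [y ->] [y' ->]|y _ [y' ->]].
      + by exists 0; rewrite mul0r.
      + by exists (y + y'); rewrite mulrDl.
      + by exists (y * y'); rewrite mulrA.
    - by move=> [y /esym e]; apply: nx; exists y.
    - by exists 1; rewrite mul1r.
  have -> // : m = M.
  apply: mu; split=> // J iJ MJ J1; apply: Mmax => //; split=> //; exact: MJ.
have [im m1 _] := mm; have [_ mD mM] := im.
have [[y ey]|ma] := unitP a'; first by left; exists (b' * y);
  rewrite eb ea -!mulrA (mulrA y) ey mul1r.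
have [[y ey]|mb] := unitP b'; first by right; exists (a' * y);
  rewrite eb ea -!mulrA (mulrA y) ey mul1r.
by case: m1; rewrite -e1; apply: mD; apply: mM.
Qed.

Lemma dvr_pivot N (w : 'I_N -> O) :
  (forall i, w i = 0) \/ exists i, w i != 0 /\ forall j, exists x, w j = x * w i.
Proof.
elim: N w => [|N IH] w; first by left; case.
have [w0|[i [wi wP]]] := IH (fun i => w (lift ord0 i)).
  have [w00|w00] := eqVneq (w ord0) 0.
    by left=> i; case: (unliftP ord0 i) => [j ->|->].
  right; exists ord0; split=> // j; case: (unliftP ord0 j) => [k ->|->].
    by exists 0; rewrite w0 mul0r.
  by exists 1; rewrite mul1r.
have [[x ex]|[x ex]] := dvr_total (w (lift ord0 i)) (w ord0).
  right; exists (lift ord0 i); split=> // j; case: (unliftP ord0 j) => [k ->|->] //.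
  by exists x.
right; exists ord0; split=> [|j].
  by apply: contra_neq wi => w0; rewrite ex w0 mulr0.
case: (unliftP ord0 j) => [k ->|->]; last by exists 1; rewrite mul1r.
by have [y ->] := wP k; exists (y * x); rewrite ex mulrA.
Qed.

(** The l i embed V in O^N with torsion-free cokernel, and such a submodule is a
    direct summand: among the coordinates of a nonzero vector one divides the
    others, so that after division it is equal to 1 and splits off a copy of O.
    The induction is on the set D of coordinates that may be nonzero. *)
Lemma saturated_retraction (V : lmodType O) N (l : 'I_N -> V -> O) :
  (forall i a v w, l i (a *: v + w) = a * l i v + l i w) ->
  (forall v, (forall i, l i v = 0) -> v = 0) ->
  (forall b v, b != 0 -> (forall i, exists x, l i v = x * b) -> exists v', v = b *: v') ->
  exists u : 'I_N -> V, forall v, v = \sum_i l i v *: u i.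
Proof.
move=> lP linj lsat.
have l0 i : l i 0 = 0 by have := lP i (- 1) 0 0; rewrite scaler0 addr0 mulN1r addNr.
have lZ i a v : l i (a *: v) = a * l i v by rewrite -[a *: v]addr0 lP l0 addr0.
suff H (D : {set 'I_N}) : exists u : 'I_N -> V, forall v,
    (forall i, i \notin D -> l i v = 0) -> v = \sum_i l i v *: u i.
  by have [u uP] := H [set: 'I_N]%SET; exists u => v; apply: uP => i; rewrite inE.
have [n nD] := ubnP #|D|; elim: n D nD => // n IH D nD.
have [[v [vD v0]]|no] := pselect (exists v, (forall i, i \notin D -> l i v = 0) /\ v <> 0);
    last first.
  exists (fun=> 0) => v vD; rewrite big1 => [|i _]; last exact: scaler0.
  by apply: contrapT => v0; apply: no; exists v.
have [/linj//|[i [li ld]]] := dvr_pivot (fun i => l i v).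
have [v' ev] := lsat _ v li ld.
have liv' : l i v' = 1.
  by apply: (mulfI li); rewrite mulr1 -lZ -ev.
have v'D j : j \notin D -> l j v' = 0.
  by move/vD/eqP; rewrite ev lZ mulf_eq0 (negPf li) => /eqP.
have iD : i \in D by apply: contraNT li => /vD ->.
have [|u uP] := IH (D :\ i).
  by move: nD; rewrite (cardsD1 i) iD add1n ltnS.
exists (fun j => u j + (if j == i then v' - \sum_k l k v' *: u k else 0)) => x xD.
have : x - l i x *: v' = \sum_j l j (x - l i x *: v') *: u j.
  apply: uP => j; rewrite !inE negb_and negbK -scaleNr addrC lP => /predU1P[->|jD].
    by rewrite liv' mulr1 addNr.
  by rewrite (v'D _ jD) (xD _ jD) mulr0 addr0.
have -> : \sum_j l j (x - l i x *: v') *: u j =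
    \sum_j l j x *: u j - l i x *: \sum_k l k v' *: u k.
  rewrite scaler_sumr -sumrB; apply: eq_bigr => j _.
  by rewrite -scaleNr addrC lP scalerDl mulNr scaleNr scalerA addrC.
move=> e; rewrite -[LHS](subrK (l i x *: v')) e.
under [RHS]eq_bigr do rewrite scalerDr; rewrite big_split /=.
rewrite -addrA; congr (_ + _).
rewrite [RHS](bigD1 i) //= eqxx [X in _ = _ + X]big1 ?addr0 => [|j /negPf ->]; last exact: scaler0.
by rewrite scalerBr addrC.
Qed.

End SaturatedDual.

Section DualRetraction.
Local Open Scope ring_scope.
Variables (O : idomainType) (c : nat) (X : augAlg O c).
Hypothesis O_dvr : is_dvr O.
Local Notation A := (aug_ring X).
Local Notation lam := (aug X : {rmorphism A -> O}).
Local Notation V := (dual (cotangent (aug X))).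

(** Evaluation at generators of p embeds V in O^N, and a form divisible by b at
    the generators is divisible by b. *)
Lemma dual_retraction : exists (N : nat) (y : nat -> A) (u : nat -> V),
  (forall i, (i < N)%N -> lam (y i) = 0) /\
  forall psi, psi = \sum_(i < N) cot_form psi (y i) *: u i.
Proof.
have [ip _ _] := aug_ker_prime (aug X).
have [s es] := @aug_noetherian _ _ X _ ip.
have ls (i : 'I_(size s)) : lam s`_i = 0.
  suff : aug_ker (aug X) s`_i by [].
  rewrite es; exists (fun j => (j == i)%:R); rewrite (bigD1 i) //= eqxx mul1r.
  by rewrite big1 ?addr0 // => j /negPf ->; rewrite mul0r.
have cf_sum (psi : V) (a : 'I_(size s) -> A) :
    cot_form psi (\sum_i a i * s`_i) = \sum_i lam (a i) * cot_form psi s`_i.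
  suff : lam (\sum_i a i * s`_i) = 0 /\
    cot_form psi (\sum_i a i * s`_i) = \sum_i lam (a i) * cot_form psi s`_i by case.
  elim/big_rec2: _ => [|i r y _ [ly ey]].
    split; first exact: rmorph0.
    by have := cot_formM psi 0 (rmorph0 lam); rewrite mul0r rmorph0 mul0r.
  have lay : lam (a i * s`_i) = 0 by rewrite rmorphM ls mulr0.
  by rewrite rmorphD lay ly addr0 cot_formD // cot_formM // ey.
have cf_pi (psi : V) (p : submod_type (ker_submod (aug X))) :
    exists a : 'I_(size s) -> A, dual_app psi (cot_pi p) = \sum_i lam (a i) * cot_form psi s`_i.
  have : aug_ker (aug X) (val p) by exact: (submod_typeP p).
  by rewrite es => -[a ea]; exists a; rewrite -cot_formE ea cf_sum.
have [||b psi b0 bd|u uP] := @saturated_retraction O O_dvr V (size s)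
    (fun i psi => cot_form psi s`_i).
- by move=> i a v w; apply: cot_formP.
- move=> psi psi0; apply: val_inj; apply/funext; elim/qmodP=> p.
  have [a ea] := cf_pi psi p; rewrite -[LHS]/(dual_app psi (cot_pi p)) ea.
  by rewrite big1 // => i _; rewrite psi0 mulr0.
- have D x : {r | dual_app psi x = r * b}.
    apply: cid; elim/qmodP: x => p; have [a ->] := cf_pi psi p.
    elim/big_ind: _ => [|x y [r ->] [r' ->]|i _].
    + by exists 0; rewrite mul0r.
    + by exists (r + r'); rewrite mulrDl.
    + by have [x ->] := bd i; exists (lam (a i) * x); rewrite mulrA.
  pose f (x : cotangent (aug X)) : O^o := sval (D x).
  have fP x : dual_app psi x = f x * b := svalP (D x).
  clearbody f.
  have lf : dual_submod (cotangent (aug X)) f.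
    move=> a x y; apply: (mulIf b0); rewrite -fP.
    have -> : dual_app psi (a *: x + y) = a * dual_app psi x + dual_app psi y.
      exact: (submod_typeP psi a x y).
    by rewrite !fP mulrA -mulrDl.
  exists (to_submod lf : V); apply: val_inj; apply/funext => x.
  by rewrite -[LHS]/(dual_app psi x) fP mulrC.
exists (size s), (fun i => s`_i), (fun i => if insub i is Some j then u j else 0).
split=> [i iN|psi]; first exact: (ls (Ordinal iN)).
rewrite [LHS]uP; apply: eq_bigr => i _; by rewrite valK.
Qed.

End DualRetraction.

(** * Exterior algebras and torsion-free Ext *)

Section WedgeInduction.
Local Open Scope ring_scope.
Variables (R : comNzRingType) (V : lmodType R).
Local Notation Lam := (wedge_alg V).

(** The exterior algebra is spanned by products of generators, taken from the
    left.  For a term that is itself a product, the statement has to be proved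
    for its products with an arbitrary left factor. *)
Lemma wedge_ind (C : forall n, Lam n -> Prop) :
  C 0%N (gone Lam) ->
  (forall n a (x y : Lam n), C n x -> C n y -> C n (a *: x + y)) ->
  (forall n, C n 0) ->
  (forall n (x : Lam n) v, C n x -> C n.+1 (mul1 x (wedge_gen v : Lam 1%N))) ->
  forall n w, C n w.
Proof.
move=> C1 CP C0 CM.
suff H n (t : wedge_term V n) : forall m k (e : k = (m + n)%N) (x : Lam m), C m x ->
    C k (gmul e x (wedge_pi t : Lam n)).
  move=> n; elim/wedgeP=> t; have := H n t 0%N n erefl _ C1.
  by rewrite gmul1l.
elim: t => {n} [v|| n|n s IHs t IHt|n a t IHt|n p q f s IHs t IHt] m k e x Cx.
- have e' := etrans e (addn1 m); move: e; rewrite e' => e.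
  by have := CM _ _ v Cx; rewrite /mul1 (eq_irrelevance (esym (addn1 m)) e).
- have e' := etrans e (addn0 m); move: e; rewrite e' => e.
  by rewrite -[wedge_pi _]/(gone Lam) gmul1r.
- by rewrite gmul0r.
- rewrite wedge_piD -[wedge_pi s]scale1r gmulPr; apply: CP; [exact: IHs|exact: IHt].
- rewrite wedge_piZ -[_ *: _]addr0 gmulPr gmul0r; apply: CP; [exact: IHt|exact: C0].
- have -> : wedge_pi (WMul f s t) = gmul f (wedge_pi s : Lam n) (wedge_pi t : Lam p).
    by rewrite -[RHS]/(wedge_mul f (wedge_pi s) (wedge_pi t)) wedge_mulE.
  have e2 : k = (m + n + p)%N by rewrite e f addnA.
  by rewrite -(gmulA (erefl (m + n)%N) e2); apply/IHt/IHs.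
Qed.

Lemma wedge_gen_anti (e : 2%N = (1 + 1)%N) (v w : V) :
  gmul e (wedge_gen v : Lam 1%N) (wedge_gen w : Lam 1%N) =
  - gmul e (wedge_gen w : Lam 1%N) (wedge_gen v : Lam 1%N).
Proof.
have sq u : gmul e (wedge_gen u : Lam 1%N) (wedge_gen u : Lam 1%N) = 0.
  exact: wedge_gen_sqr.
have := sq (v + w); rewrite raddfD gmulDl !gmulDr !sq add0r addr0.
by move/eqP; rewrite addr_eq0 => /eqP.
Qed.

End WedgeInduction.

Section ExtClasses.
Local Open Scope ring_scope.
Variables (O : idomainType) (c : nat) (X : augAlg O c) (P : projRes X).

Lemma Ext_tf_classP n a (z z' : submod_type (cocycles P n)) :
  Ext_tf_class (a *: z + z') = a *: Ext_tf_class z + Ext_tf_class z'.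
Proof. by rewrite /Ext_tf_class linearP [LHS]linearP. Qed.

Lemma Ext_tf_class0 n : Ext_tf_class (0 : submod_type (cocycles P n)) = 0.
Proof. by rewrite /Ext_tf_class !raddf0. Qed.

Lemma Ext_tf_class_eq0 n (z : submod_type (cocycles P n)) :
  Ext_tf_class z = 0 <-> exists2 a : O, a != 0 & coboundaries P n (a *: z).
Proof.
have E (a : O) : coboundaries P n (a *: z) <-> a *: Ext_pi z = 0.
  rewrite -linearZ /=; split=> [h|].
    by rewrite -[RHS](raddf0 (@Ext_pi O X P n)); apply/qmod_eqP; rewrite subr0.
  by rewrite -[X in _ = X](raddf0 (@Ext_pi O X P n)) => /qmod_eqP; rewrite subr0.
have T : torsion (Ext_alg P n) (Ext_pi z - Ext_pi 0) <-> torsion (Ext_alg P n) (Ext_pi z).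
  by rewrite (raddf0 (@Ext_pi O X P n)) subr0.
rewrite -(Ext_tf_class0 n); split.
  by move=> /qmod_eqP/T[a a0 az]; exists a => //; exact/E.
by move=> [a a0 /E az]; apply/qmod_eqP/T; exists a.
Qed.

Lemma Ext_tf_class_surj n (x : Ext_tf P n) :
  exists z : submod_type (cocycles P n), x = Ext_tf_class z.
Proof. by elim/tfP: x; elim/ExtP=> z; exists z. Qed.

Lemma Ext_tf_torsion_free n a (x : Ext_tf P n) : a != 0 -> a *: x = 0 -> x = 0.
Proof.
have [z ->] := Ext_tf_class_surj x => a0.
have -> : a *: Ext_tf_class z = Ext_tf_class (a *: z).
  by rewrite -[a *: z]addr0 Ext_tf_classP Ext_tf_class0 addr0.
move=> /Ext_tf_class_eq0[b b0]; rewrite scalerA => Bz.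
by apply/Ext_tf_class_eq0; exists (b * a) => //; rewrite mulf_neq0.
Qed.

Lemma Ext_tf_classM m n k (e : k = (m + n)%N) (z : submod_type (cocycles P m))
    (z' : submod_type (cocycles P n)) :
  gmul e (Ext_tf_class z) (Ext_tf_class z') = Ext_tf_class (cocycle_mul e z z').
Proof.
rewrite /Ext_tf_class -[LHS]/(tf_mul e (tf_pi _) (tf_pi _)) tf_mulE.
by congr tf_pi; apply: Ext_mulE.
Qed.

End ExtClasses.

(** * The isomorphism *)

Lemma kcon_scale (A : comNzRingType) (a : A) g N n (x : kos A N n.+1) :
  kcon (fun j => (a * g j)%R) x = (a *: kcon g x)%R.
Proof.
elim: N n x => [|N IH] [|n] x /=; rewrite ?scaler0 //.
  by rewrite IH scalerDr scalerA.
by congr (_, _); rewrite /= IH ?scalerN // scalerDr scalerA.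
Qed.

Section RhoClass.
Local Open Scope ring_scope.
Variables (O : idomainType) (c : nat) (X : augAlg O c) (P : projRes X).
Local Notation A := (aug_ring X).
Local Notation lam := (aug X : {rmorphism A -> O}).
Local Notation V := (dual (cotangent (aug X))).
Local Notation eps := (res_eps P).

(** A chosen cocycle; linearity holds only for its class, see
    [ext_gen_linear]. *)
Definition deg1 (psi : V) : submod_type (cocycles P 1) := sval (cid (represents_exists P psi)).

Lemma deg1P psi : represents psi (deg1 psi).
Proof. exact: (svalP (cid (represents_exists P psi))). Qed.

Definition ext_gen (psi : V) : Ext_tf P 1 := Ext_tf_class (deg1 psi).

Lemma ext_gen_linear : linear ext_gen.
Proof.
move=> a psi psi'; rewrite -Ext_tf_classP; apply/eqP; rewrite -subr_eq0.
rewrite -scaleN1r addrC -Ext_tf_classP scaleN1r addrC; apply/eqP/Ext_tf_class_eq0.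
exists 1; first exact: oner_neq0.
rewrite scale1r; apply: representsP; exact: deg1P.
Qed.

Definition ext_gen_lin : {linear V -> Ext_tf P 1} := lin_of ext_gen_linear.

Definition ext_repr n (x : Ext_tf P n) : submod_type (cocycles P n) :=
  sval (cid (Ext_tf_class_surj x)).

Lemma ext_reprK n (x : Ext_tf P n) : Ext_tf_class (ext_repr x) = x.
Proof. exact/esym/(svalP (cid (Ext_tf_class_surj x))). Qed.

Section Restriction.
Variables (g : nat -> A) (N : nat) (W : forall i j, koszul g N i -> P j).
Arguments W : clear implicits.
Hypothesis lg : forall i, (i < N)%N -> lam (g i) = 0.
Hypothesis cW : cocycle (idfun : A -> A) 0 W.
Hypothesis eW : forall k, eps (W 0%N 0%N k) = lam (kaug k).

Definition rho_tf n (x : Ext_tf P n) : kos A N n -> O := rho W (ext_repr x).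

Lemma rho_tf_form n (x : Ext_tf P n) : sform lam (rho_tf x).
Proof. exact: rho_form. Qed.

Let rho0 n k : rho W (0 : submod_type (cocycles P n)) k = 0.
Proof.
have := rhoP W (- 1) (0 : submod_type (cocycles P n)) 0 k.
by rewrite scaler0 addr0 mulN1r addNr.
Qed.

Lemma rho_tfE n (z : submod_type (cocycles P n)) k : rho_tf (Ext_tf_class z) k = rho W z k.
Proof.
have : Ext_tf_class ((- 1) *: z + ext_repr (Ext_tf_class z)) = 0.
  by rewrite Ext_tf_classP ext_reprK scaleN1r addNr.
move/Ext_tf_class_eq0 => [a a0 Bz].
have := rho_coboundary lg cW k Bz.
rewrite -[a *: _]addr0 !rhoP rho0 addr0 mulN1r => /eqP.
rewrite mulf_eq0 (negPf a0) addrC subr_eq0 => /eqP; exact.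
Qed.

Lemma rho_tfP n a (x y : Ext_tf P n) k :
  rho_tf (a *: x + y) k = a * rho_tf x k + rho_tf y k.
Proof. by rewrite -[x in LHS]ext_reprK -[y in LHS]ext_reprK -Ext_tf_classP rho_tfE rhoP. Qed.

Lemma rho_tf0 n k : rho_tf (0 : Ext_tf P n) k = 0.
Proof.
have := rho_tfP (- 1) (0 : Ext_tf P n) 0 k.
by rewrite scaler0 addr0 mulN1r addNr.
Qed.

Lemma rho_tf_one k : rho_tf (gone (Ext_tf P)) k = lam (kaug k).
Proof.
rewrite -[gone _]/(Ext_tf_class (to_submod (endo_one_cocycle P))) rho_tfE.
by rewrite /rho /= endo_oneE eW.
Qed.

Lemma rho_tf_mul n (x : Ext_tf P n) psi (h : nat -> A) k :
  (forall i, (i < N)%N -> lam (h i) = cot_form psi (g i)) ->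
  rho_tf (mul1 x (ext_gen psi)) k = rho_tf x (kcon h k).
Proof.
move=> hP; rewrite -[x in LHS]ext_reprK /mul1 Ext_tf_classM rho_tfE.
apply: (rho_mul lg cW eW) => k'; exact: (rho_represents lg cW eW (deg1P psi)).
Qed.

(** Restriction to a sequence whose Koszul complex is a resolution at p kills
    only torsion. *)
Lemma rho_tf_inj n (x : Ext_tf P n) :
  (forall m, exists2 t, lam t <> 0 &
     forall y : kos A N m, kos_cycle g y -> exists z, kcon g z = t *: y) ->
  (forall k, rho_tf x k = 0) -> x = 0.
Proof.
move=> acyclic x0; rewrite -[x]ext_reprK; apply/Ext_tf_class_eq0.
exact: (rho_kernel acyclic cW eW).
Qed.

End Restriction.

(** The square restricts to the Koszul complex of a system of parameters as a
    contraction applied twice. *)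
Lemma ext_gen_sqr (e : 2%N = (1 + 1)%N) psi : gmul e (ext_gen psi) (ext_gen psi) = 0.
Proof.
have [x_ [lx acyclic]] := regular_koszul X.
have [W cW eW] := koszul_compare P lx.
apply: (rho_tf_inj cW eW acyclic) => k.
have [h hP] : {h : nat -> A & forall i, lam (h i) = cot_form psi (x_ i)} :=
      choice (fun i => aug_surj X (cot_form psi (x_ i))).
have -> : gmul e (ext_gen psi) (ext_gen psi) = mul1 (ext_gen psi) (ext_gen psi).
  by rewrite /mul1 (eq_irrelevance e (esym (addn1 1))).
rewrite (rho_tf_mul lx cW eW _ _ (fun i _ => hP i)) rho_tfE //.
rewrite (rho_represents lx cW eW (deg1P psi) (fun i _ => hP i)) kcon_sqr.
by rewrite kaug0 rmorph0.
Qed.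

Definition ext_map n : {linear wedge_alg V n -> Ext_tf P n} :=
  lin_of (@wedge_lift_linear O V (Ext_tf P) ext_gen_lin ext_gen_sqr n).

Lemma ext_map_one : ext_map 0 (gone (wedge_alg V)) = gone (Ext_tf P).
Proof. exact: (@wedge_lift_one O V (Ext_tf P) ext_gen_lin ext_gen_sqr). Qed.

Lemma ext_mapM m n k (e : k = (m + n)%N) (x : wedge_alg V m) (y : wedge_alg V n) :
  ext_map k (gmul e x y) = gmul e (ext_map m x) (ext_map n y).
Proof. exact: (@wedge_liftM O V (Ext_tf P) ext_gen_lin ext_gen_sqr). Qed.

Lemma ext_map_gen psi : ext_map 1 (wedge_gen psi) = ext_gen psi.
Proof. exact: (@wedge_lift_gen O V (Ext_tf P) ext_gen_lin ext_gen_sqr). Qed.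

Lemma ext_map_mul1 n (w : wedge_alg V n) psi :
  ext_map n.+1 (mul1 w (wedge_gen psi : wedge_alg V 1)) = mul1 (ext_map n w) (ext_gen psi).
Proof. by rewrite /mul1 ext_mapM ext_map_gen. Qed.

(** The forms on the Koszul complex of a system of parameters which have a
    nonzero multiple coming from the exterior algebra are stable under the
    operations of [kos_forms_ind], and restriction is injective. *)
Lemma ext_map_generic n (x : Ext_tf P n) : exists2 b : O, b != 0 &
  exists w, ext_map n w = b *: x.
Proof.
have [x_ [lx acyclic]] := regular_koszul X.
have [W cW eW] := koszul_compare P lx.
pose C n (f : kos A c n -> O) := exists2 b : O, b != 0 &
  exists w, forall k, rho_tf W (ext_map n w) k = b * f k.
suff [b b0 [w wP]] : C n (rho_tf W x).
  exists b => //; exists w; apply/eqP; rewrite -subr_eq0; apply/eqP.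
  apply: (rho_tf_inj cW eW acyclic) => k; rewrite -scaleN1r addrC rho_tfP //.
  by rewrite -[b *: x]addr0 rho_tfP // wP rho_tf0 // addr0 mulN1r addNr.
apply: (@kos_forms_ind A O lam c C); last exact: rho_tf_form.
- move=> m; exists 1; first exact: oner_neq0.
  by exists 0 => k; rewrite mulr0 raddf0 rho_tf0.
- move=> m a f f' [b b0 [w wP]] [b' b0' [w' wP']]; exists (b * b').
    by rewrite mulf_neq0.
  exists ((a * b') *: w + b *: w') => k.
  rewrite linearP rho_tfP // wP -[b *: w']addr0 linearP rho_tfP // wP' raddf0 rho_tf0 //.
  by ring.
- exists 1; first exact: oner_neq0.
  by exists (gone (wedge_alg V)) => k; rewrite ext_map_one rho_tf_one // mul1r.
- move=> m i f ic sf [b b0 [w wP]].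
  have [psi [b' b0' psiP]] := dual_parameters lx acyclic i.
  have [a ea'] := aug_surj X b'; have ea : lam a = b' := ea'.
  exists (b' * b); first by rewrite mulf_neq0.
  exists (mul1 w (wedge_gen psi : wedge_alg V 1)) => k.
  have hP j : (j < c)%N -> lam (a * (j == i)%:R) = cot_form psi (x_ j).
    move=> jc; rewrite psiP // rmorphM ea; case: eqP => _; first by rewrite rmorph1 mulr1.
    by rewrite rmorph0 mulr0.
  rewrite ext_map_mul1 (rho_tf_mul lx cW eW _ _ hP).
  by rewrite kcon_scale (sformZ (rho_tf_form cW _)) wP ea mulrA.
Qed.

Hypothesis O_dvr : is_dvr O.

Lemma form_eval_one (E : gradedAlg O) (v : nat -> E 1%N) N :
  form_eval v (fun k : kos A N 0 => lam (kaug k)) = gone E.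
Proof. by elim: N => //=; rewrite rmorph1 scale1r. Qed.

(** The inverse restricts a class to the Koszul complex of generators of p and
    evaluates the resulting form at the vectors u_i of [dual_retraction]. *)
Lemma ext_map_bij n : bijective (ext_map n).
Proof.
have [N [y [u [ly uP]]]] := dual_retraction X O_dvr.
have [W cW eW] := koszul_compare P ly.
pose v i : wedge_alg V 1 := wedge_gen (u i).
pose r m (x : Ext_tf P m) : wedge_alg V m := form_eval v (rho_tf W x).
have rP m a (x z : Ext_tf P m) : r m (a *: x + z) = a *: r m x + r m z.
  by rewrite /r -form_evalP; congr form_eval; apply/funext => k; rewrite rho_tfP.
have r0 m : r m 0 = 0.
  by have := rP m (- 1) 0 0; rewrite scaler0 addr0 scaleN1r addNr.
have v2 (e : 2%N = (1 + 1)%N) i : gmul e (v i) (v i) = 0 by exact: wedge_gen_sqr.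
have vN (e : 2%N = (1 + 1)%N) i j : gmul e (v i) (v j) = - gmul e (v j) (v i).
  exact: wedge_gen_anti.
have rK m : cancel (ext_map m) (r m).
  move=> w; move: m w; apply: wedge_ind.
  - rewrite ext_map_one -[RHS](form_eval_one v N); congr form_eval; apply/funext => k.
    exact: rho_tf_one.
  - by move=> m a x z ex ez; rewrite linearP rP ex ez.
  - by move=> m; rewrite raddf0 r0.
  - move=> m w psi ew.
    have [h hP] : {h : nat -> A & forall i, lam (h i) = cot_form psi (y i)} :=
      choice (fun i => aug_surj X (cot_form psi (y i))).
    rewrite ext_map_mul1.
    have -> : r m.+1 (mul1 (ext_map m w) (ext_gen psi)) =
        form_eval v (fun k => rho_tf W (ext_map m w) (kcon h k)).
      congr form_eval; apply/funext => k; exact: (rho_tf_mul ly cW eW _ _ (fun i _ => hP i)).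
    rewrite (form_eval_kcon v2 vN h (rho_tf_form cW _)) -/(r m _) ew; congr mul1.
    rewrite /lincomb [in RHS](uP psi) raddf_sum; apply: eq_bigr => i _.
    by rewrite hP -[RHS]/(wedge_gen _) [RHS]linearZ.
exists (r n); first exact: rK.
move=> x.
have [b b0 [w ew]] := ext_map_generic x.
apply/eqP; rewrite -subr_eq0; apply/eqP; apply: (Ext_tf_torsion_free b0).
rewrite scalerBr -linearZ /= -ew.
have -> : b *: r n x = r n (b *: x) by rewrite -[b *: x]addr0 rP r0 addr0.
by rewrite -ew rK subrr.
Qed.

Definition ext_iso : gradedIso (wedge_alg V) (Ext_tf P) :=
  GradedIso ext_map_bij ext_map_one ext_mapM.

End RhoClass.

(** * Naturality *)

Section Naturality.
Local Open Scope ring_scope.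
Variables (O : idomainType) (c : nat) (X Y : augAlg O c) (phi : augHom X Y).
Variables (P : projRes X) (Q : projRes Y).
Local Notation lamX := (aug X : {rmorphism aug_ring X -> O}).
Local Notation lamY := (aug Y : {rmorphism aug_ring Y -> O}).
Local Notation f := (ah_fun phi : {rmorphism aug_ring X -> aug_ring Y}).

Lemma comparison_exists : exists2 U : forall i j, P i -> Q j, cocycle f 0 U &
  forall x, res_eps Q (U 0%N 0%N x) = res_eps P x.
Proof.
apply: (@cocycle_exists O c Y Q (aug_ring X) f P (@res_projective _ _ _ P) 0 (res_eps P)).
  by move=> a x y; rewrite res_epsP /= ah_aug.
exact: res_eps_d.
Qed.

Lemma cot_form_map (psi : dual (cotangent (aug Y))) (a : aug_ring X) : lamX a = 0 ->
  cot_form (dual_map (cot_map phi) psi) a = cot_form psi (phi a).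
Proof.
move=> la; have -> : a = val (@to_submod _ _ (ker_submod (aug X)) a la) by [].
rewrite cot_formE -[phi _]/(val (ker_map phi (@to_submod _ _ (ker_submod (aug X)) a la))).
by rewrite cot_formE; congr (dual_app psi _); apply: cot_mapE.
Qed.

Lemma wedge_map_mul1 (V V' : lmodType O) (h : {linear V -> V'}) n (w : wedge_alg V n) v :
  wedge_map h (mul1 w (wedge_gen v : wedge_alg V 1)) =
  mul1 (wedge_map h w : wedge_alg V' n) (wedge_gen (h v) : wedge_alg V' 1).
Proof.
have sq (e : 2%N = (1 + 1)%N) u :
    gmul e ((@wedge_gen O V' \o h) u : wedge_alg V' 1) ((@wedge_gen O V' \o h) u) = 0.
  exact: wedge_gen_sqr.
have eg : wedge_map h (wedge_gen v) = wedge_gen (h v) :=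
  @wedge_lift_gen O V (wedge_alg V') _ sq v.
rewrite -eg; exact: (@wedge_liftM O V (wedge_alg V') _ sq).
Qed.

Lemma wedge_map_linear (V V' : lmodType O) (h : {linear V -> V'}) n :
  linear (@wedge_map O V V' h n : wedge_alg V n -> wedge_alg V' n).
Proof.
apply: (@wedge_lift_linear O V (wedge_alg V')) => e u; exact: wedge_gen_sqr.
Qed.

Lemma wedge_map_one (V V' : lmodType O) (h : {linear V -> V'}) :
  @wedge_map O V V' h 0 (gone (wedge_alg V)) = gone (wedge_alg V').
Proof.
apply: (@wedge_lift_one O V (wedge_alg V')) => e u; exact: wedge_gen_sqr.
Qed.

Section Comparison.
Variable U : forall i j, P i -> Q j.
Arguments U : clear implicits.
Hypothesis cU : cocycle f 0 U.
Hypothesis eU : forall x, res_eps Q (U 0%N 0%N x) = res_eps P x.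

(** z restricts y along phi when this cocycle of Hom(P, Q) is a coboundary. *)
Definition restr_defect n (z : submod_type (cocycles P n)) (y : submod_type (cocycles Q n)) :
  forall i j, P i -> Q j := fun i j t => U j j (val z i j t) - val y i j (U i i t).

Lemma restr_defect_cocycle n z y : cocycle f n (@restr_defect n z y).
Proof.
have [[lU zU] dU] := cU.
have [[lz zz] dz] := submod_typeP z; have [[ly zy] dy] := submod_typeP y.
have U0 j : U j j 0 = 0.
  by have := lU j j (- 1) 0 0; rewrite scaler0 addr0 /= rmorphN1 scaleN1r addNr.
split; first split.
- move=> i j a s t; rewrite /restr_defect lz lU lU ly /= scalerBr opprD; exact: addrACA.
- by move=> i j t ij; rewrite /restr_defect zz // zy // U0 subr0.
- move=> i j t; rewrite /restr_defect raddfB /= dU dy expr0 scale1r dz scalerBr.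
  rewrite dU expr0 scale1r; congr (_ - _).
  have := lU j j ((- 1) ^+ n) (val z i j (cc_d P i t)) 0.
  by rewrite U0 !addr0 /= rmorphXn rmorphN1.
Qed.

Lemma restr_defectE n z y t : res_eps Q (@restr_defect n z y n 0%N t) =
  res_eps P (val z n 0%N t) - res_eps Q (val y n 0%N (U n n t)).
Proof. by rewrite /restr_defect raddfB /= eU. Qed.

Let null_defect n z y := null (lamY \o f) (fun t => res_eps Q (@restr_defect n z y n 0%N t)).

Lemma null_defect_deg1 psi :
  null_defect (deg1 P (dual_map (cot_map phi) psi)) (deg1 Q psi).
Proof.
have [[lU zU] dU] := cU; rewrite /null_defect.
have [al [ea ez]] := representsE (deg1P P (dual_map (cot_map phi) psi)).
have [be [eb ey]] := representsE (deg1P Q psi).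
have := @cot_form_null O c Y (aug_ring X) f P psi
  (fun x => phi (al x)) (fun x => be (U 0%N 0%N x)).
have -> : (fun x => cot_form psi (phi (al (cc_d P 0 x))) -
    cot_form psi (be (U 0%N 0%N (cc_d P 0 x)))) =
  (fun t => res_eps Q
    (@restr_defect 1 (deg1 P (dual_map (cot_map phi) psi)) (deg1 Q psi) 1%N 0%N t)).
  apply/funext => t; rewrite restr_defectE ez ey dU expr0 scale1r cot_form_map //.
  by rewrite ea res_eps_d.
apply.
- by move=> a x y; rewrite linearP /= rmorphD rmorphM.
- by move=> a x y; rewrite lU linearP.
- by move=> x; rewrite [LHS]ah_aug [RHS]eb eU; exact: ea.
- by move=> x; rewrite eb eU res_eps_d.
Qed.

(** U z z1 - y y1 U = (U z - y U) z1 + y (U z1 - y1 U). *)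
Lemma null_defect_mul n (z : submod_type (cocycles P n)) (y : submod_type (cocycles Q n))
    (z1 : submod_type (cocycles P 1)) (y1 : submod_type (cocycles Q 1)) :
  null_defect z y -> null_defect z1 y1 ->
  null_defect (cocycle_mul (esym (addn1 n)) z z1) (cocycle_mul (esym (addn1 n)) y y1).
Proof.
move=> Nzy /(null_coboundary (@res_projective _ _ _ P) (restr_defect_cocycle z1 y1)) B1.
have M1 := @null_comp_cocycle O (aug_ring X) (aug_ring X) idfun (lamY \o f) P P n 1
  _ (val z1) Nzy (submod_typeP z1).
have M2 := @cocycle_comp_coboundary O (aug_ring Y) (aug_ring X) f lamY P Q n 1
  _ _ (eps_cocycle_form y) (eps_cocycle y) B1.
rewrite addn1 in M1 M2.
have := nullP 1 M1 M2; congr null; apply/funext => t.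
rewrite mul1r !restr_defectE /= /endo_mul /restr_defect.
have [[ly _] _] := submod_typeP y.
by rewrite (linB _ _ (ly n 0%N)) raddfB /= addrA subrK.
Qed.

Lemma ext_map_natural n (w : wedge_alg (dual (cotangent (aug Y))) n) :
  exists z y, [/\ null_defect z y, ext_map Q n w = Ext_tf_class y &
    ext_map P n (wedge_map (dual_map (cot_map phi)) w) = Ext_tf_class z].
Proof.
move: n w; apply: wedge_ind.
- exists (to_submod (endo_one_cocycle P)), (to_submod (endo_one_cocycle Q)).
  split; rewrite ?wedge_map_one ?ext_map_one //.
  by move=> t; rewrite restr_defectE /= !endo_oneE eU subrr.
- move=> n a w w' [z [y [N1 e1 e2]]] [z' [y' [N2 e1' e2']]].
  exists (a *: z + z'), (a *: y + y'); split; last first.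
  + by rewrite wedge_map_linear linearP e2 e2' Ext_tf_classP.
  + by rewrite linearP e1 e1' Ext_tf_classP.
  have := nullP a N1 N2; congr null; apply/funext => t; rewrite !restr_defectE.
  have -> : val (a *: z + z') n 0%N t = a%:A *: val z n 0%N t + val z' n 0%N t by [].
  set s := U n n t.
  have -> : val (a *: y + y') n 0%N s = a%:A *: val y n 0%N s + val y' n 0%N s by [].
  by rewrite !res_epsP !aug_alg; ring.
- move=> n; exists 0, 0; split.
  + have E t : res_eps Q (@restr_defect n 0 0 n 0%N t) = 0.
      rewrite restr_defectE.
      have -> : val (0 : submod_type (cocycles P n)) n 0%N t = 0 by [].
      have -> : val (0 : submod_type (cocycles Q n)) n 0%N (U n n t) = 0 by [].
      by rewrite (raddf0 (res_eps P)) (raddf0 (res_eps Q)) subrr.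
    rewrite /null_defect; case: n E => [|n] E //=; exists (fun=> 0) => // a x x'.
    by rewrite mulr0 addr0.
  + by rewrite raddf0 Ext_tf_class0.
  + have := wedge_map_linear (dual_map (cot_map phi)) (- 1)
      (0 : wedge_alg (dual (cotangent (aug Y))) n) 0.
    by rewrite scaler0 addr0 scaleN1r addNr => ->; rewrite raddf0 Ext_tf_class0.
- move=> n w psi [z [y [N1 e1 e2]]].
  exists (cocycle_mul (esym (addn1 n)) z (deg1 P (dual_map (cot_map phi) psi))),
    (cocycle_mul (esym (addn1 n)) y (deg1 Q psi)); split.
  + by apply: null_defect_mul => //; apply: null_defect_deg1.
  + by rewrite ext_map_mul1 e1 /mul1 Ext_tf_classM.
  + by rewrite wedge_map_mul1 ext_map_mul1 e2 /mul1 Ext_tf_classM.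
Qed.

End Comparison.
End Naturality.

Theorem theorem4 (O : idomainType) (O_dvr : is_dvr O) (c : nat) :
  exists Phi : forall (X : augAlg O c) (P : projRes X),
      gradedIso (wedge_alg (dual (cotangent (aug X)))) (Ext_tf P),
    (forall (X : augAlg O c) (P : projRes X) (psi : dual (cotangent (aug X))),
       exists z : submod_type (cocycles P 1),
         represents psi z /\
         giso (Phi X P) 1 (wedge_gen psi) = Ext_tf_class z) /\
    (forall (X Y : augAlg O c) (phi : augHom X Y)
       (P : projRes X) (Q : projRes Y)
       (n : nat) (w : wedge_alg (dual (cotangent (aug Y))) n),
       Ext_restr phi (giso (Phi Y Q) n w)
         (giso (Phi X P) n (wedge_map (dual_map (cot_map phi)) w))).
Proof.
exists (fun X P => ext_iso P O_dvr); split=> [X P psi|X Y phi P Q n w].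
  exists (deg1 P psi); split; first exact: deg1P.
  exact: ext_map_gen.
have [U cU eU] := comparison_exists phi P Q.
have [z [y [Nzy ey ez]]] := ext_map_natural cU eU w.
have [[lU _] dU] := cU.
exists (fun i => U i i), y, z; split=> //.
  split=> // i x.
  by rewrite dU expr0 scale1r.
exact: (null_coboundary (@res_projective _ _ _ P) (restr_defect_cocycle cU z y) Nzy).
Qed.
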